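(* Let $\omega\mapsto\mathbf X_{[0,T]}(\omega)$ be a random geometric $p$-rough path over $\mathbb R^d$ with $p>2$ (where $T(\omega)$ can also be a random time). Fix $k\ge1$ and $M\in\mathcal L(\mathbb R^d,\mathfrak{so}(k))$, and for $\lambda\in\mathbb R$, $n\ge0$ let $Y^{\lambda,(n)}_T=\frac{\partial^n}{\partial\lambda^n}Y^\lambda_T$, where $Y^\lambda$ solves the linear rough differential equation $dY^\lambda_t=Y^\lambda_t(\lambda M)(d\mathbf X_t)$, $Y^\lambda_0=I_k$. For any $\eta>0$ and any bounded subset $\mathbf K\subset\mathbb R$ there exists $r=r(\eta,\mathbf K,p,k,M)>0$ such that for all $n\ge0$, $$\sup_{\lambda\in\mathbf K}\|Y^{\lambda,(n)}_T\|_{\mathrm{HS}}\le\frac{n!}{r^n}\sqrt k\,e^{\eta}\,e^{\eta\mathbf N(\mathbf X_{[0,T]})},\qquad \sup_{\lambda\in\mathbf K}\|Y^{\lambda,(n)}_T\|_{L^1}\le\frac{n!}{r^n}\sqrt k\,e^{\eta}\,\mathbb E\big[e^{\eta\mathbf N(\mathbf X_{[0,T]})}\big].$$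
   Context: Tensor algebra. $V=\mathbb R^d$ with Euclidean norm; $T((V))=\prod_{n\ge 0}V^{\otimes n}$; $T^N(V)=\bigoplus_{n=0}^N V^{\otimes n}$; multiplication is $\otimes$; $\|\cdot\|_{\otimes n}$ is the projective tensor norm on $V^{\otimes n}$. Rough paths. A $p$-rough path on $[0,T]$ is a continuous map $\mathbf X:\{(s,t):0\le s\le t\le T\}\to T^{\lfloor p\rfloor}(V)$ with $\mathbf X^0_{s,t}=1$, $\mathbf X_{s,u}\otimes\mathbf X_{u,t}=\mathbf X_{s,t}$ for $s\le u\le t$, and for which there is a control $w$ (continuous, superadditive, vanishing on the diagonal) with $\sup_{1\le n\le\lfloor p\rfloor}\big((n/p)!\,\gamma_p\|\mathbf X^n_{s,t}\|_{\otimes n}\big)^{p/n}\le w(s,t)$, where $(n/p)!=\Gamma(n/p+1)$ and $\gamma_p$ depends only on $p$. The $p$-variation distance on $[s,t]$ is $\|\mathbf X;\mathbf Y\|_{p\text{-var};[s,t]}^p=\sum_{n=1}^{\lfloor p\rfloor}\sup_{\mathcal D}\sum_{t_j\in\mathcal D}\|\mathbf X^n_{t_j,t_{j+1}}-\mathbf Y^n_{t_j,t_{j+1}}\|_{\otimes n}^{p/n}$ over dissections $\mathcal D$ of $[s,t]$, and the $p$-variation norm is $\|\mathbf X\|_{p\text{-var};[s,t]}^p=\sum_{n=1}^{\lfloor p\rfloor}\sup_{\mathcal D}\sum_{t_j\in\mathcal D}\|\mathbf X^n_{t_j,t_{j+1}}\|_{\otimes n}^{p/n}$. Geometric $p$-rough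 paths ($G\Omega_p(V)$) are limits in $p$-variation distance of truncated signatures $S_{\lfloor p\rfloor}(X)=(1,S(X)^1,\dots,S(X)^{\lfloor p\rfloor})$ of continuous bounded variation paths $X$, where $S(X)^n_{s,t}=\int_{s<s_1<\dots<s_n<t}dX_{s_1}\otimes\cdots\otimes dX_{s_n}$. A random geometric $p$-rough path is a random element $\mathbf X_{[0,T]}(\omega)$ of geometric $p$-rough paths on $[0,T(\omega)]$. Rough differential equations. A path $Y$ of finite $p$-variation solves $dY_t=Y_t(\lambda M)(d\mathbf X_t)$, $Y_0=I_k$, if there are continuous bounded variation paths $X(m)$ with $\|S_{\lfloor p\rfloor}(X(m));\mathbf X\|_{p\text{-var};[0,T]}\to0$ such that the solutions of $dY(m)_t=Y(m)_t(\lambda M)(dX(m)_t)$, $Y(m)_0=I_k$, converge to $Y$ uniformly on $[0,T]$. (Such a solution exists, is unique, equals $\sum_n\lambda^nM^{\otimes n}(S(\mathbf X)^n_{0,t})$, where $S(\mathbf X)$ is the Lyons extension, and is smooth in $\lambda$.) Greedy count. $\tau_0=0$, $\tau_{j+1}=\inf\{t>\tau_j:\|\mathbf X\|_{p\text{-var},[\tau_j,t]}\ge1\}\wedge T$, and $\mathbf N(\mathbf X_{[0,T]})=\sup\{j\ge0:\tau_j<T\}$. Norms. $\|\cdot\|_{\mathrm{HS}}$ is the Hilbert–Schmidt norm; $\|Z\|_{L^1}=\mathbb E[\|Z\|_{\mathrm{HS}}]$ for a random matrix $Z$. $\mathfrak{so}(k)$ is the space of real antisymmetric $k\times k$ matrices;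 $\mathcal L(\cdot,\cdot)$ denotes linear maps. *)

(* Defs.v *)
From HB Require Import structures.
From mathcomp Require Import all_boot all_order all_algebra.
From mathcomp Require Import all_classical all_reals all_analysis.

Set Implicit Arguments.
Unset Strict Implicit.
Unset Printing Implicit Defensive.

Import Order.TTheory GRing.Theory Num.Theory.
Import numFieldNormedType.Exports.

Local Open Scope classical_set_scope.
Local Open Scope ring_scope.

(* On row vectors this is the Euclidean norm. *)
Definition hs_norm (R : realType) (m n : nat) (A : 'M[R]_(m, n)) : R :=
  Num.sqrt (\sum_i \sum_j A i j ^+ 2).

Definition so (R : realType) (k : nat) : set 'M[R]_k :=
  [set A | A^T = - A].

(** * Tensors over V = R^d, in coordinates with respect to the canonical basis *)

Notation tensor R d n := {ffun n.-tuple 'I_d -> R^o}.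

Definition pure_tensor (R : realType) (d n : nat) (v : 'I_n -> 'rV[R]_d) :
    tensor R d n :=
  [ffun I => \prod_(j < n) v j 0 (tnth I j)].

(* The scalars c can be absorbed in the vectors when 0 < n; for n = 0 they make
   this the absolute value on V^{\otimes 0} = R. *)
Definition proj_norm (R : realType) (d n : nat) (u : tensor R d n) : R :=
  inf [set x | exists (m : nat) (c : 'I_m -> R) (v : 'I_m -> 'I_n -> 'rV[R]_d),
         u = \sum_(l < m) c l *: pure_tensor (v l)
      /\ x = \sum_(l < m) `|c l| * \prod_(j < n) hs_norm (v l j)].

(* T((V)): the coefficient of e_{i_1} \otimes ... \otimes e_{i_n} is the value at
   the word [:: i_1; ...; i_n]. *)
Definition tseries (R : realType) (d : nat) : Type := seq 'I_d -> R.

Definition level (R : realType) (d n : nat) (x : tseries R d) : tensor R d n :=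
  [ffun I : n.-tuple 'I_d => x I].

(* T^N(V), as a subspace of T((V)). *)
Definition trunc_tensors (R : realType) (d N : nat) : set (tseries R d) :=
  [set x | forall w, (N < size w)%N -> x w = 0].

Definition trunc (R : realType) (d N : nat) (x : tseries R d) : tseries R d :=
  fun w => if (size w <= N)%N then x w else 0.

Definition tmul (R : realType) (d : nat) (x y : tseries R d) : tseries R d :=
  fun w => \sum_(i < (size w).+1) x (take i w) * y (drop i w).

(** * Dissections and p-variation *)

(* A dissection a = t_0 < t_1 < ... < t_n = b is represented, as in
   [itv_partition], by the list t_1, ..., t_n; this sums f over the pairs
   (t_j, t_{j+1}). *)
Definition dissection_sum (R : realType) (f : R -> R -> R) (a : R) (D : seq R) : R :=
  \sum_(uv <- zip (a :: D) D) f uv.1 uv.2.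

Definition sup_dissections (R : realType) (f : R -> R -> R) (a b : R) : \bar R :=
  ereal_sup [set (dissection_sum f a D)%:E | D in [set D | itv_partition a b D]].

Definition pvar_norm (R : realType) (d : nat) (p : R) (X : R -> R -> tseries R d)
    (s t : R) : \bar R :=
  ((\sum_(1 <= n < (Num.truncn p).+1)
      sup_dissections
        (fun u v => proj_norm (level n (X u v)) `^ (p / n%:R))%R s t) `^ p^-1)%E.

Definition pvar_dist (R : realType) (d : nat) (p : R) (X Y : R -> R -> tseries R d)
    (s t : R) : \bar R :=
  ((\sum_(1 <= n < (Num.truncn p).+1)
      sup_dissections
        (fun u v => proj_norm (level n (X u v) - level n (Y u v)) `^ (p / n%:R))%R
        s t) `^ p^-1)%E.

(* Finite p-variation on [0, T]; p = 1 is bounded variation. *)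
Definition finite_pvar (R : realType) (m n : nat) (p T : R) (f : R -> 'M[R]_(m, n)) :
    Prop :=
  (sup_dissections (fun u v => hs_norm (f v - f u) `^ p)%R 0%R T < +oo)%E.

(** * Rough paths *)

Definition simplex (R : realType) (T : R) : set (R * R) :=
  [set st | 0 <= st.1 /\ st.1 <= st.2 /\ st.2 <= T].

Definition is_control (R : realType) (T : R) (w : R -> R -> R) : Prop :=
  [/\ {within simplex T, continuous (fun st : R * R => w st.1 st.2)},
      forall s t, simplex T (s, t) -> 0 <= w s t,
      forall s u t, 0 <= s -> s <= u -> u <= t -> t <= T ->
        w s u + w u t <= w s t
    & forall t, 0 <= t <= T -> w t t = 0].

Definition Gamma_fun (R : realType) (x : R) : R :=
  \int[@lebesgue_measure R]_(t in `]0, +oo[) (t `^ (x - 1) * expR (- t)).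

Definition frac_fact (R : realType) (x : R) : R := Gamma_fun (x + 1).

(* [gamma] is the normalising constant \gamma_p of the p-variation estimate.
   Values of X outside the simplex are irrelevant. *)
Definition is_rough_path (R : realType) (d : nat) (p gamma T : R)
    (X : R -> R -> tseries R d) : Prop :=
  let N := Num.truncn p in
  [/\ forall s t, simplex T (s, t) -> trunc_tensors N (X s t),
      forall w, {within simplex T, continuous (fun st : R * R => X st.1 st.2 w)},
      forall s t, simplex T (s, t) -> X s t [::] = 1,
      forall s u t, 0 <= s -> s <= u -> u <= t -> t <= T ->
        X s t = trunc N (tmul (X s u) (X u t))
    & exists w, is_control T w /\
        forall s t, simplex T (s, t) -> forall n : nat, (1 <= n <= N)%N ->
          (frac_fact (n%:R / p) * gamma * proj_norm (level n (X s t)))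
            `^ (p / n%:R) <= w s t].

(** * Riemann-Stieltjes integrals and signatures *)

Definition is_RSint (R : realType) (f g : R -> R) (a b I : R) : Prop :=
  forall e, 0 < e -> exists2 delta, 0 < delta &
    forall (D : seq R) (xi : nat -> R), itv_partition a b D ->
      (forall i, (i < size D)%N ->
         [/\ nth b (a :: D) i <= xi i, xi i <= nth b D i
           & nth b D i - nth b (a :: D) i < delta]) ->
      `|\sum_(0 <= i < size D) f (xi i) * (g (nth b D i) - g (nth b (a :: D) i)) - I|
        < e.

(* The value of the integral of f dg over [a, b] if it exists, and 0 otherwise;
   it exists for f continuous and g of bounded variation on [a, b]. *)
Definition RSint (R : realType) (f g : R -> R) (a b : R) : R :=
  xget 0 [set I | is_RSint f g a b I].

(* The integral of Y dA over [a, b], for matrix-valued Y and A. *)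
Definition RSint_mx (R : realType) (k : nat) (Y A : R -> 'M[R]_k) (a b : R) :
    'M[R]_k :=
  \matrix_(i, j) \sum_l RSint (fun s => Y s i l) (fun s => A s l j) a b.

Definition continuous_bv_path (R : realType) (d : nat) (T : R) (X : R -> 'rV[R]_d) :
    Prop :=
  {within `[0, T], continuous X} /\ finite_pvar 1 T X.

(* The iterated integral over s < s_1 < ... < s_n < t for the word
   [:: i_n; ...; i_1], outermost variable s_n first. *)
Fixpoint iterated_int (R : realType) (d : nat) (X : R -> 'rV[R]_d) (w : seq 'I_d)
    (s t : R) : R :=
  if w is i :: w' then
    RSint (fun u => iterated_int X w' s u) (fun u => X u 0 i) s t
  else 1.

Definition signature (R : realType) (d : nat) (X : R -> 'rV[R]_d) (s t : R) :
    tseries R d :=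
  fun w => iterated_int X (rev w) s t.

Definition trunc_signature (R : realType) (d N : nat) (X : R -> 'rV[R]_d) (s t : R) :
    tseries R d :=
  trunc N (signature X s t).

Definition approximates (R : realType) (d : nat) (p T : R)
    (Xm : nat -> R -> 'rV[R]_d) (X : R -> R -> tseries R d) : Prop :=
  (forall m, continuous_bv_path T (Xm m)) /\
  (fun m => pvar_dist p (trunc_signature (Num.truncn p) (Xm m)) X 0 T)
    @ \oo --> 0%E.

Definition is_geometric_rough_path (R : realType) (d : nat) (p gamma T : R)
    (X : R -> R -> tseries R d) : Prop :=
  is_rough_path p gamma T X /\
  exists Xm : nat -> R -> 'rV[R]_d, approximates p T Xm X.

(* Measurability is with respect to the sigma-algebra generated by the
   evaluations; since the domain [0, T omega] is random, the path is evaluated at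
   the times stopped at T omega. *)
Definition is_random_geometric_rough_path (R : realType) (disp : measure_display)
    (Omega : measurableType disp) (P : probability Omega R) (d : nat) (p gamma : R)
    (T : {RV P >-> R}) (X : Omega -> R -> R -> tseries R d) : Prop :=
  [/\ forall omega, 0 <= T omega,
      forall omega, is_geometric_rough_path p gamma (T omega) (X omega)
    & forall (s t : R) (w : seq 'I_d), 0 <= s -> s <= t ->
        measurable_fun setT
          (fun omega => X omega (Num.min s (T omega)) (Num.min t (T omega)) w)].

(** * Linear rough differential equations dY = Y A(dX), Y_0 = I *)

(* For linear A, the driving differential A(dX_t) is that of t |-> A(X_t). *)
Definition solves_linear_ode (R : realType) (d k : nat) (T : R)
    (A : 'rV[R]_d -> 'M[R]_k) (X : R -> 'rV[R]_d) (Y : R -> 'M[R]_k) : Prop :=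
  {within `[0, T], continuous Y} /\
  forall t, 0 <= t <= T -> Y t = 1%:M + RSint_mx Y (fun s => A (X s)) 0 t.

Definition solves_linear_rde (R : realType) (d k : nat) (p T : R)
    (A : 'rV[R]_d -> 'M[R]_k) (X : R -> R -> tseries R d) (Y : R -> 'M[R]_k) : Prop :=
  finite_pvar p T Y /\
  exists (Xm : nat -> R -> 'rV[R]_d) (Ym : nat -> R -> 'M[R]_k),
    [/\ approximates p T Xm X,
        forall m, solves_linear_ode T A (Xm m) (Ym m)
      & forall e, 0 < e -> exists m0 : nat, forall m : nat, (m0 <= m)%N ->
          forall t, 0 <= t <= T -> hs_norm (Ym m t - Y t) < e].

Definition deriv_param (R : realType) (k n : nat) (f : R -> 'M[R]_k) (x : R) : 'M[R]_k :=
  \matrix_(i, j) derive1n n (fun y => f y i j) x.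

(** * The greedy count *)

(* The infimum of the admissible times t in ]a, T], capped at T; adding T to the
   set performs the capping, and gives T when no t is admissible. *)
Definition greedy_next (R : realType) (d : nat) (p T : R) (X : R -> R -> tseries R d)
    (a : R) : R :=
  inf ([set t | a < t <= T /\ (1 <= pvar_norm p X a t)%E] `|` [set T]).

Definition greedy_time (R : realType) (d : nat) (p T : R) (X : R -> R -> tseries R d)
    (j : nat) : R :=
  iter j (greedy_next p T X) 0.

(* The supremum is taken in [0, +oo], so that the count is 0 when T = 0. *)
Definition greedy_count (R : realType) (d : nat) (p T : R)
    (X : R -> R -> tseries R d) : \bar R :=
  maxe 0%E
    (ereal_sup [set (j%:R)%:E | j in [set j : nat | greedy_time p T X j < T]]).

(* Main.v *)
(** Fix lambda in K. For a word w = i_1...i_n put m_w = m_{i_1} ... m_{i_n}, where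
   m_i = (lambda + mu) M(e_i) is a polynomial in mu, and let P_{s,t} be the sum of
   X_{s,t}(w) m_w over the words w of length at most p. By Chen's relation P is
   multiplicative up to O(omega(s,t)^theta), theta = (floor(p) + 1)/p > 1, omega
   being the p-variation control of X, so a sewing argument bounds the products of
   P over the partitions of an interval, and shows that they converge to the
   solution Y^{lambda+mu}. The bound holds in the Wiener norm
   |Q|_r = sum_n |Q_n|_HS r^n of polynomials Q = sum_n Q_n mu^n; on a greedy
   interval, where omega <= 1, it is |Q|_1 <= C with C independent of X.

   At mu = 0 the driving matrices are antisymmetric, so the constant coefficient
   Q_0 of such a product is orthogonal in the limit and multiplication by it
   preserves the Hilbert-Schmidt norm, while |Q - Q_0|_r <= r |Q|_1 <= r C. For r
   small, each greedy interval thus multiplies the Wiener norm by at most e^eta.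
   The products over [0, T] therefore have Wiener norm at most
   sqrt(k) e^{eta (N + 1)}, and so has their limit, the Taylor series of
   mu |-> Y^{lambda+mu}_T; this is the bound on the derivatives, without any
   complex analysis. *)

Require Import Defs.
From HB Require Import structures.
From mathcomp Require Import all_boot all_order all_algebra.
From mathcomp Require Import all_classical all_reals all_analysis.
From mathcomp Require Import ring lra zify.

Set Implicit Arguments.
Unset Strict Implicit.
Unset Printing Implicit Defensive.

Import Order.TTheory GRing.Theory Num.Theory.
Import numFieldNormedType.Exports.

Local Open Scope classical_set_scope.
Local Open Scope ring_scope.

(** * Riemann-Stieltjes integrals against integrators of bounded variation *)

(** The factors P are built from X, and neither they nor their finite products need be orthogonal.
    Orthogonality belongs to the solutions driven by the bounded variation paths [Xm] and has to be
    carried over to X. For this, products along [Xm] must follow the solution for all partitions of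
    mesh below a delta that does not depend on m. The p-variation controls of the signatures of [Xm]
    are therefore bounded, and made small on short intervals, uniformly in large m, by comparison
    with X. Once delta is fixed, a partition is chosen, and m tends to infinity in a finite product.

    The constants must not depend on X, which is what the normalisation of the greedy times
    provides. At a greedy time the p-variation norm may already be 1 or more, so the last partition
    step before it is treated apart and costs a factor 2. The Wiener norm of radius 1 serves to find
    C; then r is chosen with 2 r C <= eta / 2, which leaves eta / 2 for the almost orthogonal
    constant coefficient. Polynomials with matrix coefficients are never completed: limits are taken
    coefficient by coefficient. *)

Section RiemannStieltjes.
Variable R : realType.
Implicit Types (a b s t u e : R) (f g : R -> R) (V : R -> R -> R).

(* Unlike [is_control], this requires no continuity. *)
Definition ctrl a b V :=
  (forall s t, a <= s -> s <= t -> t <= b -> 0 <= V s t) /\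
  (forall s u t, a <= s -> s <= u -> u <= t -> t <= b -> V s u + V u t <= V s t).

Definition dominates a b V g :=
  forall s t, a <= s -> s <= t -> t <= b -> `|g t - g s| <= V s t.

Definition ucont a b f :=
  forall e, 0 < e -> exists2 delta, 0 < delta &
    forall s t, a <= s -> s <= t -> t <= b -> t - s < delta -> `|f t - f s| <= e.

(* An e-tagged partition of [a, b] is a list of pairs (t_i, y_i) such that f is
   within e of y_i on [t_{i-1}, t_i]; unlike a tag in the interval, y_i survives
   the splitting of [t_{i-1}, t_i]. *)
Fixpoint tagged f e a b (E : seq (R * R)) : Prop :=
  if E is (t, y) :: E' then
    [/\ a <= t, forall x, a <= x -> x <= t -> `|f x - y| <= e & tagged f e t b E']
  else a = b.

Fixpoint rs_sum g a (E : seq (R * R)) : R :=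
  if E is (t, y) :: E' then y * (g t - g a) + rs_sum g t E' else 0.

Lemma ctrl_sub a b a' b' V : a <= a' -> b' <= b -> ctrl a b V -> ctrl a' b' V.
Proof.
move=> aa bb [V0 Vs]; split=> [s t s1 st tb|s u t s1 su ut tb].
  by apply: V0 => //; lra.
by apply: Vs => //; lra.
Qed.

Lemma ctrl_diag a b V t : ctrl a b V -> a <= t -> t <= b -> V t t = 0.
Proof.
move=> [V0 Vs] h1 h2; have := Vs t t t h1 (lexx _) (lexx _) h2.
have := V0 t t h1 (lexx _) h2; lra.
Qed.

Lemma ctrl_mono a b V s u v t : ctrl a b V -> a <= s -> s <= u -> u <= v ->
  v <= t -> t <= b -> V u v <= V s t.
Proof.
move=> [V0 Vs] h1 h2 h3 h4 h5.
have := Vs s u t h1 h2 (le_trans h3 h4) h5.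
have := Vs u v t (le_trans h1 h2) h3 h4 h5.
have := V0 s u h1 h2 (le_trans h3 (le_trans h4 h5)).
have := V0 v t (le_trans (le_trans h1 h2) h3) h4 h5; lra.
Qed.

Lemma tagged_le f e a b E : tagged f e a b E -> a <= b.
Proof.
by elim: E a => [a ->//|[t y] E IH a /= [at_ _ /IH]]; exact: le_trans.
Qed.

Lemma tagged_cat f e a b c E1 E2 :
  tagged f e a b E1 -> tagged f e b c E2 -> tagged f e a c (E1 ++ E2).
Proof.
elim: E1 a => [a -> //|[t y] E IH a /= [at_ fy h] h2]; split=> //.
exact: IH.
Qed.

Lemma rs_sum_cat f e g a b E1 E2 :
  tagged f e a b E1 -> rs_sum g a (E1 ++ E2) = rs_sum g a E1 + rs_sum g b E2.
Proof.
elim: E1 a => [a /= ->|[t y] E IH a /=]; first by rewrite add0r.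
by move=> [at_ fy h]; rewrite IH // addrA.
Qed.

Lemma rs_sum_diag f e g a E : tagged f e a a E -> rs_sum g a E = 0.
Proof.
elim: E => [//|[t y] E IH] /= [at_ _ h].
have ta : t = a by apply/eqP; rewrite eq_le at_ (tagged_le h).
by subst t; rewrite subrr mulr0 add0r IH.
Qed.

(** The partitions are merged one point at a time: the earlier of the two first points cuts the
    first interval of the other partition, which keeps its tag. On the common piece both tags are
    near the same values of f, so they differ by at most e1 + e2; superadditivity of V adds up the
    pieces. *)
Lemma rs_sum_close f g V e1 e2 lo a b E1 E2 : ctrl lo b V -> dominates lo b V g ->
  0 <= e1 -> 0 <= e2 -> lo <= a -> tagged f e1 a b E1 -> tagged f e2 a b E2 ->
  `|rs_sum g a E1 - rs_sum g a E2| <= (e1 + e2) * V a b.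
Proof.
move=> cV dV e10 e20.
have [n] := ubnP (size E1 + size E2); elim: n a E1 E2 => // n IH a.
have triv E : lo <= a -> a = b -> tagged f e1 a b E \/ tagged f e2 a b E ->
    rs_sum g a E = 0 /\ 0 <= (e1 + e2) * V a b.
  move=> la ab h; subst b; split; first by case: h => /rs_sum_diag.
  by rewrite mulr_ge0 ?addr_ge0 // cV.1.
case=> [|[t y] E1]; first move=> E2 _ la /= ab h.
  by have [-> ?] := triv E2 la ab (or_intror h); rewrite subrr normr0.
case=> [|[u z] E2]; first move=> _ la h /= ab.
  by have [/= -> ?] := triv _ la ab (or_introl h); rewrite subrr normr0.
rewrite /= => hn la [at_ fy h1] [au fz h2].
have tb := tagged_le h1; have ub := tagged_le h2.
have yz : `|y - z| <= e1 + e2.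
  have := fy a (lexx _) at_; have := fz a (lexx _) au.
  rewrite !ler_norml => /andP[p1 p2] /andP[p3 p4]; apply/andP; split; lra.
have key c S1 S2 : a <= c -> c <= b -> `|S1 - S2| <= (e1 + e2) * V c b ->
    `|(y * (g c - g a) + S1) - (z * (g c - g a) + S2)| <= (e1 + e2) * V a b.
  move=> ac cb hS.
  have -> : (y * (g c - g a) + S1) - (z * (g c - g a) + S2) =
            (y - z) * (g c - g a) + (S1 - S2) by ring.
  apply: (le_trans (ler_normD _ _)).
  have hV := cV.2 a c b la ac cb (lexx _).
  have : `|(y - z) * (g c - g a)| <= (e1 + e2) * V a c.
    by rewrite normrM ler_pM // dV.
  have : (e1 + e2) * (V a c + V c b) <= (e1 + e2) * V a b.
    by rewrite ler_wpM2l // addr_ge0.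
  lra.
case: (leP t u) => tu.
  have hn' : (size E1 + size ((u, z) :: E2) < n)%N by rewrite /=; lia.
  have h2' : tagged f e2 t b ((u, z) :: E2).
    by split=> // x tx xu; apply: fz => //; lra.
  have /= hS := IH t E1 _ hn' (le_trans la at_) h1 h2'.
  have -> : z * (g u - g a) + rs_sum g u E2 =
    z * (g t - g a) + (z * (g u - g t) + rs_sum g u E2) by ring.
  exact: key.
have hn' : (size ((t, y) :: E1) + size E2 < n)%N by rewrite /=; lia.
have h1' : tagged f e1 u b ((t, y) :: E1).
  by split=> //; [exact: ltW|move=> x tx xu; apply: fy => //; lra].
have /= hS := IH u _ E2 hn' (le_trans la au) h1' h2.
have -> : y * (g t - g a) + rs_sum g t E1 =
    y * (g u - g a) + (y * (g t - g u) + rs_sum g t E1) by ring.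
exact: key.
Qed.

End RiemannStieltjes.

Lemma eq_eps (R : realType) (C x y : R) :
  (forall e, 0 < e -> `|x - y| <= C * e) -> x = y.
Proof.
move=> h; apply/eqP; rewrite -subr_eq0 -normr_le0; apply/ler_addgt0Pr => e e0.
rewrite add0r; have C0 : 0 <= C by have := h 1 ltr01; have := normr_ge0 (x - y); lra.
have := h (e / (C + 1)) _; rewrite divr_gt0 ?ltr_wpDl // => /(_ isT)/le_trans; apply.
rewrite mulrA ler_pdivrMr ?ltr_wpDl // mulrC ler_wpM2l //; lra.
Qed.

(** * Partitions of small mesh; existence, additivity and linearity of the integral *)

Section Partitions.
Variable R : realType.
Implicit Types (a b s t u e delta : R) (f g : R -> R) (V : R -> R -> R).

Fixpoint part delta a b (D : seq R) : Prop :=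
  if D is t :: D' then [/\ a < t, t - a < delta & part delta t b D'] else a = b.

Lemma part_le delta a b D : part delta a b D -> a <= b.
Proof.
by elim: D a => [a ->//|t D IH a /= [/ltW at_ _ /IH]]; exact: le_trans.
Qed.

Lemma part_cat delta a b c D1 D2 :
  part delta a b D1 -> part delta b c D2 -> part delta a c (D1 ++ D2).
Proof.
elim: D1 a => [a -> //|t D IH a /= [at_ h1 h] h2]; split=> //; exact: IH.
Qed.

Lemma part_weaken delta delta' a b D : delta <= delta' -> part delta a b D ->
  part delta' a b D.
Proof.
move=> dd; elim: D a => [//|t D IH a /= [at_ h1 h]]; split=> //; last exact: IH.
exact: lt_le_trans h1 dd.
Qed.

Lemma part_itv delta a b D : part delta a b D -> itv_partition a b D.
Proof.
rewrite /itv_partition; elim: D a => [a -> //=|t D IH a /= [-> h1 /IH[]]] //.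
Qed.

Lemma part_exists delta a b : 0 < delta -> a <= b -> exists D, part delta a b D.
Proof.
move=> d0 ab.
have [n] : exists n : nat, b - a < delta / 2 * n%:R.
  exists (Num.Def.archi_bound ((b - a) / (delta / 2))).
  rewrite mulrC -ltr_pdivrMr ?divr_gt0 //; apply: archi_boundP.
  by rewrite divr_ge0 ?subr_ge0 // ltW ?divr_gt0.
elim: n a ab => [a ab|n IH a ab hn]; first by rewrite mulr0; lra.
have [eab|nab] := eqVneq a b; first by exists [::].
have {}ab : a < b by rewrite lt_neqAle nab.
have [h|h] := ltP (b - a) delta; first by exists [:: b].
have [||D hD] := IH (a + delta / 2); first lra.
  by move: hn; rewrite -[n.+1%:R]natr1; lra.
exists (a + delta / 2 :: D); split=> //; lra.
Qed.

Lemma ucont_sub a b a' b' f : a <= a' -> b' <= b -> ucont a b f -> ucont a' b' f.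
Proof.
move=> aa bb uf e e0; have [dl d0 h] := uf e e0; exists dl => // s t h1 h2 h3.
by apply: h; lra.
Qed.

Lemma dominates_sub a b a' b' V g : a <= a' -> b' <= b -> dominates a b V g ->
  dominates a' b' V g.
Proof. by move=> aa bb dV s t h1 h2 h3; apply: dV; lra. Qed.

Fixpoint left_tags f a (D : seq R) :=
  if D is t :: D' then (t, f a) :: left_tags f t D' else [::].

Lemma left_tagsP f e delta a b D :
  (forall s t, a <= s -> s <= t -> t <= b -> t - s < delta -> `|f t - f s| <= e) ->
  part delta a b D -> tagged f e a b (left_tags f a D).
Proof.
elim: D a => [//|t D IH a h /= [at_ ta hD]]; split; first exact: ltW.
  by move=> x ax xt; apply: h; rewrite ?lexx //; have := part_le hD; lra.
by apply: IH => // s u ts su ub; apply: h => //; lra.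
Qed.

Lemma tagged_exists f e a b : ucont a b f -> 0 < e -> a <= b ->
  exists E, tagged f e a b E.
Proof.
move=> uf e0 ab; have [dl d0 h] := uf e e0; have [D hD] := part_exists d0 ab.
by exists (left_tags f a D); exact: left_tagsP hD.
Qed.

Fixpoint point_tags f (xi : nat -> R) (D : seq R) :=
  if D is t :: D' then (t, f (xi 0%N)) :: point_tags f (xi \o S) D' else [::].

Lemma point_tags_sum f g xi a b D :
  \sum_(0 <= i < size D) f (xi i) * (g (nth b D i) - g (nth b (a :: D) i)) =
  rs_sum g a (point_tags f xi D).
Proof.
elim: D xi a => [|t D IH] xi a; first by rewrite big_nil.
by rewrite big_nat_recl //= -IH.
Qed.

Lemma point_tagsP f e delta xi a b D :
  (forall s t, a <= s -> s <= t -> t <= b -> t - s < delta -> `|f t - f s| <= e) ->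
  itv_partition a b D ->
  (forall i, (i < size D)%N ->
         [/\ nth b (a :: D) i <= xi i, xi i <= nth b D i
           & nth b D i - nth b (a :: D) i < delta]) ->
  tagged f e a b (point_tags f xi D).
Proof.
elim: D xi a => [|t D IH] xi a h hD hx; first exact: itv_partition_nil hD.
have at_ : a < t by case: hD => /= /andP[].
have tb := itv_partition_le (itv_partition_cons hD).
have [/= h1 h2 h3] := hx 0%N isT.
split; first exact: ltW.
- move=> x ax xt; have [?|?] := leP x (xi 0%N).
    by rewrite distrC; apply: h => //; lra.
  by apply: h; lra.
- apply: IH; [|exact: itv_partition_cons hD|].
    by move=> s u ts su ub; apply: h => //; lra.
  by move=> i hi; exact: (hx i.+1).
Qed.

Section Integral.
Variables (f g : R -> R) (V : R -> R -> R) (a b : R).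
Hypotheses (ab : a <= b) (uf : ucont a b f) (cV : ctrl a b V) (dV : dominates a b V g).

(** The integral is the supremum of the numbers [rs_sum g a E - e * V a b]. By [rs_sum_close] each
    of them lies below every [rs_sum g a E + e * V a b], so the supremum is within e V(a, b) of
    every e-tagged sum. *)
Let RS_exists : exists I, is_RSint f g a b I /\
  forall e E, 0 <= e -> tagged f e a b E -> `|rs_sum g a E - I| <= e * V a b.
Proof.
have V0 : 0 <= V a b by apply: cV.1.
pose S := [set x | exists e E, [/\ 0 <= e, tagged f e a b E & x = rs_sum g a E - e * V a b]].
have close e1 e2 E1 E2 := @rs_sum_close _ f g V e1 e2 a a b E1 E2 cV dV.
have ubS e E : 0 <= e -> tagged f e a b E -> ubound S (rs_sum g a E + e * V a b).
  move=> e0 hE x [e' [E' [e'0 hE' ->]]].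
  have := close e' e E' E e'0 e0 (lexx _) hE' hE.
  rewrite ler_norml => /andP[]; lra.
have key e E : 0 <= e -> tagged f e a b E -> `|rs_sum g a E - sup S| <= e * V a b.
  move=> e0 hE; rewrite ler_norml; apply/andP; split.
    have h : sup S <= rs_sum g a E + e * V a b.
      apply: sup_le_ub; last exact: ubS.
      by exists (rs_sum g a E - e * V a b), e, E.
    lra.
  have h : rs_sum g a E - e * V a b <= sup S.
    apply: ub_le_sup; first by exists (rs_sum g a E + e * V a b); exact: ubS.
    by exists e, E.
  lra.
exists (sup S); split=> // e e0.
have V1 : 0 < V a b + 1 by rewrite ltr_wpDl.
have e1 : 0 < e / (V a b + 1) by rewrite divr_gt0.
have [dl d0 h] := uf e1; exists dl => // D xi hD hxi.
rewrite point_tags_sum.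
apply: le_lt_trans (key _ _ (ltW e1) (point_tagsP h hD hxi)) _.
by rewrite mulrAC ltr_pdivrMr // ltr_pM2l //; lra.
Qed.

Lemma RSint_close e E : 0 <= e -> tagged f e a b E ->
  `|rs_sum g a E - RSint f g a b| <= e * V a b.
Proof.
have [I [hI cI]] := RS_exists.
suff -> : RSint f g a b = I by exact: cI.
(* [xget] returns some value of the integral, not a priori I. Both values are compared with one
   Riemann sum, over a fine partition tagged at right endpoints. *)
rewrite /RSint; set J := xget _ _.
have hJ : is_RSint f g a b J by apply: (@xgetPex _ 0 [set I | is_RSint f g a b I]); exists I.
apply: (@eq_eps _ 2) => e' e'0.
have [d1 d10 h1] := hI e' e'0; have [d2 d20 h2] := hJ e' e'0.
have [D hD] : exists D, part (Num.min d1 d2) a b D.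
  by apply: part_exists => //; rewrite lt_min d10.
have hx : forall i, (i < size D)%N ->
    [/\ nth b (a :: D) i <= nth b D i, nth b D i <= nth b D i
      & nth b D i - nth b (a :: D) i < Num.min d1 d2].
  elim: D a {h1 h2 hI hJ} hD => [//|t D IH] c /= [ct tc hD] [|i] /=.
    by rewrite ltW.
  by rewrite ltnS => /(IH _ hD).
have := h1 D (nth b D) (part_itv hD); have := h2 D (nth b D) (part_itv hD).
set s := \sum_(_ <= _ < _) _ => /(_ _)/wrap[|k2 /(_ _)/wrap[|k1]].
- by move=> i /hx[? ?]; rewrite lt_min => /andP[].
- by move=> i /hx[? ?]; rewrite lt_min => /andP[].
have -> : J - I = (s - I) - (s - J) by ring.
by apply: le_trans (ler_normB _ _) _; lra.
Qed.

Lemma RSint_unique C J :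
  (forall e, 0 < e -> exists2 E, tagged f e a b E & `|rs_sum g a E - J| <= C * e) ->
  RSint f g a b = J.
Proof.
move=> h; apply: (@eq_eps _ (V a b + C)) => e e0; have [E hE hJ] := h e e0.
have := RSint_close (ltW e0) hE.
have -> : RSint f g a b - J = (rs_sum g a E - J) - (rs_sum g a E - RSint f g a b) by ring.
by move=> h1; apply: le_trans (ler_normB _ _) _; lra.
Qed.

Lemma RSint_near e y : 0 <= e -> (forall x, a <= x -> x <= b -> `|f x - y| <= e) ->
  `|RSint f g a b - y * (g b - g a)| <= e * V a b.
Proof.
move=> e0 h; have := @RSint_close e [:: (b, y)] e0; rewrite /= addr0 distrC; apply.
by split.
Qed.

Lemma RSint_bound e : 0 <= e -> (forall x, a <= x -> x <= b -> `|f x| <= e) ->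
  `|RSint f g a b| <= e * V a b.
Proof.
move=> e0 h; have := @RSint_near e 0 e0; rewrite mul0r subr0; apply => x ? ?.
by rewrite subr0; exact: h.
Qed.

End Integral.

Lemma RSint_cst f g V y a b : a <= b -> ctrl a b V -> dominates a b V g ->
  (forall x, a <= x -> x <= b -> f x = y) -> RSint f g a b = y * (g b - g a).
Proof.
move=> ab cV dV fy; apply/eqP; rewrite -subr_eq0 -normr_le0.
have := @RSint_near f g V a b ab _ cV dV 0 y (lexx _); rewrite mul0r; apply.
  move=> e e0; exists 1 => // s t h1 h2 h3 _.
  by rewrite !fy ?subrr ?normr0 ?(ltW e0) //; lra.
by move=> x ax xb; rewrite fy // subrr normr0.
Qed.

Lemma RSint_diag f g V a : ctrl a a V -> dominates a a V g -> RSint f g a a = 0.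
Proof.
move=> cV dV; rewrite (RSint_cst (y := f a) (lexx _) cV dV) ?subrr ?mulr0 //.
by move=> x h1 h2; congr f; apply/eqP; rewrite eq_le h1 h2.
Qed.

Lemma RSint_add f g V a c b : a <= c -> c <= b -> ucont a b f -> ctrl a b V ->
  dominates a b V g -> RSint f g a b = RSint f g a c + RSint f g c b.
Proof.
move=> ac cb uf cV dV.
have uf1 : ucont a c f by exact: ucont_sub uf.
have uf2 : ucont c b f by exact: ucont_sub uf.
have cV1 : ctrl a c V by exact: ctrl_sub cV.
have cV2 : ctrl c b V by exact: ctrl_sub cV.
have dV1 : dominates a c V g by exact: dominates_sub dV.
have dV2 : dominates c b V g by exact: dominates_sub dV.
apply: (RSint_unique (le_trans ac cb) uf cV dV (C := V a c + V c b)) => e e0.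
have [E1 h1] := tagged_exists uf1 e0 ac; have [E2 h2] := tagged_exists uf2 e0 cb.
exists (E1 ++ E2); first exact: tagged_cat h1 h2.
rewrite (rs_sum_cat _ _ h1).
have k1 := RSint_close ac uf1 cV1 dV1 (ltW e0) h1.
have k2 := RSint_close cb uf2 cV2 dV2 (ltW e0) h2.
rewrite opprD addrACA mulrDl; apply: le_trans (ler_normD _ _) _.
by rewrite ![_ * e]mulrC lerD.
Qed.

Lemma ucontD a b f1 f2 : ucont a b f1 -> ucont a b f2 -> ucont a b (fun x => f1 x + f2 x).
Proof.
move=> h1 h2 e e0; have e2 : 0 < e / 2 by rewrite divr_gt0.
have [d1 d10 k1] := h1 _ e2; have [d2 d20 k2] := h2 _ e2.
exists (Num.min d1 d2); first by rewrite lt_min d10.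
move=> s t as_ st tb; rewrite lt_min => /andP[l1 l2].
have := k1 _ _ as_ st tb l1; have := k2 _ _ as_ st tb l2.
rewrite opprD addrACA => ? ?; apply: le_trans (ler_normD _ _) _; lra.
Qed.

Lemma ucontZ a b c f : ucont a b f -> ucont a b (fun x => c * f x).
Proof.
move=> h e e0; have c1 : 0 < `|c| + 1 by rewrite ltr_wpDl.
have [d d0 k] := h (e / (`|c| + 1)) (divr_gt0 e0 c1).
exists d => // s t as_ st tb l; rewrite -mulrBr normrM.
apply: le_trans (ler_wpM2l (normr_ge0 _) (k _ _ as_ st tb l)) _.
rewrite mulrA ler_pdivrMr // mulrC ler_wpM2l ?(ltW e0) //; lra.
Qed.

(** One fine partition with left tags serves the three integrands at once, and its sums are linear.
    The identity between integrands is assumed on [a, b] only, because Chen's relation will supply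
    it only there. *)
Lemma RSint_linear f1 f2 c f g V a b : a <= b -> ucont a b f1 -> ucont a b f2 ->
  ctrl a b V -> dominates a b V g ->
  (forall x, a <= x -> x <= b -> f x = c * f1 x + f2 x) ->
  RSint f g a b = c * RSint f1 g a b + RSint f2 g a b.
Proof.
move=> ab u1 u2 cV dV ff.
have uf : ucont a b f.
  move=> e e0; have [d d0 k] := ucontD (ucontZ c u1) u2 e0.
  by exists d => // s t h1 h2 h3 h4; rewrite !ff; first exact: (k _ _ h1 h2 h3 h4); lra.
have V0 : 0 <= V a b by apply: cV.1.
have C0 : 0 <= `|c| + 1 by rewrite addr_ge0.
apply: (RSint_unique ab uf cV dV (C := (`|c| + 1) * V a b)) => e e0.
have e1 : 0 < e / (`|c| + 1) by rewrite divr_gt0 // ltr_wpDl.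
have [d1 d10 k1] := u1 _ e1; have [d2 d20 k2] := u2 _ e1; have [d d0 k] := uf _ e0.
have [D hD] : exists D, part (Num.min d (Num.min d1 d2)) a b D.
  by apply: part_exists => //; rewrite !lt_min d0 d10 d20.
exists (left_tags f a D).
  by apply: left_tagsP k (part_weaken _ hD); rewrite ge_min lexx.
have hD1 : part d1 a b D.
  by apply: part_weaken hD; rewrite !ge_min lexx orbT.
have hD2 : part d2 a b D.
  by apply: part_weaken hD; rewrite !ge_min lexx !orbT.
have l1 := RSint_close ab u1 cV dV (ltW e1) (left_tagsP k1 hD1).
have l2 := RSint_close ab u2 cV dV (ltW e1) (left_tagsP k2 hD2).
have -> : rs_sum g a (left_tags f a D) =
    c * rs_sum g a (left_tags f1 a D) + rs_sum g a (left_tags f2 a D).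
  elim: D a {ab uf u1 u2 cV dV C0 V0 k1 k2 k hD1 hD2 l1 l2} ff hD => [|t D IH] a' ff hD /=.
    by rewrite mulr0 addr0.
  case: hD => at_ _ hD; have tb := part_le hD.
  rewrite IH //; last by move=> x h1 h2; apply: ff => //; lra.
  by rewrite ff ?lexx //; [ring|lra].
move: l1 l2; set r1 := rs_sum _ _ _; set r2 := rs_sum _ _ _.
set i1 := RSint _ _ _ _; set i2 := RSint _ _ _ _ => l1 l2.
have -> : c * r1 + r2 - (c * i1 + i2) = c * (r1 - i1) + (r2 - i2) by ring.
apply: le_trans (ler_normD _ _) _; rewrite normrM.
have := ler_wpM2l (normr_ge0 c) l1.
have : (`|c| + 1) * (e / (`|c| + 1) * V a b) = e * V a b.
  by rewrite mulrA mulrCA mulfV ?mulr1 // gt_eqF // ltr_wpDl.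
have : e * V a b <= (`|c| + 1) * V a b * e.
  rewrite -mulrA [V a b * e]mulrC ler_peMl //.
    by rewrite mulr_ge0 // ltW.
  by have := normr_ge0 c; lra.
lra.
Qed.

End Partitions.

(** * Controls and Hilbert-Schmidt norms *)

Section Variation.
Variable R : realType.
Implicit Types (a b s t u : R) (D : seq R).

Lemma dissection_sum_nil (g : R -> R -> R) a : dissection_sum g a [::] = 0.
Proof. by rewrite /dissection_sum big_nil. Qed.

Lemma dissection_sum_cons (g : R -> R -> R) a t D :
  dissection_sum g a (t :: D) = g a t + dissection_sum g t D.
Proof. by rewrite /dissection_sum /= big_cons. Qed.

Lemma dissection_sum_cat (g : R -> R -> R) a D1 D2 :
  dissection_sum g a (D1 ++ D2) = dissection_sum g a D1 + dissection_sum g (last a D1) D2.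
Proof.
elim: D1 a => [|t D IH] a /=; first by rewrite dissection_sum_nil add0r.
by rewrite !dissection_sum_cons IH addrA.
Qed.

Lemma dissection_sum_le_ctrl (g V : R -> R -> R) lo a b D : ctrl lo b V -> lo <= a ->
  (forall s t, a <= s -> s < t -> t <= b -> g s t <= V s t) ->
  itv_partition a b D -> dissection_sum g a D <= V a b.
Proof.
move=> cV la; elim: D a la => [|t D IH] a la h hD.
  by rewrite dissection_sum_nil (itv_partition_nil hD) ?cV.1 ?lexx // -(itv_partition_nil hD).
rewrite dissection_sum_cons.
have at_ : a < t by case: hD => /= /andP[].
have {}hD := itv_partition_cons hD; have tb := itv_partition_le hD.
apply: le_trans (cV.2 a t b la (ltW at_) tb (lexx _)).
rewrite lerD ?h ?lexx // IH //; first exact: le_trans la (ltW at_).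
by move=> s u ts; apply: h; exact: le_trans (ltW at_) ts.
Qed.

Section Control.
Variables (g : R -> R -> R) (a b : R).
Hypotheses (g0 : forall s t, 0 <= g s t) (fin : (sup_dissections g a b < +oo)%E).

(* Meaningful only where the supremum is finite; [fine] gives 0 otherwise. *)
Definition dvar s t := fine (sup_dissections g s t).

Lemma dissection_sum_ge0 s D : 0 <= dissection_sum g s D.
Proof. by elim: D s => [|t D IH] s;
  rewrite ?dissection_sum_nil // dissection_sum_cons addr_ge0. Qed.

Lemma partition_le s t : s <= t -> exists D, itv_partition s t D.
Proof.
have [-> _|st st'] := eqVneq s t; first by exists [::]; split => /=.
by exists [:: t]; apply: itv_partition1; rewrite lt_neqAle st.
Qed.

(** Dissections of [a, s] and [t, b] complete one of [s, t], and the extra terms are nonnegative, so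
    finiteness on [a, b] is inherited. *)
Let fin_om s t : a <= s -> s <= t -> t <= b -> sup_dissections g s t \is a fin_num.
Proof.
move=> as_ st tb; rewrite fin_numE -ltNye -ltey; apply/andP; split.
  have [D hD] := partition_le st; apply: (@lt_le_trans _ _ (dissection_sum g s D)%:E).
    exact: ltNyr.
  by apply: ereal_sup_ubound; exists D.
apply: le_lt_trans fin; apply: ge_ereal_sup => _ [D hD <-].
have [D1 h1] := partition_le as_; have [D2 h2] := partition_le tb.
apply: (@le_trans _ _ (dissection_sum g a (D1 ++ D ++ D2))%:E); last first.
  by apply: ereal_sup_ubound; exists (D1 ++ D ++ D2) => //;
    exact: itv_partition_cat h1 (itv_partition_cat hD h2).
rewrite lee_fin !dissection_sum_cat; case: h1 => _ /eqP ->.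
have := dissection_sum_ge0 a D1; have := dissection_sum_ge0 (last s D) D2; lra.
Qed.

Lemma dvar_ub s t D : a <= s -> s <= t -> t <= b -> itv_partition s t D ->
  dissection_sum g s D <= dvar s t.
Proof.
move=> as_ st tb hD; rewrite -lee_fin fineK ?fin_om //.
by apply: ereal_sup_ubound; exists D.
Qed.

Lemma dvar_least s t c : a <= s -> s <= t -> t <= b ->
  (forall D, itv_partition s t D -> dissection_sum g s D <= c) -> dvar s t <= c.
Proof.
move=> as_ st tb h; rewrite -lee_fin fineK ?fin_om //.
by apply: ge_ereal_sup => _ [D hD <-]; rewrite lee_fin h.
Qed.

Lemma dvar_ctrl : ctrl a b dvar.
Proof.
split=> [s t as_ st tb|s u t as_ su ut tb].
  have [D hD] := partition_le st; exact: le_trans (dissection_sum_ge0 s D) (dvar_ub _ _ _ hD).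
have as2 := le_trans as_ su; have ub := le_trans ut tb; have st := le_trans su ut.
rewrite -lerBrDr; apply: dvar_least => // D1 h1.
rewrite lerBrDr addrC -lerBrDr; apply: dvar_least => // D2 h2.
rewrite lerBrDr addrC; have := dvar_ub as_ st tb (itv_partition_cat h1 h2).
by rewrite dissection_sum_cat; case: h1 => _ /eqP ->.
Qed.

Lemma dvar_ge s t : a <= s -> s < t -> t <= b -> g s t <= dvar s t.
Proof.
move=> as_ st tb; have := dvar_ub as_ (ltW st) tb (itv_partition1 st).
by rewrite dissection_sum_cons dissection_sum_nil addr0.
Qed.

(** [dvar] is the least control above g off the diagonal; it is bounded below by exhibiting other
    controls above g. *)
Lemma dvar_le_ctrl V s t : a <= s -> s <= t -> t <= b -> ctrl s t V ->
  (forall u v, s <= u -> u < v -> v <= t -> g u v <= V u v) -> dvar s t <= V s t.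
Proof.
move=> as_ st tb cV h; apply: dvar_least => // D hD.
exact: dissection_sum_le_ctrl cV (lexx _) h hD.
Qed.

End Control.

Lemma ctrlD a b V W : ctrl a b V -> ctrl a b W -> ctrl a b (fun s t => V s t + W s t :> R).
Proof.
move=> [v1 v2] [w1 w2]; split=> [s t h1 h2 h3|s u t h1 h2 h3 h4].
  by rewrite addr_ge0 ?v1 ?w1.
by have := v2 _ _ _ h1 h2 h3 h4; have := w2 _ _ _ h1 h2 h3 h4; lra.
Qed.

Lemma ctrlZ a b c V : 0 <= c -> ctrl a b V -> ctrl a b (fun s t => c * V s t :> R).
Proof.
move=> c0 [v1 v2]; split=> [s t h1 h2 h3|s u t h1 h2 h3 h4].
  by rewrite mulr_ge0 ?v1.
by rewrite -mulrDr ler_wpM2l ?v2.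
Qed.

End Variation.

Section Norms.
Variable R : realType.

(** Lagrange's identity: the difference of the two sides is half the sum of the squares of a_i b_j -
    a_j b_i. *)
Lemma sum_CauchySchwarz (I : finType) (a b : I -> R) :
  (\sum_i a i * b i) ^+ 2 <= (\sum_i a i ^+ 2) * (\sum_i b i ^+ 2).
Proof.
suff : 0 <= (\sum_i a i ^+ 2) * (\sum_i b i ^+ 2) - (\sum_i a i * b i) ^+ 2 by rewrite subr_ge0.
have -> : (\sum_i a i ^+ 2) * (\sum_i b i ^+ 2) - (\sum_i a i * b i) ^+ 2 =
   2^-1 * \sum_i \sum_j (a i * b j - a j * b i) ^+ 2.
  rewrite expr2 !big_distrlr /=.
  have e1 : \sum_i \sum_j a i ^+ 2 * b j ^+ 2 = \sum_i \sum_j a j ^+ 2 * b i ^+ 2.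
    by rewrite exchange_big.
  have -> : \sum_i \sum_j (a i * b j - a j * b i) ^+ 2 =
      \sum_i \sum_j a i ^+ 2 * b j ^+ 2 + \sum_i \sum_j a j ^+ 2 * b i ^+ 2
      - 2 * \sum_i \sum_j a i * b i * (a j * b j).
    rewrite mulr_sumr -big_split -sumrB; apply: eq_bigr => i _.
    by rewrite mulr_sumr -big_split -sumrB; apply: eq_bigr => j _ /=; ring.
  by rewrite -e1; field.
by rewrite mulr_ge0 // ?invr_ge0 //; do 2 apply: sumr_ge0 => ? _; exact: sqr_ge0.
Qed.

Definition hs2 m n (A : 'M[R]_(m, n)) := \sum_i \sum_j A i j ^+ 2.

Lemma hs2_ge0 m n (A : 'M[R]_(m, n)) : 0 <= hs2 A.
Proof. by do 2 apply: sumr_ge0 => ? _; exact: sqr_ge0. Qed.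

Lemma hs_norm_ge0 m n (A : 'M[R]_(m, n)) : 0 <= hs_norm A.
Proof. exact: sqrtr_ge0. Qed.

Lemma hs_norm_sqr m n (A : 'M[R]_(m, n)) : hs_norm A ^+ 2 = hs2 A.
Proof. by rewrite sqr_sqrtr // hs2_ge0. Qed.

Lemma hs2_tr m n (A : 'M[R]_(m, n)) : hs2 A = \tr (A *m A^T).
Proof.
rewrite /hs2 /mxtrace; apply: eq_bigr => i _; rewrite mxE; apply: eq_bigr => j _.
by rewrite mxE expr2.
Qed.

Lemma hs_normD m n (A B : 'M[R]_(m, n)) : hs_norm (A + B) <= hs_norm A + hs_norm B.
Proof.
rewrite -(@ler_pXn2r _ 2) ?nnegrE ?addr_ge0 ?hs_norm_ge0 //.
rewrite sqrrD !hs_norm_sqr.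
have -> : hs2 (A + B) = hs2 A + (\sum_i \sum_j A i j * B i j) *+ 2 + hs2 B.
  rewrite /hs2 -sumrMnl -!big_split; apply: eq_bigr => i _ /=.
  rewrite -sumrMnl -!big_split; apply: eq_bigr => j _ /=; rewrite mxE; ring.
rewrite lerD2r lerD2l lerMn2r orFb.
apply: le_trans (ler_norm _) _.
rewrite -(@ler_pXn2r _ 2) ?nnegrE ?mulr_ge0 ?hs_norm_ge0 //.
rewrite exprMn !hs_norm_sqr -normrX ger0_norm ?sqr_ge0 //.
rewrite /hs2 !pair_bigA /=; exact: sum_CauchySchwarz.
Qed.

Lemma hs_norm0 m n : hs_norm (0 : 'M[R]_(m, n)) = 0.
Proof.
rewrite /hs_norm big1 ?sqrtr0 // => i _; rewrite big1 // => j _.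
by rewrite mxE expr0n.
Qed.

Lemma hs_normZ m n c (A : 'M[R]_(m, n)) : hs_norm (c *: A) = `|c| * hs_norm A.
Proof.
rewrite /hs_norm -sqrtr_sqr -sqrtrM ?sqr_ge0 //; congr Num.sqrt.
rewrite mulr_sumr; apply: eq_bigr => i _; rewrite mulr_sumr; apply: eq_bigr => j _.
by rewrite mxE exprMn.
Qed.

Lemma hs_normN m n (A : 'M[R]_(m, n)) : hs_norm (- A) = hs_norm A.
Proof. by rewrite -scaleN1r hs_normZ normrN1 mul1r. Qed.

Lemma hs_normM m n l (A : 'M[R]_(m, n)) (B : 'M[R]_(n, l)) :
  hs_norm (A *m B) <= hs_norm A * hs_norm B.
Proof.
rewrite -(@ler_pXn2r _ 2) ?nnegrE ?mulr_ge0 ?hs_norm_ge0 // exprMn !hs_norm_sqr.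
rewrite /hs2 mulr_suml; apply: ler_sum => i _.
rewrite [X in _ * X]exchange_big mulr_sumr; apply: ler_sum => j _.
rewrite mxE; exact: sum_CauchySchwarz.
Qed.

Lemma hs_norm1 k : hs_norm (1%:M : 'M[R]_k) = Num.sqrt k%:R.
Proof.
rewrite /hs_norm; congr Num.sqrt; rewrite -/(hs2 _) hs2_tr mul1mx trmx1 mxtrace1 //.
Qed.

Lemma hs_norm_tr m n (A : 'M[R]_(m, n)) : hs_norm A^T = hs_norm A.
Proof.
rewrite /hs_norm exchange_big; congr Num.sqrt; apply: eq_bigr => i _; apply: eq_bigr => j _.
by rewrite mxE.
Qed.

Lemma hs_norm_orthr m k (A : 'M[R]_(m, k)) (O : 'M[R]_k) :
  O *m O^T = 1%:M -> hs_norm (A *m O) = hs_norm A.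
Proof.
move=> hO; rewrite /hs_norm -!/(hs2 _) !hs2_tr trmx_mul -mulmxA (mulmxA O) hO mul1mx //.
Qed.

Lemma hs_norm_entry m n (A : 'M[R]_(m, n)) i j : `|A i j| <= hs_norm A.
Proof.
rewrite -sqrtr_sqr ler_wsqrtr // (bigD1 i) //= (bigD1 j) //= -addrA ler_wpDr //.
by rewrite addr_ge0 //; do ?apply: sumr_ge0 => ? _; rewrite ?sqr_ge0 //;
  apply: sumr_ge0 => ? _; rewrite sqr_ge0.
Qed.

(** The l^2 norm is at most the l^1 norm. The dimension factor is harmless where this is applied:
    errors that can be made small, and plain boundedness. *)
Lemma hs_norm_entries m n (A : 'M[R]_(m, n)) e : 0 <= e ->
  (forall i j, `|A i j| <= e) -> hs_norm A <= (m * n)%:R * e.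
Proof.
move=> e0 h.
rewrite -(@ler_pXn2r _ 2) ?nnegrE ?mulr_ge0 ?hs_norm_ge0 // hs_norm_sqr.
have -> : (m * n)%:R * e = \sum_(i < m) \sum_(j < n) e.
  by rewrite mulr_natl !sumr_const !card_ord -mulrnA mulnC.
apply: (@le_trans _ _ ((\sum_i \sum_j `|A i j|) ^+ 2)).
  rewrite /hs2 !pair_bigA /=;
    apply: le_trans (_ : \sum_p `|A p.1 p.2| * (\sum_q `|A q.1 q.2|) <= _); last first.
    by rewrite -mulr_suml.
  apply: ler_sum => p _; rewrite -[X in X <= _]ger0_norm ?sqr_ge0 // expr2 normrM ler_wpM2l //.
  by rewrite (bigD1 p) //= ler_wpDr // sumr_ge0.
rewrite ler_pXn2r ?nnegrE //; do ?[do 2 apply: sumr_ge0 => ? _; rewrite //].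
by do 2 apply: ler_sum => ? _.
Qed.

End Norms.

(** * Signatures of paths of bounded variation *)

Section Signature.
Variable R : realType.

(** The control V may jump, so V(s, t) need not be small on short intervals. The integrand is frozen
    at s instead: the remainder is the oscillation of f times V, and f(s) (g(t) - g(s)) is small by
    continuity of g. *)
Lemma ucont_RSint (f g : R -> R) V (M a b : R) : a <= b -> ucont a b f -> ctrl a b V ->
  dominates a b V g -> ucont a b g -> (forall x, a <= x -> x <= b -> `|f x| <= M) ->
  ucont a b (fun t => RSint f g a t).
Proof.
move=> ab uf cV dV ug fM e e0.
have V0 : 0 <= V a b by apply: cV.1.
have M0 : 0 <= M by exact: le_trans (fM a (lexx _) ab).
have V1 : 0 < 2 * (V a b + 1) by lra.
have M1 : 0 < 2 * (M + 1) by lra.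
have [d1 d10 k1] := uf _ (divr_gt0 e0 V1); have [d2 d20 k2] := ug _ (divr_gt0 e0 M1).
exists (Num.min d1 d2); first by rewrite lt_min d10.
move=> s t as_ st tb; rewrite lt_min => /andP[l1 l2].
have uf' : ucont a t f by exact: ucont_sub uf.
have uf2 : ucont s t f by exact: ucont_sub uf.
have cV' : ctrl a t V by exact: ctrl_sub cV.
have cV2 : ctrl s t V by exact: ctrl_sub cV.
have dV' : dominates a t V g by exact: dominates_sub dV.
have dV2 : dominates s t V g by exact: dominates_sub dV.
rewrite (RSint_add as_ st uf' cV' dV') addrC addKr.
have h := RSint_near st uf2 cV2 dV2 (y := f s) (ltW (divr_gt0 e0 V1)).
have {h}: `|RSint f g s t - f s * (g t - g s)| <= e / 2.
  apply: le_trans (h _) _; first by move=> x sx xt; apply: k1; lra.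
  apply: le_trans (ler_wpM2l (ltW (divr_gt0 e0 V1)) (ctrl_mono cV (lexx _) as_ st tb (lexx
    _))) _.
  by rewrite mulrAC ler_pdivrMr // -mulrA ler_pM2l //; lra.
have : `|f s * (g t - g s)| <= e / 2.
  rewrite normrM; apply: le_trans (ler_pM _ _ (fM s as_ (le_trans st tb)) (k2 _ _ as_ st tb
    l2)) _ => //.
  by rewrite mulrCA ler_pM2l // ler_pdivrMr //; lra.
move=> h1 h2.
have -> : RSint f g s t = (RSint f g s t - f s * (g t - g s)) + f s * (g t - g s) by ring.
by apply: le_trans (ler_normD _ _) _; lra.
Qed.

Lemma ucont_sum n (c : 'I_n -> R) (F : 'I_n -> R -> R) a b :
  (forall i, ucont a b (F i)) -> ucont a b (fun x => \sum_i c i * F i x).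
Proof.
elim: n c F => [|n IH] c F uF.
  by move=> e e0; exists 1 => // s t _ _ _ _; rewrite !big_ord0 subrr normr0 ltW.
have := ucontD (ucontZ (c ord0) (uF ord0))
  (IH (fun i => c (lift ord0 i)) (fun i => F (lift ord0 i)) (fun i => uF _)).
by congr ucont; apply/funext => x; rewrite big_ord_recl.
Qed.

Lemma RSint_sum n (c : 'I_n -> R) (f : R -> R) (F : 'I_n -> R -> R) (g : R -> R) V a b :
  a <= b -> (forall i, ucont a b (F i)) -> ctrl a b V -> dominates a b V g ->
  (forall x, a <= x -> x <= b -> f x = \sum_i c i * F i x) ->
  RSint f g a b = \sum_i c i * RSint (F i) g a b.
Proof.
elim: n c F f => [|n IH] c F f ab uF cV dV h.
  rewrite (RSint_cst (y := 0) ab cV dV) ?mul0r ?big_ord0 // => x h1 h2.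
  by rewrite h // big_ord0.
rewrite big_ord_recl.
pose G x := \sum_(i < n) c (lift ord0 i) * F (lift ord0 i) x.
have uG : ucont a b G by apply: ucont_sum => i; exact: uF.
rewrite (@RSint_linear _ (F ord0) G (c ord0) f g V) //.
  by rewrite (IH (fun i => c (lift ord0 i)) (fun i => F (lift ord0 i)) G).
by move=> x h1 h2; rewrite h // big_ord_recl.
Qed.

Variables (d : nat) (X : R -> 'rV[R]_d) (V : R -> R -> R) (T : R).
Hypotheses (cV : ctrl 0 T V) (dV : forall i, dominates 0 T V (fun u => X u 0 i))
  (uX : forall i, ucont 0 T (fun u => X u 0 i)).

Let sub s t i : 0 <= s -> t <= T -> ctrl s t V /\ dominates s t V (fun u => X u 0 i).
Proof. by move=> h1 h2; split; [exact: ctrl_sub cV|exact: dominates_sub (dV i)]. Qed.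

(** Bound and continuity go through one induction, as continuity of the inner integral makes the
    next one exist. The factor 1/n! is given up: only finitely many levels are ever evaluated. *)
Lemma iterated_int_bound w s : 0 <= s -> s <= T ->
  (forall t, s <= t -> t <= T -> `|iterated_int X w s t| <= V s t ^+ size w) /\
  ucont s T (iterated_int X w s).
Proof.
move=> s0 sT; elim: w => [|i w [IH1 IH2]].
  split=> [t st tT|e e0]; first by rewrite /= expr0 normr1.
  by exists 1 => // u t _ _ _ _; rewrite /= subrr normr0 ltW.
have mono x t : s <= x -> x <= t -> t <= T -> V s x ^+ size w <= V s t ^+ size w.
  move=> sx xt tT; rewrite lerXn2r ?nnegrE ?cV.1 //; try lra.
  by apply: (ctrl_mono cV); lra.
split=> [t st tT|] /=.
  have [c1 c2] := sub i s0 tT; have u1 : ucont s t (iterated_int X w s) by exact: ucont_sub IH2.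
  rewrite exprSr; apply: (RSint_bound st u1 c1 c2); first by rewrite exprn_ge0 ?cV.1.
  by move=> x sx xt; apply: le_trans (IH1 x sx _) (mono _ _ sx xt tT); lra.
have [c1 c2] := sub i s0 (lexx T).
apply: (ucont_RSint sT IH2 c1 c2 (M := V s T ^+ size w)); first exact: ucont_sub (uX i).
by move=> x sx xT; apply: le_trans (IH1 x sx _) (mono _ _ sx xT (lexx _)).
Qed.

Lemma iterated_int1 i s t : 0 <= s -> s <= t -> t <= T ->
  iterated_int X [:: i] s t = X t 0 i - X s 0 i.
Proof.
move=> s0 st tT; have [c1 c2] := sub i s0 tT.
by rewrite /= (RSint_cst (y := 1) st c1 c2) // mul1r.
Qed.

(** The innermost integral is an increment of X, at most o; only the remaining ones are charged to
    V. From length 2 on, this is o(V) on short intervals. *)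
Lemma iterated_int_small w s t o : 0 <= s -> s <= t -> t <= T -> 0 <= o ->
  (forall i x, s <= x -> x <= t -> `|X x 0 i - X s 0 i| <= o) -> (0 < size w)%N ->
  `|iterated_int X w s t| <= o * V s t ^+ (size w).-1.
Proof.
move=> s0 + tT o0; elim: w t tT => [//|i w IH] t tT st h _.
case: w IH => [|j w] IH.
  by rewrite iterated_int1 // expr0 mulr1 h.
have [c1 c2] := sub i s0 tT.
have [_ u1] := iterated_int_bound (j :: w) s0 (le_trans st tT).
have u2 : ucont s t (iterated_int X (j :: w) s) by exact: ucont_sub u1.
have -> : V s t ^+ (size [:: i, j & w]).-1 = V s t ^+ size w * V s t by rewrite exprSr.
rewrite mulrA; apply: (RSint_bound st u2 c1 c2).
  by rewrite mulr_ge0 // exprn_ge0 // cV.1.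
move=> x sx xt; apply: le_trans (IH x _ sx _ isT) _; first exact: le_trans xt tT.
  by move=> k y sy yx; apply: h => //; exact: le_trans yx xt.
rewrite ler_wpM2l // lerXn2r ?nnegrE ?cV.1 //; try lra.
by apply: (ctrl_mono cV); lra.
Qed.

(** Words are read outermost letter first. Splitting the outermost integral at u leaves an integral
    over [u, t], whose integrand starts from s; the induction hypothesis expands it and [RSint_sum]
    integrates termwise. *)
Lemma iterated_int_Chen w s u t : 0 <= s -> s <= u -> u <= t -> t <= T ->
  iterated_int X w s t =
  \sum_(i < (size w).+1) iterated_int X (drop i w) s u * iterated_int X (take i w) u t.
Proof.
move=> s0 su + tT; elim: w t tT => [|i w IH] t tT ut.
  by rewrite big_ord1 /= mulr1.
have u0 := le_trans s0 su; have uT := le_trans ut tT; have sT := le_trans su uT.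
have [_ u1] := iterated_int_bound w s0 sT.
have [c1 c2] := sub i s0 tT; have [c3 c4] := sub i u0 tT.
have us : ucont s t (iterated_int X w s) by exact: ucont_sub u1.
have uut : ucont u t (iterated_int X w s) by exact: ucont_sub u1.
rewrite big_ord_recl drop0 take0 mulr1 {1}/iterated_int -/(iterated_int X).
rewrite (RSint_add su ut us c1 c2); congr (_ + _).
rewrite (@RSint_sum _ (fun j : 'I_(size w).+1 => iterated_int X (drop j w) s u)
  _ (fun j : 'I_(size w).+1 => iterated_int X (take j w) u) _ V) //.
- move=> j; have [_ h] := iterated_int_bound (take j w) u0 uT.
  exact: ucont_sub h.
- by move=> x ux xt; rewrite IH //; exact: le_trans xt tT.
Qed.

Lemma signature_Chen w s u t : 0 <= s -> s <= u -> u <= t -> t <= T ->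
  signature X s t w = tmul (signature X s u) (signature X u t) w.
Proof.
move=> s0 su ut tT; rewrite /signature (iterated_int_Chen _ s0 su ut tT) /tmul size_rev.
rewrite (reindex_inj rev_ord_inj) /=; apply: eq_bigr => j _.
have jw : (j <= size w)%N by rewrite -ltnS.
by rewrite subSS drop_rev take_rev subKn.
Qed.

Lemma signature_bound w s t : 0 <= s -> s <= t -> t <= T ->
  `|signature X s t w| <= V s t ^+ size w.
Proof.
move=> s0 st tT; rewrite /signature -(size_rev w).
by have [h _] := iterated_int_bound (rev w) s0 (le_trans st tT); exact: h.
Qed.

Lemma signature_small w s t o : 0 <= s -> s <= t -> t <= T -> 0 <= o ->
  (forall i x, s <= x -> x <= t -> `|X x 0 i - X s 0 i| <= o) -> (0 < size w)%N ->
  `|signature X s t w| <= o * V s t ^+ (size w).-1.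
Proof. by rewrite /signature -(size_rev w); exact: iterated_int_small. Qed.

End Signature.

(** * The multiplicative sewing lemma *)

Section Sewing.
Variables (R : realType) (A : nzRingType) (nrm : A -> R).

(** The value [nrm 1] is left free: for the Hilbert-Schmidt norm it is the square root of the
    dimension. *)
Record ring_norm : Prop := RingNorm {
  nrm_ge0 : forall x, 0 <= nrm x;
  nrmD : forall x y, nrm (x + y) <= nrm x + nrm y;
  nrmN : forall x, nrm (- x) = nrm x;
  nrm0 : nrm 0 = 0;
  nrmM : forall x y, nrm (x * y) <= nrm x * nrm y }.

Hypothesis hn : ring_norm.
Implicit Types (P : R -> R -> A) (D : seq R) (x y z : A).

Fixpoint prodP P a D : A := if D is t :: D' then P a t * prodP P t D' else 1.

Lemma prodP_cat P a D1 D2 : prodP P a (D1 ++ D2) = prodP P a D1 * prodP P (last a D1) D2.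
Proof. by elim: D1 a => [|t D IH] a /=; rewrite ?mul1r // IH mulrA. Qed.

Lemma nrm_sum (I : Type) (r : seq I) (Q : pred I) (F : I -> A) (G : I -> R) :
  (forall i, Q i -> nrm (F i) <= G i) ->
    nrm (\sum_(i <- r | Q i) F i) <= \sum_(i <- r | Q i) G i.
Proof.
move=> h; elim/big_rec2: _ => [|i x y Qi xy]; first by rewrite nrm0.
by apply: le_trans (nrmD hn _ _) _; rewrite lerD ?h.
Qed.

(** Writing x y = x + x (y - 1) gives a factor close to 1, where submultiplicativity alone would
    give one close to [nrm 1]. *)
Lemma nrm_near1 x y e : nrm (y - 1) <= e -> nrm (x * y) <= (1 + e) * nrm x.
Proof.
move=> ye; have -> : x * y = x + x * (y - 1) by rewrite mulrBr mulr1 addrC subrK.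
apply: le_trans (nrmD hn _ _) _; rewrite [leRHS]mulrDl mul1r lerD2l.
by rewrite mulrC; apply: le_trans (nrmM hn _ _) _; rewrite ler_wpM2l ?(nrm_ge0 hn).
Qed.

Lemma nrm_near1l x y e : nrm (x - 1) <= e -> nrm (x * y) <= (1 + e) * nrm y.
Proof.
move=> xe; have -> : x * y = y + (x - 1) * y by rewrite mulrBl mul1r addrC subrK.
apply: le_trans (nrmD hn _ _) _; rewrite [leRHS]mulrDl mul1r lerD2l.
by apply: le_trans (nrmM hn _ _) _; rewrite ler_wpM2r ?(nrm_ge0 hn).
Qed.

(** A discrete intermediate value argument: t is the first point of the partition with V a t >= h.
    The induction moves the start c of the remaining list, while V is still measured from a. *)
Lemma part_split (V : R -> R -> R) delta a b D h : D <> [::] -> V a a <= h -> h <= V a b ->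
  part delta a b D -> exists D1 t D2, [/\ D = D1 ++ t :: D2, part delta a (last a D1) D1,
    last a D1 < t, part delta t b D2 & V a (last a D1) <= h /\ h <= V a t].
Proof.
move=> D0 haa hb.
suff gen c : V a c <= h -> part delta c b D -> exists D1 t D2,
    [/\ D = D1 ++ t :: D2, part delta c (last c D1) D1,
    last c D1 < t, part delta t b D2 & V a (last c D1) <= h /\ h <= V a t].
  by move=> hD; have [D1 [t [D2]]] := gen a haa hD; exists D1, t, D2.
elim: D c D0 => [//|t D IH] c _ hc /= [ct tc hD].
have [ht|ht] := leP h (V a t); first by exists [::], t, D.
have [D0|/eqP D0] := eqVneq D [::].
  by move: hD; rewrite D0 /= => tb; move: ht; rewrite tb ltNge hb.
have [D1 [u [D2 [-> h1 h2 h3 h4]]]] := IH t D0 (ltW ht) hD.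
by exists (t :: D1), u, D2; split.
Qed.

(** The gain 2^-theta is written q / 2 with q = 2^(1 - theta), so that two halves together cost q,
    which is below 1 when theta > 1. *)
Lemma powR_half (x y theta : R) : 0 <= theta -> 0 <= x -> x <= y / 2 ->
  x `^ theta <= (2 `^ (1 - theta)) / 2 * y `^ theta.
Proof.
move=> t0 x0 xy; have y0 : 0 <= y by lra.
apply: le_trans (ge0_ler_powR t0 _ _ xy) _; rewrite ?nnegrE //; first lra.
have -> : 2 `^ (1 - theta) / 2 = 2^-1 `^ theta :> R.
  rewrite -(@powR_inv1 _ 2) // -powRrM -powRD ?pnatr_eq0 ?implybT //.
  by congr (_ `^ _); ring.
by rewrite mulrC powRM ?invr_ge0.
Qed.

(** One bisection in [sewing], with [l, t] the step across the middle: x1 and pt are the products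
    over [a, l] and [t, b], while y1, p, p3, y3, z are P at (a, l), (l, t), (t, b), (a, t), (a, b).
    The two products are replaced by values of P, with error e each; then the three factors are
    merged into z in two stages, with defect f each. *)
Lemma sewing_step x1 p p3 y1 y3 pt z d e f : 0 <= d -> nrm (p - 1) <= d -> nrm (p3 - 1) <= d ->
  nrm (y1 - 1) <= d ->
  nrm (x1 - y1) <= e -> nrm (pt - p3) <= e -> e <= d -> nrm (y1 * p - y3) <= f ->
    nrm (y3 * p3 - z) <= f ->
  nrm (x1 * (p * pt) - z) <= (1 + 2 * d) ^+ 2 * (2 * e) + f * (2 + d).
Proof.
move=> d0 hp hp3 hy1 he1 he2 ed hf1 hf2.
have -> : x1 * (p * pt) - z = (x1 - y1) * p * pt + y1 * (p * (pt - p3)) + (y1 * p - y3) * p3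
  + (y3 * p3 - z).
  by rewrite !mulrBl !mulrBr !mulrA !subrKA.
have e0 : 0 <= e by exact: le_trans (nrm_ge0 hn _) he1.
have f0 : 0 <= f by exact: le_trans (nrm_ge0 hn _) hf1.
have hpt : nrm (pt - 1) <= 2 * d.
  have -> : pt - 1 = (pt - p3) + (p3 - 1) by rewrite addrA subrK.
  by apply: le_trans (nrmD hn _ _) _; lra.
apply: le_trans (nrmD hn _ _) _; apply: le_trans (lerD (nrmD hn _ _) hf2) _.
apply: le_trans (lerD (lerD (nrmD hn _ _) (lexx _)) (lexx _)) _.
have k1 : nrm ((x1 - y1) * p * pt) <= (1 + 2 * d) ^+ 2 * e.
  apply: le_trans (nrm_near1 _ hpt) _; rewrite expr2 -mulrA; apply: ler_wpM2l; first lra.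
  apply: le_trans (nrm_near1 _ hp) _; apply: ler_pM; rewrite ?(nrm_ge0 hn) //; lra.
have k2 : nrm (y1 * (p * (pt - p3))) <= (1 + 2 * d) ^+ 2 * e.
  apply: le_trans (nrm_near1l _ hy1) _; rewrite expr2 -mulrA.
  apply: ler_pM; rewrite ?(nrm_ge0 hn) //; try lra.
  apply: le_trans (nrm_near1l _ hp) _; apply: ler_pM; rewrite ?(nrm_ge0 hn) //; lra.
have k3 : nrm ((y1 * p - y3) * p3) <= (1 + d) * f.
  apply: le_trans (nrm_near1 _ hp3) _; apply: ler_wpM2l => //; lra.
lra.
Qed.

(* Split the partition at the first point where V a . reaches V a b / 2: both
   sides carry at most half of V, and 2 * 2^-theta < 1 absorbs the sum of the two
   errors. *)
Lemma sewing (theta c : R) : 1 < theta -> 0 <= c ->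
  exists e d K : R, [/\ 0 < e, 0 < d, d <= 1, 0 <= K & forall P V a b,
    ctrl a b V -> (forall s, a <= s -> s <= b -> P s s = 1) ->
    (forall s u t, a <= s -> s <= u -> u <= t -> t <= b ->
       nrm (P s u * P u t - P s t) <= c * V s t `^ theta) ->
    (forall s t, a <= s -> s <= t -> t <= b -> nrm (P s t - 1) <= d) ->
    V a b <= e -> forall delta D, part delta a b D ->
    nrm (prodP P a D - P a b) <= K * V a b `^ theta].
Proof.
move=> t1 c0; pose q : R := 2 `^ (1 - theta).
have q0 : 0 < q by rewrite powR_gt0.
have q1 : q < 1.
  have -> : 1 = 2 `^ 0 :> R by rewrite powRr0.
  rewrite /q /powR pnatr_eq0 /= ltr_expR ltr_pM2r ?ln_gt0 //; lra.
have half (x y : R) : 0 <= x -> x <= y / 2 -> x `^ theta <= q / 2 * y `^ theta.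
  by move=> x0 xy; apply: powR_half => //; lra.
clearbody q.
(* These constants close the recursion: d gives q (1 + 2 d)^2 <= (1 + q) / 2, the defects cost at
   most 3 c, and K (1 - q) / 2 = 3 c. The choice of e keeps the error on each half below d. *)
pose d := (1 - q) / 16; pose K := 6 * c / (1 - q); pose e := Num.min 1 (d / (K + 1)).
have dq : 16 * d = 1 - q by rewrite /d mulrC mulfVK.
have d0 : 0 < d by rewrite divr_gt0 // subr_gt0.
have K0 : 0 <= K by rewrite divr_ge0 ?mulr_ge0 // subr_ge0 ltW.
have Kc : K * (1 - q) = 6 * c by rewrite /K mulfVK // subr_eq0 gt_eqF.
have K1 : 0 < K + 1 by lra.
have e0 : 0 < e by rewrite lt_min ltr01 divr_gt0.
have e1 : e <= 1 by rewrite ge_min lexx.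
have Ke : (K + 1) * e <= d by rewrite mulrC -ler_pdivlMr // ge_min lexx orbT.
clearbody d K e.
exists e, d, K; split=> //; first lra.
move=> P V a b cV P1 PP Pd Ve delta.
suff gen n : forall a' b' D, (size D < n)%N -> a <= a' -> b' <= b -> part delta a' b' D ->
    nrm (prodP P a' D - P a' b') <= K * V a' b' `^ theta.
  by move=> D hD; apply: (gen (size D).+1 _ _ D).
elim: n => [//|n IH] a' b' D hs aa bb hD.
have ab := part_le hD.
have [D0|/eqP D0] := eqVneq D [::].
  move: hD; rewrite D0 /= => <-; rewrite P1 ?subrr ?(nrm0 hn) //; last by rewrite (le_trans ab).
  by rewrite mulr_ge0 ?powR_ge0.
have V0 : 0 <= V a' b' by apply: cV.1.
have Vd : V a' a' = 0 by apply: (ctrl_diag cV aa); exact: le_trans bb.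
have [||D1 [t [D2 [DE h1 h2 h3 [h4 h5]]]]] := part_split (V := V) (h :=
  V a' b' / 2) D0 _ _ hD; try by rewrite ?Vd; lra.
set l := last a' D1 in h1 h2 h4 *.
have al := part_le h1; have tb := part_le h3; have lt := ltW h2.
have at_ := le_trans al lt; have lb := le_trans lt tb.
have al' := le_trans aa al; have at' := le_trans aa at_.
have tb' := le_trans tb bb; have lb' := le_trans lb bb.
have Vt : V t b' <= V a' b' / 2 by have := cV.2 a' t b' aa at_ tb bb; lra.
have phi : V a' b' `^ theta <= V a' b'.
  have Ve' : V a' b' <= e by apply: le_trans Ve; exact: (ctrl_mono cV).
  have V1 : V a' b' <= 1 by exact: le_trans e1.
  have [->|nV] := eqVneq (V a' b') 0; first by rewrite powR0 //; lra.
  rewrite -[X in _ <= X]powRr1 //; apply: ger_powR; last lra.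
  by rewrite V1 lt_neqAle eq_sym nV V0.
pose w := V a' b' `^ theta.
have w0 : 0 <= w by exact: powR_ge0.
have we : w <= e by apply: le_trans phi _; apply: le_trans Ve; exact: (ctrl_mono cV).
have szs : (size D1 < n)%N /\ (size D2 < n)%N.
  by move: hs; rewrite DE size_cat /=; clear; lia.
have step s t' : a' <= s -> s <= t' -> t' <= b' -> V s t' <= V a' b' / 2 ->
    K * V s t' `^ theta <= K * (q / 2 * w).
  move=> s1 s2 s3 s4; apply: (ler_wpM2l K0); apply: half s4.
  by apply: cV.1 => //; [exact: le_trans s1|exact: le_trans bb].
have i1 : nrm (prodP P a' D1 - P a' l) <= K * (q / 2 * w).
  apply: le_trans (step a' l (lexx _) al lb h4).
  by apply: IH h1 => //; case: szs.
have i2 : nrm (prodP P t D2 - P t b') <= K * (q / 2 * w).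
  apply: le_trans (step t b' at_ tb (lexx _) Vt).
  by apply: IH h3 => //; case: szs.
have Kw : K * (q / 2 * w) <= d.
  have : K * w <= K * e by exact: ler_wpM2l.
  have : q / 2 * (K * w) <= 1 * (K * w) by apply: ler_wpM2r; [exact: mulr_ge0|lra].
  have -> : q / 2 * (K * w) = K * (q / 2 * w) by ring.
  lra.
have mono s t' : a' <= s -> s <= t' -> t' <= b' -> c * V s t' `^ theta <= c * w.
  move=> s1 s2 s3; apply: ler_wpM2l => //; apply: ge0_ler_powR; rewrite ?nnegrE //.
  - exact: le_trans (ltW t1).
  - by apply: cV.1 => //; [exact: le_trans s1|exact: le_trans bb].
  - exact: (ctrl_mono cV).
rewrite DE prodP_cat /= -/l.
apply: le_trans (sewing_step (d := d) (y1 := P a' l) (p3 := P t b') (y3 := P a' t) (e :=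
  K * (q / 2 * w)) (f := c * w) _ _ _ _ _ _ _ _ _) _ => //.
- exact: ltW.
- exact: Pd.
- exact: Pd.
- exact: Pd.
- by apply: le_trans (mono a' t _ _ _); [exact: PP| | |].
- by apply: le_trans (mono a' b' _ _ _); [exact: PP| | |].
clear -dq q0 q1 Kc K0 w0 c0 d0.
have d1 : d <= 1 by lra.
have dd : q * (1 + 2 * d) ^+ 2 <= (1 + q) / 2.
  have : d ^+ 2 <= d by rewrite expr2 ler_piMl // ltW.
  have : q * (8 * d) <= 8 * d by rewrite ler_piMl //; lra.
  have -> : (1 + 2 * d) ^+ 2 = 1 + 4 * d + 4 * d ^+ 2 by ring.
  move=> p1 p2; have : q * (1 + 4 * d + 4 * d ^+ 2) <= q * (1 + 8 * d).
    by apply: ler_wpM2l; lra.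
  lra.
have z1 : K * w * (q * (1 + 2 * d) ^+ 2) <= K * w * ((1 + q) / 2).
  by apply: ler_wpM2l => //; exact: mulr_ge0.
have z2 : c * w * (2 + d) <= c * w * 3 by apply: ler_wpM2l; [exact: mulr_ge0|lra].
have z3 : K * (1 - q) * w = 6 * c * w by rewrite Kc.
rewrite -/w; clearbody w; clear -z1 z2 z3; lra.
Qed.

(* The points are grouped in blocks on which V <= e; each block, together with the
   step that follows it, uses up e of V a b. *)
Lemma prodP_bound P V a b e B1 B2 n : ctrl a b V -> 0 < e -> 1 <= B1 -> 1 <= B2 ->
  (forall a' b' delta D, a <= a' -> b' <= b -> V a' b' <= e -> part delta a' b' D ->
     nrm (prodP P a' D) <= B1) ->
  (forall s t, a <= s -> s <= t -> t <= b -> nrm (P s t) <= B2) ->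
  V a b <= n%:R * e -> forall delta D, part delta a b D ->
  nrm (prodP P a D) <= B1 * (B1 * B2) ^+ n.
Proof.
move=> cV e0 B11 B21 h1 h2 + delta.
suff gen a' : a <= a' -> V a' b <= n%:R * e -> forall D, part delta a' b D ->
  nrm (prodP P a' D) <= B1 * (B1 * B2) ^+ n by exact: gen.
have B10 : 0 <= B1 by lra.
have B12 : 1 <= B1 * B2 by rewrite mulr_ege1.
elim: n a' => [|n IH] a' aa Vn D hD.
  by rewrite mulr1; apply: h1 hD => //; lra.
have [Ve|Ve] := leP (V a' b) e.
  apply: le_trans (h1 _ _ _ _ aa (lexx _) Ve hD) _.
  by rewrite ler_peMr // exprn_ege1.
have ab := part_le hD.
have D0 : D <> [::].
  move=> D0; move: hD Ve; rewrite D0 /= => eb; subst b.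
  by rewrite (ctrl_diag cV aa (lexx _)) ltNge (ltW e0).
have Vd : V a' a' = 0 by apply: (ctrl_diag cV aa).
have [||D1 [t [D2 [-> k1 k2 k3 [k4 k5]]]]] := part_split (V := V) (h := e) D0 _ _ hD;
  try by rewrite ?Vd; lra.
have al := part_le k1; have tb := part_le k3.
rewrite prodP_cat /= exprS.
have Vt : V t b <= n%:R * e.
  have := cV.2 a' t b aa (le_trans al (ltW k2)) tb (lexx _).
  by move: Vn; rewrite -[n.+1%:R]natr1; lra.
have at_ : a <= t by rewrite (le_trans aa) // (le_trans al) // ltW.
have i1 := IH t at_ Vt D2 k3.
have i2 := h1 _ (last a' D1) _ _ aa (le_trans (ltW k2) tb) k4 k1.
have i3 := h2 (last a' D1) t (le_trans aa al) (ltW k2) tb.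
have i4 : nrm (P (last a' D1) t * prodP P t D2) <= B2 * (B1 * (B1 * B2) ^+ n).
  by apply: le_trans (nrmM hn _ _) _; apply: ler_pM; rewrite ?(nrm_ge0 hn).
have -> : B1 * (B1 * B2 * (B1 * B2) ^+ n) = B1 * (B2 * (B1 * (B1 * B2) ^+ n)) by ring.
by apply: le_trans (nrmM hn _ _) _; apply: ler_pM; rewrite ?(nrm_ge0 hn).
Qed.

End Sewing.

(** * Almost multiplicative functionals from truncated tensors *)

Section Words.
Variables (V : nmodType) (d : nat).

Fixpoint wsum n (f : seq 'I_d -> V) : V :=
  if n is n'.+1 then \sum_i wsum n' (fun w => f (i :: w)) else f [::].

Lemma eq_wsum n f1 f2 : (forall w, size w = n -> f1 w = f2 w) -> wsum n f1 = wsum n f2.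
Proof.
elim: n f1 f2 => [|n IH] f1 f2 h /=; first exact: h.
by apply: eq_bigr => i _; apply: IH => w hw; apply: h; rewrite /= hw.
Qed.

Lemma wsum_cat m n f : wsum (m + n) f = wsum m (fun u => wsum n (fun v => f (u ++ v))).
Proof. by elim: m f => [//|m IH] f /=; apply: eq_bigr => i _; rewrite IH. Qed.

Lemma wsum_sum (I : finType) n (F : I -> seq 'I_d -> V) :
  wsum n (fun w => \sum_i F i w) = \sum_i wsum n (F i).
Proof.
elim: n F => [//|n IH] F /=; rewrite exchange_big; apply: eq_bigr => i _.
exact: (IH (fun j w => F j (i :: w))).
Qed.

Lemma wsumD n f g : wsum n (fun w => f w + g w) = wsum n f + wsum n g.
Proof. by elim: n f g => [//|n IH] f g /=; rewrite -big_split; apply: eq_bigr => i _. Qed.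

End Words.

Lemma wsum_mulr (A : pzRingType) d n (f : seq 'I_d -> A) x :
  wsum n f * x = wsum n (fun w => f w * x).
Proof. by elim: n f => [//|n IH] f /=; rewrite mulr_suml; apply: eq_bigr => i _;
  rewrite IH. Qed.

Lemma wsum_mull (A : pzRingType) d n (f : seq 'I_d -> A) x :
  x * wsum n f = wsum n (fun w => x * f w).
Proof. by elim: n f => [//|n IH] f /=; rewrite mulr_sumr; apply: eq_bigr => i _;
  rewrite IH. Qed.

Lemma wsum_ge0 (R : numDomainType) d n (f : seq 'I_d -> R) : (forall w, 0 <= f w) ->
  0 <= wsum n f.
Proof. by elim: n f => [|n IH] f h /=; [|apply: sumr_ge0 => i _; apply: IH]. Qed.

Lemma ler_wsum (R : numDomainType) d n (f g : seq 'I_d -> R) :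
  (forall w, size w = n -> f w <= g w) -> wsum n f <= wsum n g.
Proof.
elim: n f g => [|n IH] f g h /=; first exact: h.
by apply: ler_sum => i _; apply: IH => w hw; apply: h; rewrite /= hw.
Qed.

Lemma wsum_cst (R : numDomainType) d n (c : R) : wsum n (fun _ : seq 'I_d => c) = (d ^ n)%:R
  * c.
Proof.
elim: n => [|n IH] /=; first by rewrite expn0 mul1r.
by rewrite sumr_const card_ord IH expnS natrM -mulrA [RHS]mulr_natl.
Qed.

Lemma wsum_ge_term (R : numDomainType) d n (f : seq 'I_d -> R) w :
  (forall w, 0 <= f w) -> size w = n -> f w <= wsum n f.
Proof.
move=> + <-; elim: w {n} f => [//|i w IH] f f0 /=.
apply: le_trans (IH (fun w => f (i :: w)) _) _ => //.
by rewrite (bigD1 i) //= ler_wpDr //; apply: sumr_ge0 => j _; apply: wsum_ge0 => v.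
Qed.

(** * Multiplicative functionals on truncated tensors *)

Section Multiplicative.
Variables (R : realType) (d N : nat) (p : R).

Definition multiplicative (a b : R) (x : R -> R -> tseries R d) :=
  (forall s t, a <= s -> s <= t -> t <= b -> x s t [::] = 1) /\
  forall s u t, a <= s -> s <= u -> u <= t -> t <= b ->
    forall w, (size w <= N)%N -> x s t w = tmul (x s u) (x u t) w.

Definition holder (a b : R) (V : R -> R -> R) (x : R -> R -> tseries R d) :=
  forall s t, a <= s -> s <= t -> t <= b ->
    forall w, (size w <= N)%N -> `|x s t w| <= V s t `^ ((size w)%:R / p).

Lemma multiplicative_sub a b a' b' x : a <= a' -> b' <= b -> multiplicative a b x ->
  multiplicative a' b' x.
Proof.
move=> aa bb [h1 h2]; split=> [s t l1 l2 l3|s u t l1 l2 l3 l4].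
  by apply: h1; lra.
by apply: h2; lra.
Qed.

Lemma holder_sub a b a' b' V x : a <= a' -> b' <= b -> holder a b V x -> holder a' b' V x.
Proof. by move=> aa bb h s t l1 l2 l3; apply: h; lra. Qed.

Lemma multiplicative_diag a b x s w : multiplicative a b x -> a <= s -> s <= b ->
  (0 < size w <= N)%N -> x s s w = 0.
Proof.
move=> [h1 h2] as_ sb /andP[w0 wN].
have [n] := ubnP (size w); elim: n w w0 wN => // n IH w w0 wN hn.
have := h2 s s s as_ (lexx _) (lexx _) sb w wN.
rewrite /tmul; case sw : (size w) w0 wN hn => [//|l] _ lN ln.
rewrite big_ord_recl big_ord_recr /= take0 drop0 /bump /= add1n -sw take_size drop_size.
rewrite h1 // mul1r mulr1 big1 ?add0r; first by lra.
move=> i _; have il := ltn_ord i; rewrite add1n.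
have st : size (take i.+1 w) = i.+1 by rewrite size_takel // sw ltnW.
have iN : (i.+1 <= N)%N by exact: leq_trans il (ltnW lN).
have hi : (i.+1 < n)%N by exact: leq_ltn_trans il ln.
by rewrite [X in X * _]IH ?mul0r // st.
Qed.

End Multiplicative.

(** * Evaluation of truncated tensors in a normed algebra *)

Section Evaluation.
Variables (R : realType) (A : nzRingType) (nrm : A -> R) (hn : ring_norm nrm).
Variables (sc : {rmorphism R -> A}) (d N : nat) (p : R).
Hypotheses (scC : forall c x, sc c * x = x * sc c) (scN : forall c x,
  nrm (sc c * x) <= `|c| * nrm x).
Hypotheses (p0 : 0 < p) (Np : N%:R <= p) (pN : p < N.+1%:R).
Implicit Types (m : 'I_d -> A) (x y z : tseries R d) (u w : seq 'I_d) (L e : R).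

Definition wprod m w := foldr (fun i acc => m i * acc) 1 w.

Lemma wprod_cat m u (v : seq 'I_d) : wprod m (u ++ v) = wprod m u * wprod m v.
Proof. by elim: u => [|i u IH] /=; rewrite ?mul1r // IH mulrA. Qed.

(** The algebra A is abstract because it is taken twice: matrices, for the flow at a given
    parameter, and polynomials in mu with matrix coefficients. [ev m (x s t)] is the functional
    P. *)
Definition ev_level m x n := wsum n (fun w => sc (x w) * wprod m w).
Definition ev m x := \sum_(n < N.+1) ev_level m x n.

Lemma ev_level_tmul m x y z n : (forall w, size w = n -> z w = tmul x y w) ->
  ev_level m z n = \sum_(i < n.+1) ev_level m x i * ev_level m y (n - i).
Proof.
move=> h; rewrite /ev_level.
rewrite (@eq_wsum _ _ _ _ (fun w => \sum_(i < n.+1) sc (x (take i w)) * wprod m (take i w) *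
   (sc (y (drop i w)) * wprod m (drop i w)))); last first.
  move=> w hw; rewrite h // /tmul rmorph_sum mulr_suml hw; apply: eq_bigr => i _.
  have -> : wprod m w = wprod m (take i w) * wprod m (drop i w).
    by rewrite -wprod_cat cat_take_drop.
  by rewrite rmorphM -!mulrA; congr (_ * _); rewrite !mulrA scC.
rewrite (wsum_sum n (fun (i : 'I_n.+1) w => sc (x (take i w)) * wprod m (take i w) *
   (sc (y (drop i w)) * wprod m (drop i w)))).
apply: eq_bigr => i _.
have hi : n = (i + (n - i))%N by rewrite subnKC // -ltnS.
rewrite {1}hi wsum_cat wsum_mulr; apply: eq_wsum => u hu.
rewrite wsum_mull; apply: eq_wsum => v hv.
by rewrite -hu take_size_cat // drop_size_cat.
Qed.

(** By Chen's relation the terms with i + j <= N of the double sum are exactly the levels of z, so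
    only those of total degree above N survive. *)
Lemma ev_defect m x y z : (forall w, (size w <= N)%N -> z w = tmul x y w) ->
  ev m x * ev m y - ev m z =
  \sum_(i < N.+1) \sum_(j < N.+1 | (N < i + j)%N) ev_level m x i * ev_level m y j.
Proof.
move=> h; rewrite /ev big_distrlr /=.
have -> : \sum_(n < N.+1) ev_level m z n =
    \sum_(i < N.+1) \sum_(j < N.+1 | (i + j <= N)%N) ev_level m x i * ev_level m y j.
  rewrite (eq_bigr (fun n : 'I_N.+1 => \sum_(i < N.+1 | (i <= n)%N)
      ev_level m x i * ev_level m y (n - i))); last first.
    move=> n _; rewrite (@ev_level_tmul m x y z) => [|w hw]; last first.
      by rewrite h // hw -ltnS.
    rewrite (big_ord_widen N.+1 (fun i => ev_level m x i * ev_level m y (n - i))) //.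
  rewrite (exchange_big_dep xpredT) //=; apply: eq_bigr => i _.
  rewrite -(big_mkord (fun n => (i <= n)%N) (fun n => ev_level m x i * ev_level m y (n - i))).
  rewrite -(big_mkord (fun j => (i + j <= N)%N) (fun j => ev_level m x i * ev_level m y j)).
  have iN : (i <= N.+1)%N by rewrite ltnW.
  rewrite (big_cat_nat (n := i)) //= big_nat_cond big1 ?add0r; last first.
    by move=> j /andP[/andP[_ ji]]; rewrite leqNgt ji.
  rewrite -{1}[nat_of_ord i]add0n big_addn.
  rewrite [RHS](big_cat_nat (n := (N.+1 - i)%N)) //= ?leq_subr //.
  rewrite [X in _ = _ + X]big_nat_cond [X in _ = _ + X]big1 ?addr0; last first.
    by move=> j; have := ltn_ord i; lia.
  rewrite big_nat_cond [RHS]big_nat_cond; apply: eq_big => [j|j _]; last by rewrite addnK.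
  by have := ltn_ord i; lia.
rewrite -sumrB; apply: eq_bigr => i _.
rewrite (bigID (fun j : 'I_N.+1 => (i + j <= N)%N)) /= addrC addrK.
by apply: eq_bigl => j; rewrite -ltnNge.
Qed.

Definition ev_cst (L : R) n := (d ^ n)%:R * (nrm 1 * L ^+ n).

Lemma wprod_bound m L w : (forall i, nrm (m i) <= L) -> nrm (wprod m w) <= nrm 1 * L ^+ size w.
Proof.
move=> h; elim: w => [|i w IH] /=; first by rewrite mulr1.
have L0 : 0 <= L by exact: le_trans (nrm_ge0 hn (m i)) (h i).
rewrite exprS mulrCA; apply: le_trans (nrmM hn _ _) _.
by apply: ler_pM; rewrite ?(nrm_ge0 hn).
Qed.

Lemma nrm_wsum n (f : seq 'I_d -> A) (g : seq 'I_d -> R) :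
  (forall w, size w = n -> nrm (f w) <= g w) -> nrm (wsum n f) <= wsum n g.
Proof.
elim: n f g => [|n IH] f g h /=; first exact: h.
by apply: nrm_sum => // i _; apply: IH => w hw; apply: h; rewrite /= hw.
Qed.

Lemma ev_level_bound m L x n (e : R) : (forall i, nrm (m i) <= L) -> 
  (forall w, size w = n -> `|x w| <= e) -> nrm (ev_level m x n) <= ev_cst L n * e.
Proof.
move=> hm hx; rewrite /ev_cst -mulrA -wsum_cst; apply: nrm_wsum => w hw.
apply: le_trans (scN _ _) _; rewrite mulrC; apply: ler_pM; rewrite ?(nrm_ge0 hn) //.
  by rewrite -hw; exact: wprod_bound.
exact: hx.
Qed.

Definition ev_tot L := \sum_(n < N.+1) ev_cst L n.

Lemma ev_cst_ge0 L n : 0 <= L -> 0 <= ev_cst L n.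
Proof. by move=> L0; rewrite /ev_cst !mulr_ge0 ?(nrm_ge0 hn) ?exprn_ge0. Qed.

Lemma ev_tot_ge0 L : 0 <= L -> 0 <= ev_tot L.
Proof. by move=> L0; apply: sumr_ge0 => n _; exact: ev_cst_ge0. Qed.

Lemma ev_bound m L x e : 0 <= L -> (forall i, nrm (m i) <= L) -> 0 <= e -> 
  (forall w, (size w <= N)%N -> `|x w| <= e) -> nrm (ev m x) <= ev_tot L * e.
Proof.
move=> L0 hm e0 hx; rewrite /ev_tot mulr_suml; apply: nrm_sum => // n _.
by apply: ev_level_bound => // w hw; apply: hx; rewrite hw -ltnS.
Qed.

Lemma ev0 m x : x [::] = 1 -> ev_level m x 0 = 1.
Proof. by move=> h; rewrite /ev_level /= h rmorph1 mul1r. Qed.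

Lemma ev_near1 m L x e : 0 <= L -> (forall i, nrm (m i) <= L) -> 0 <= e -> x [::] = 1 ->
  (forall w, (0 < size w <= N)%N -> `|x w| <= e) -> nrm (ev m x - 1) <= ev_tot L * e.
Proof.
move=> L0 hm e0 x1 hx.
rewrite /ev big_ord_recl ev0 // [1 + _]addrC addrK /ev_tot big_ord_recl mulrDl mulr_suml.
rewrite ler_wpDl ?(mulr_ge0 (ev_cst_ge0 _ L0) e0) //; apply: nrm_sum => // n _.
by apply: ev_level_bound => // w hw; apply: hx; rewrite hw /= /bump /= add1n.
Qed.

Lemma level_neq0 k : (0 < k)%N -> k%:R / p != 0.
Proof. by move=> k0; rewrite gt_eqF // divr_gt0 // ltr0n. Qed.

Lemma powR_level (v : R) n : 0 <= v -> v <= 1 -> (0 < n)%N -> v `^ (n%:R / p) <= v `^ p^-1.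
Proof.
move=> v0 v1 n0; have [->|v00] := eqVneq v 0.
  by rewrite !powR0 ?level_neq0 // gt_eqF // invr_gt0.
apply: ger_powR; first by rewrite v1 lt_neqAle eq_sym v00 v0.
by rewrite ler_peMl ?invr_ge0 ?(ltW p0) // ler1n.
Qed.

(** The surviving terms have i + j >= N + 1, and for v <= 1 the smallest exponent is the worst one.
    The resulting exponent (N + 1) / p exceeds 1 because p < N + 1. *)
Lemma ev_almost_mult m L x y z (v : R) : 0 <= L -> (forall i, nrm (m i) <= L) ->
  0 <= v -> v <= 1 ->
  (forall w, (size w <= N)%N -> z w = tmul x y w) ->
  (forall w, (size w <= N)%N -> `|x w| <= v `^ ((size w)%:R / p)) ->
  (forall w, (size w <= N)%N -> `|y w| <= v `^ ((size w)%:R / p)) ->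
  nrm (ev m x * ev m y - ev m z) <= ev_tot L ^+ 2 * v `^ (N.+1%:R / p).
Proof.
move=> L0 hm v0 v1 hz hx hy; rewrite (ev_defect m hz).
rewrite expr2 /ev_tot big_distrlr /= mulr_suml; apply: nrm_sum => // i _.
rewrite mulr_suml [X in _ <= X](bigID (fun j : 'I_N.+1 => (N < i + j)%N)) /= ler_wpDr //.
  by apply: sumr_ge0 => j _; rewrite !mulr_ge0 ?powR_ge0 ?ev_cst_ge0 ?(nrm_ge0 hn) ?exprn_ge0.
apply: nrm_sum => // j hij.
have iN : (i <= N)%N by rewrite -ltnS.
have jN : (j <= N)%N by rewrite -ltnS.
have h1 : nrm (ev_level m x i) <= ev_cst L i * v `^ (i%:R / p).
  by apply: ev_level_bound => // w hw; rewrite -hw hx // hw.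
have h2 : nrm (ev_level m y j) <= ev_cst L j * v `^ (j%:R / p).
  by apply: ev_level_bound => // w hw; rewrite -hw hy // hw.
apply: le_trans (nrmM hn _ _) _; apply: le_trans (ler_pM _ _ h1 h2) _; rewrite ?(nrm_ge0 hn) //.
rewrite mulrACA ler_wpM2l ?(mulr_ge0 (ev_cst_ge0 _ L0) (ev_cst_ge0 _ L0)) //.
(* Since 0^0 = 1, exponents are added only for nonzero v; at v = 0 one of i, j is positive and its
   factor vanishes. *)
have [->|v00] := eqVneq v 0.
  have : (0 < i)%N || (0 < j)%N by lia.
  case/orP => h; first by rewrite powR0 ?level_neq0 // mul0r powR_ge0.
  by rewrite [X in _ * X]powR0 ?level_neq0 // mulr0 powR_ge0.
rewrite -powRD ?v00 ?implybT // -mulrDl -natrD; apply: ger_powR.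
  by rewrite v1 lt_neqAle eq_sym v00 v0.
by rewrite ler_pM2r ?invr_gt0 // ler_nat.
Qed.

Lemma theta_gt1 : 1 < N.+1%:R / p.
Proof. by rewrite ltr_pdivlMr // mul1r. Qed.

(** The constants are chosen before the path, the control and the matrices, which enter only through
    L. This uniformity is the source of an r that does not depend on X. *)
Lemma rough_sewing L : 0 <= L -> exists e K : R, [/\ 0 < e, 0 <= K &
  forall m (x : R -> R -> tseries R d) V (a b : R), (forall i, nrm (m i) <= L) -> ctrl a b V ->
    multiplicative N a b x -> holder N p a b V x -> V a b <= e ->
    (forall s t, a <= s -> s <= t -> t <= b -> nrm (ev m (x s t) - 1) <= 1) /\
    forall delta D, part delta a b D ->
    nrm (prodP (fun s t => ev m (x s t)) a D - ev m (x a b)) <= K * V a b `^ (N.+1%:R / p)].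
Proof.
move=> L0; have B0 := ev_tot_ge0 L0.
have [e [dl [K [e0 d0 d1 K0 h]]]] := sewing hn theta_gt1 (sqr_ge0 (ev_tot L)).
have B1 : 0 < ev_tot L + 1 by lra.
(* V <= 1 bounds every positive level by V^(1/p), V <= e is what sewing asks for, and the third
   bound puts [ev] within dl of 1. *)
pose e1 := Num.min 1 (Num.min e ((dl / (ev_tot L + 1)) `^ p)).
exists e1, K; split=> //; first by rewrite !lt_min ltr01 e0 powR_gt0 // divr_gt0.
move=> m x V a b hm cV mx hx Ve.
have [V1 V2 V3] : [/\ V a b <= 1, V a b <= e & V a b <= (dl / (ev_tot L + 1)) `^ p].
  by move: Ve; rewrite !le_min => /and3P[].
have V0 s t : a <= s -> s <= t -> t <= b -> 0 <= V s t by exact: cV.1.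
have Vm s t : a <= s -> s <= t -> t <= b -> V s t <= V a b.
  by move=> s1 s2 s3; apply: (ctrl_mono cV).
have near1 s t : a <= s -> s <= t -> t <= b -> nrm (ev m (x s t) - 1) <= dl.
  move=> s1 s2 s3; apply: le_trans (ev_near1 L0 hm (powR_ge0 (V s t) p^-1) _ _) _.
  - exact: mx.1.
  - move=> w /andP[w0 wN]; apply: le_trans (hx s t s1 s2 s3 w wN) _.
    by apply: powR_level => //; [exact: V0|apply: le_trans V1; exact: Vm].
  have : V s t `^ p^-1 <= dl / (ev_tot L + 1).
    have -> : dl / (ev_tot L + 1) = ((dl / (ev_tot L + 1)) `^ p) `^ p^-1.
      by rewrite -powRrM mulfV ?gt_eqF // powRr1 // divr_ge0 // ltW.
    apply: ge0_ler_powR; rewrite ?nnegrE ?powR_ge0 ?V0 ?invr_ge0 ?(ltW p0) //.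
    by apply: le_trans V3; exact: Vm.
  rewrite ler_pdivlMr // mulrDr mulr1 [_ * ev_tot L]mulrC.
  by have := powR_ge0 (V s t) p^-1; lra.
split=> [s t s1 s2 s3|]; first by apply: le_trans (near1 s t s1 s2 s3) _.
apply: h => //.
- move=> s as_ sb; have := @ev_near1 m L (x s s) 0 L0 hm (lexx _) (mx.1 s s as_ (lexx _) sb).
  rewrite mulr0 => hh; apply/eqP; rewrite -subr_eq0.
  have -> : ev m (x s s) - 1 = 0; last by [].
  rewrite /ev big_ord_recl ev0 ?mx.1 // [1 + _]addrC addrK big1 // => n _.
  rewrite /ev_level (@eq_wsum _ _ _ _ (fun w => sc (0:R) * 0)) => [|w hw]; last first.
    rewrite (multiplicative_diag mx as_ sb) ?rmorph0 ?mul0r //.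
    by rewrite hw /= /bump /= add1n.
  by rewrite -wsum_mull rmorph0 mul0r.
- move=> s u t s1 s2 s3 s4.
  have [u1 u2 u3] : [/\ a <= u, u <= b & s <= t] by split; lra.
  apply: ev_almost_mult => //; [exact: V0|by apply: le_trans V1; exact: Vm|exact: mx.2| |].
  + move=> w hw; apply: le_trans (hx s u s1 s2 u2 w hw) _.
    apply: ge0_ler_powR; rewrite ?nnegrE ?divr_ge0 ?(ltW p0) ?V0 //.
    exact: (ctrl_mono cV).
  + move=> w hw; apply: le_trans (hx u t u1 s3 s4 w hw) _.
    apply: ge0_ler_powR; rewrite ?nnegrE ?divr_ge0 ?(ltW p0) ?V0 //.
    exact: (ctrl_mono cV).
Qed.

Lemma rough_bound L W : 0 <= L -> exists2 C : R, 0 < C &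
  forall m (x : R -> R -> tseries R d) V (a b : R), (forall i, nrm (m i) <= L) -> ctrl a b V ->
    multiplicative N a b x -> holder N p a b V x -> V a b <= W ->
    forall delta D, part delta a b D -> nrm (prodP (fun s t => ev m (x s t)) a D) <= C.
Proof.
move=> L0; have [e [K [e0 K0 h]]] := rough_sewing L0.
have B0 := ev_tot_ge0 L0; have n1 := nrm_ge0 hn 1.
(* B1 bounds a product over a block with V <= e: it is within K e^theta of [ev], which is within 1
   of the unit. B2 bounds a single step, as the exponents n / p are at most 1, and n >= |W| / e
   counts the cuts. *)
pose B1 := 2 + nrm 1 + K * e `^ (N.+1%:R / p).
pose B2 := 1 + ev_tot L * (1 + `|W|).
have B11 : 1 <= B1 by have := mulr_ge0 K0 (powR_ge0 e (N.+1%:R / p)); rewrite /B1; lra.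
have B21 : 1 <= B2 by rewrite /B2 lerDl mulr_ge0 ?addr_ge0 //.
pose n := Num.Def.archi_bound (`|W| / e).
have Wn : W <= n%:R * e.
  rewrite -ler_pdivrMr //; apply/ltW; apply: le_lt_trans (archi_boundP _).
    by rewrite ler_pM2r ?invr_gt0 // ler_norm.
  by rewrite divr_ge0 // ltW.
exists (B1 * (B1 * B2) ^+ n).
  by rewrite mulr_gt0 ?exprn_gt0 ?mulr_gt0 //; lra.
move=> m x V a b hm cV mx hx VW delta D hD; have ab := part_le hD.
apply: (prodP_bound hn cV e0 B11 B21 _ _ _ hD); last exact: le_trans Wn.
- move=> a' b' dl D' aa bb Ve hD'.
  have cV' : ctrl a' b' V by exact: ctrl_sub cV.
  have [k1 k2] := h m x V a' b' hm cV' (multiplicative_sub aa bb mx) (holder_sub aa bb hx) Ve.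
  have ab' := part_le hD'.
  have := k2 dl D' hD'; have := k1 a' b' (lexx _) ab' (lexx _).
  set P1 := prodP _ _ _; set P2 := ev _ _ => l1 l2.
  have l3 : nrm (P1 - P2 + (P2 - 1) + 1) <= nrm (P1 - P2) + nrm (P2 - 1) + nrm 1.
    apply: le_trans (nrmD hn _ _) _; rewrite lerD2r; exact: nrmD.
  move: l3; rewrite subrKA subrK => l3.
  have l4 : K * V a' b' `^ (N.+1%:R / p) <= K * e `^ (N.+1%:R / p).
    apply: ler_wpM2l => //; apply: ge0_ler_powR;
      rewrite ?nnegrE ?divr_ge0 ?(ltW p0) ?(ltW e0) //.
    exact: cV'.1.
  by rewrite /B1; lra.
- move=> s t s1 s2 s3; apply: (@le_trans _ _ (ev_tot L * (1 + `|W|))); last by rewrite /B2; lra.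
  apply: ev_bound => //.
  move=> w wN; apply: le_trans (hx s t s1 s2 s3 w wN) _.
  apply: (@le_trans _ _ ((1 + `|W|) `^ ((size w)%:R / p))).
    apply: ge0_ler_powR; rewrite ?nnegrE ?divr_ge0 ?(ltW p0) ?cV.1 ?addr_ge0 //.
    have := ctrl_mono cV (lexx _) s1 s2 s3 (lexx _); have := ler_norm W; lra.
  rewrite -[X in _ <= X]powRr1 ?addr_ge0 //; apply: ler_powR; first by rewrite lerDl.
  rewrite ler_pdivrMr // mul1r; apply: le_trans Np; by rewrite ler_nat.
Qed.

End Evaluation.

(** * Polynomials with matrix coefficients *)

Section Telescope.
Variables (R : realType) (A : nzRingType) (nrm : A -> R) (hn : ring_norm nrm).

(** The defect on each interval is multiplied by the product over the later ones, hence the need for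
    a bound C on these products that does not depend on their number of factors. *)
Lemma telescope_prodP (Y : R -> A) (P : R -> R -> A) U (C lo a b delta : R) D :
  ctrl lo b U -> lo <= a -> 0 <= C ->
  (forall s t, lo <= s -> s <= t -> t <= b -> t - s < delta ->
     nrm (Y t - Y s * P s t) <= U s t) ->
  (forall a' D', lo <= a' -> part delta a' b D' -> nrm (prodP P a' D') <= C) ->
  part delta a b D -> nrm (Y b - Y a * prodP P a D) <= U a b * C.
Proof.
move=> cU + C0 hY hP; elim: D a => [|t D IH] a la /=.
  by move=> ab; rewrite ab mulr1 subrr (nrm0 hn) mulr_ge0 // cU.1 // -ab.
move=> [at_ td hD]; have tb := part_le hD; have lt := le_trans la (ltW at_).
have -> : Y b - Y a * (P a t * prodP P t D) =
    (Y b - Y t * prodP P t D) + (Y t - Y a * P a t) * prodP P t D.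
  by rewrite mulrBl mulrA subrKA.
apply: le_trans (nrmD hn _ _) _.
apply: (@le_trans _ _ (U t b * C + U a t * C)); last first.
  by rewrite addrC -mulrDl; apply: ler_wpM2r => //; apply: cU.2 => //; exact: ltW.
apply: lerD; first exact: IH.
apply: le_trans (nrmM hn _ _) _; apply: ler_pM; rewrite ?(nrm_ge0 hn) //.
  by apply: hY => //; exact: ltW.
exact: hP hD.
Qed.

End Telescope.

Section Morphism.
Variables (R : realType) (A B : nzRingType) (h : {rmorphism A -> B}).
Variables (sA : {rmorphism R -> A}) (sB : {rmorphism R -> B}).
Hypothesis hs : forall c, h (sA c) = sB c.

Lemma rmorph_prodP (P : R -> R -> A) a D : h (prodP P a D) = prodP (fun s t => h (P s t)) a D.
Proof. by elim: D a => [|t D IH] a /=; rewrite ?rmorph1 // rmorphM IH. Qed.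

Lemma rmorph_wsum d n (f : seq 'I_d -> A) : h (wsum n f) = wsum n (fun w => h (f w)).
Proof.
by elim: n f => [//|n IH] f /=; rewrite rmorph_sum; apply: eq_bigr => i _; rewrite IH.
Qed.

Lemma rmorph_ev d N (m : 'I_d -> A) (x : tseries R d) :
  h (ev sA N m x) = ev sB N (h \o m) x.
Proof.
rewrite /ev rmorph_sum; apply: eq_bigr => n _; rewrite /ev_level rmorph_wsum.
apply: eq_wsum => w _; rewrite rmorphM hs; congr (_ * _).
by elim: w => [|i w IH] /=; rewrite ?rmorph1 // rmorphM IH.
Qed.

End Morphism.

Section MatrixPolynomials.
Variables (R : realType) (k : nat).
Local Notation Mat := 'M[R]_k.+1.
Implicit Types (q y : {poly Mat}) (r c mu : R) (O : Mat).

Lemma hs_ring_norm : ring_norm (@hs_norm R k.+1 k.+1).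
Proof.
split=> [x|x y|x||x y]; [exact: hs_norm_ge0|exact: hs_normD|exact: hs_normN|
 exact: hs_norm0|exact: hs_normM].
Qed.

Lemma scalar_mx_central c (x : Mat) : c%:M * x = x * c%:M.
Proof. by rewrite -!mulmxE scalar_mxC. Qed.

Lemma hs_scalar_mx c (x : Mat) : hs_norm (c%:M * x) <= `|c| * hs_norm x.
Proof. by rewrite -mulmxE mul_scalar_mx hs_normZ. Qed.

(** The Wiener norm is the value at r of a real polynomial, so that its properties become
    coefficientwise inequalities ([ler_horner]). *)
Definition majorant q : {poly R} := \poly_(i < size q) hs_norm q`_i.
Definition pnorm r q := (majorant q).[r].

Lemma coef_majorant q i : (majorant q)`_i = hs_norm q`_i.
Proof.
rewrite coef_poly; case: ltnP => // h; rewrite [q`_i]nth_default //.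
by rewrite hs_norm0.
Qed.

Lemma ler_horner (f g : {poly R}) r : 0 <= r -> (forall i, f`_i <= g`_i) -> f.[r] <= g.[r].
Proof.
move=> r0 h; pose s := maxn (size f) (size g).
rewrite (@horner_coef_wide _ s) ?leq_maxl // (@horner_coef_wide _ s g) ?leq_maxr //.
by apply: ler_sum => i _; rewrite ler_wpM2r ?exprn_ge0.
Qed.

Lemma pnorm_ring_norm r : 0 <= r -> ring_norm (pnorm r).
Proof.
move=> r0; split.
- move=> q; rewrite -(horner0 r); apply: ler_horner => // i.
  by rewrite coef0 coef_majorant hs_norm_ge0.
- move=> q y; rewrite -hornerD; apply: ler_horner => // i.
  by rewrite coefD !coef_majorant coefD hs_normD.
- move=> q; congr horner; apply/polyP => i.
  by rewrite !coef_majorant coefN hs_normN.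
- rewrite /pnorm -[RHS](horner0 r); congr horner; apply/polyP => i.
  by rewrite !coef_majorant !coef0 hs_norm0.
- move=> q y; rewrite -hornerM; apply: ler_horner => // i.
  rewrite coefM coef_majorant coefM; apply: (nrm_sum hs_ring_norm) => j _.
  by rewrite !coef_majorant; exact: hs_normM.
Qed.

Lemma pnormC r O : pnorm r O%:P = hs_norm O.
Proof.
rewrite /pnorm -[RHS](hornerC _ r); congr horner; apply/polyP => i.
by rewrite coef_majorant !coefC; case: eqP => // _; rewrite hs_norm0.
Qed.

Lemma pnorm_scalar r c q : 0 <= r -> pnorm r ((c%:M)%:P * q) <= `|c| * pnorm r q.
Proof.
move=> r0; rewrite -hornerZ; apply: ler_horner => // i.
by rewrite coef_majorant coefCM coefZ coef_majorant hs_scalar_mx.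
Qed.

Lemma coef_pnorm r q n : 0 <= r -> hs_norm q`_n * r ^+ n <= pnorm r q.
Proof.
move=> r0; rewrite -coef_majorant /pnorm.
have [h|h] := ltnP n (size (majorant q)); last first.
  rewrite nth_default // mul0r; exact: (nrm_ge0 (pnorm_ring_norm r0) q).
rewrite horner_coef (bigD1 (Ordinal h)) //= ler_wpDr //; apply: sumr_ge0 => i _.
by rewrite coef_majorant mulr_ge0 ?hs_norm_ge0 ?exprn_ge0.
Qed.

Lemma pnorm_tail r q : 0 <= r -> r <= 1 -> pnorm r (q - (q`_0)%:P) <= r * pnorm 1 q.
Proof.
move=> r0 r1; have [->|] := eqVneq q 0.
  have n0 := nrm0 (pnorm_ring_norm r0); have n1 := nrm0 (pnorm_ring_norm ler01).
  by rewrite coef0 polyC0 subr0 n0 n1 mulr0.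
move=> _; pose s := (size q).+1.
have sq : (size (majorant q) <= s)%N by apply: leq_trans (size_poly _ _) _.
have sq' : (size (majorant (q - (q`_0)%:P)) <= s)%N.
  apply: leq_trans (size_poly _ _) _; apply: leq_trans (size_polyD _ _) _.
  by rewrite geq_max leqnSn size_polyN (leq_trans (size_polyC_leq1 _)).
rewrite /pnorm (horner_coef_wide _ sq) (horner_coef_wide _ sq') mulr_sumr.
apply: ler_sum => i _; rewrite !coef_majorant expr1n mulr1 coefB coefC.
case: i => [[|i] hi] /=; first by rewrite subrr hs_norm0 mul0r mulr_ge0 ?hs_norm_ge0.
rewrite subr0 mulrC ler_wpM2r ?hs_norm_ge0 //.
by rewrite exprS ler_piMr // exprn_ile1.
Qed.

Lemma pnorm_mulC r c y O : 0 <= r -> (forall B : Mat, hs_norm (B * O) <= c * hs_norm B) ->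
  pnorm r (y * O%:P) <= c * pnorm r y.
Proof.
move=> r0 h; rewrite -hornerZ; apply: ler_horner => // i.
by rewrite coef_majorant coefMC coefZ coef_majorant.
Qed.

(** The constant coefficient enters through a bound c on right multiplication by it. Its
    Hilbert-Schmidt norm would not do: for an orthogonal matrix it is the square root of the
    dimension, a factor that would accumulate over the greedy intervals. *)
Lemma pnorm_mul_near r c C y q : 0 <= r -> r <= 1 ->
  (forall B : Mat, hs_norm (B * q`_0) <= c * hs_norm B) -> pnorm 1 q <= C ->
  pnorm r (y * q) <= (c + r * C) * pnorm r y.
Proof.
move=> r0 r1 h hC; have hr := pnorm_ring_norm r0.
have -> : y * q = y * (q`_0)%:P + y * (q - (q`_0)%:P) by rewrite mulrBr addrC subrK.
apply: le_trans (nrmD hr _ _) _; rewrite mulrDl lerD ?pnorm_mulC //.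
apply: le_trans (nrmM hr _ _) _; rewrite mulrC ler_wpM2r ?(nrm_ge0 hr) //.
by apply: le_trans (pnorm_tail _ r0 r1) _; rewrite ler_wpM2l.
Qed.

(** Over a noncommutative ring, evaluation is multiplicative at central points; scalar matrices are
    such points. *)
Lemma horner_scalar_comm mu : commr_rmorph (@idfun Mat) mu%:M.
Proof. by move=> x; rewrite /GRing.comm /= scalar_mx_central. Qed.

Definition horner_scalar mu : {rmorphism {poly Mat} -> Mat} :=
  horner_morph (horner_scalar_comm mu).

Lemma horner_scalarE mu q : horner_scalar mu q = q.[mu%:M].
Proof. by rewrite /= /horner_morph map_poly_id. Qed.

Definition pencil (lambda : R) (B : Mat) : {poly Mat} := (lambda *: B)%:P + B *: 'X.

Lemma horner_pencil lambda mu B : (pencil lambda B).[mu%:M] = (lambda + mu) *: B.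
Proof.
rewrite /pencil hornerD hornerC hornerZ hornerX scalerDl; congr (_ + _).
by rewrite -scalar_mx_central -mulmxE mul_scalar_mx.
Qed.

Lemma pnorm_pencil lambda B : pnorm 1 (pencil lambda B) <= (`|lambda| + 1) * hs_norm B.
Proof.
have hr := pnorm_ring_norm (@ler01 R).
apply: le_trans (nrmD hr _ _) _; rewrite pnormC hs_normZ mulrDl lerD2l mul1r.
suff -> : pnorm 1 (B *: 'X) = hs_norm B by [].
rewrite /pnorm; have -> : majorant (B *: 'X) = hs_norm B *: 'X.
  apply/polyP => i; rewrite coef_majorant !coefZ !coefX; case: eqP => _.
    by rewrite !mulr1.
  by rewrite !mulr0 hs_norm0.
by rewrite hornerZ hornerX mulr1.
Qed.

End MatrixPolynomials.

(** * Linear equations driven by paths of bounded variation *)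

Section UniformContinuity.
Variable R : realType.

(** Heine's theorem by the near-covering form of compactness; halving the radius leaves room for
    both the moving centre and the increment. *)
Lemma within_ucont (f : R -> R) (a b : R) : {within `[a, b], continuous f} -> ucont a b f.
Proof.
move=> cf e e0.
have /compact_near_coveringP h := @segment_compact R a b.
pose P (dl x : R) := `[a, b]%classic x ->
  forall y, a <= y -> y <= b -> `|y - x| < dl -> `|f y - f x| <= e.
have e2 : 0 < e / 2 by rewrite divr_gt0.
have H : \forall dl \near (0 : R)^'+, `[a, b]%classic `<=` P dl.
  apply: h => x xab; move/subspace_continuousP : cf => /(_ x xab)/cvgrPdist_lt/(_ _ e2).
  rewrite near_withinE => /nbhs_ballP[d /= d0 hd].
  have d2 : 0 < d / 2 by rewrite divr_gt0.
  exists (ball x (d / 2), [set dl | dl < d / 2]).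
    split; first exact: nbhsx_ballx.
    exact: nbhs_right_lt.
  move=> [x' dl] /= [xx' dld] x'ab y ay yb yx'.
  rewrite /ball /= in xx'.
  have k1 : `|f x - f x'| < e / 2.
    apply: hd x'ab; rewrite /ball /=; apply: lt_trans xx' _; rewrite ltr_pdivrMr //; lra.
  have k2 : `|f x - f y| < e / 2.
    apply: hd; last by rewrite /= in_itv /= ay yb.
    rewrite /ball /=; have -> : x - y = (x - x') - (y - x') by ring.
    by apply: le_lt_trans (ler_normB _ _) _; lra.
  have -> : f y - f x' = (f x - f x') - (f x - f y) by ring.
  by apply: le_trans (ler_normB _ _) _; lra.
have [dl [dl0 hdl]] : exists dl, 0 < dl /\ forall x, `[a, b]%classic x ->
    forall y, a <= y -> y <= b -> `|y - x| < dl -> `|f y - f x| <= e.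
  near (0 : R)^'+ => dl; exists dl; split; first by near: dl; exact: nbhs_right_gt.
  by move=> x xab; apply: (near H dl).
exists dl => // s t as_ st tb ts; apply: hdl => //; try lra.
  by rewrite /= in_itv /= as_ (le_trans st tb).
by rewrite ger0_norm // subr_ge0.
Unshelve. all: by end_near.
Qed.

Lemma within_ucont_mx m n (f : R -> 'M[R]_(m, n)) (a b : R) i j :
  {within `[a, b], continuous f} -> ucont a b (fun t => f t i j).
Proof.
move=> cf; apply: within_ucont.
apply: (@within_continuous_comp _ _ _ `[a, b]%classic f (fun N : 'M[R]_(m, n) => N i j)) => //.
by move=> x _; exact: coord_continuous.
Qed.

Lemma ucont_bounded (f : R -> R) (a b : R) : a <= b -> {within `[a, b], continuous f} ->
  exists2 C, 0 <= C & forall t, a <= t -> t <= b -> `|f t| <= C.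
Proof.
move=> ab cf; have [c1 _ h1] := EVT_max ab cf; have [c2 _ h2] := EVT_min ab cf.
exists (`|f c1| + `|f c2|); first by rewrite addr_ge0.
move=> t at_ tb; have tab : t \in `[a, b]%R by rewrite in_itv /= at_ tb.
have := h1 t tab; have := h2 t tab; rewrite ler_norml.
have := ler_norm (f c1); have := ler_norm (- f c2); rewrite normrN.
by have := normr_ge0 (f c1); have := normr_ge0 (f c2); lra.
Qed.

(** Increments that are uniformly o(V) add up, along a fine partition, to at most e V(0, t). *)
Lemma small_increments_cst (f : R -> R) V (T t : R) : ctrl 0 T V -> 0 <= t -> t <= T ->
  (forall e, 0 < e -> exists2 delta, 0 < delta &
    forall s u, 0 <= s -> s <= u -> u <= T -> u - s < delta -> `|f u - f s| <= e * V s u) ->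
  f t = f 0.
Proof.
move=> cV t0 tT h; apply: (@eq_eps _ (V 0 t)) => e e0.
have [dl d0 hd] := h e e0; have [D hD] := part_exists d0 t0.
rewrite mulrC; suff gen a D' : part dl a t D' -> 0 <= a -> `|f t - f a| <= e * V a t.
  exact: gen hD _.
elim: D' a => [|u D' IH] a /= => [-> a0|[au ua {}hD] a0].
  by rewrite subrr normr0 mulr_ge0 ?(ltW e0) // cV.1.
have ut := part_le hD.
have -> : f t - f a = (f t - f u) + (f u - f a) by rewrite subrKA.
apply: le_trans (ler_normD _ _) _.
have k1 := IH u hD (le_trans a0 (ltW au)).
have k2 := hd a u a0 (ltW au) (le_trans ut tT) ua.
have k3 : e * (V a u + V u t) <= e * V a t.
  by rewrite ler_wpM2l ?(ltW e0) // cV.2 // ltW.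
by rewrite mulrDr in k3; lra.
Qed.

End UniformContinuity.

(** * Linear equations: first-order expansion and orthogonality of the solution *)

Section LinearODE.
Variable R : realType.

Lemma ucont_common (I : finType) (f : I -> R -> R) (a b : R) :
  (forall i, ucont a b (f i)) -> forall e, 0 < e -> exists2 delta, 0 < delta &
    forall i s t, a <= s -> s <= t -> t <= b -> t - s < delta -> `|f i t - f i s| <= e.
Proof.
move=> h e e0.
have /choice[dl hdl] : forall i, exists x, 0 < x /\
    forall s t, a <= s -> s <= t -> t <= b -> t - s < x -> `|f i t - f i s| <= e.
  by move=> i; have [x x0 hx] := h i e e0; exists x.
exists (\big[Order.min/1]_i dl i).
  by apply/bigmin_gtP; split=> // i _; have [] := hdl i.
move=> i s t as_ st tb ts; apply: (hdl i).2 => //.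
by apply: lt_le_trans ts _; exact: bigmin_le_cond.
Qed.

Lemma hs_norm_sumZ d k (c : 'I_d -> R) (B : 'I_d -> 'M[R]_k.+1) o : (forall i, `|c i| <= o) ->
  hs_norm (\sum_i c i *: B i) <= o * \sum_i hs_norm (B i).
Proof.
move=> h; rewrite mulr_sumr; apply: (nrm_sum (@hs_ring_norm R k)) => i _.
by rewrite hs_normZ ler_wpM2r ?hs_norm_ge0.
Qed.

Variables (d k : nat) (T : R) (X : R -> 'rV[R]_d) (V : R -> R -> R).
Local Notation Mat := 'M[R]_k.+1.
Local Notation hsn := (@hs_norm R k.+1 k.+1).
Implicit Types (e o s t u : R).
Variables (B : 'I_d -> Mat) (Y : R -> Mat).
Hypotheses (T0 : 0 <= T) (cV : ctrl 0 T V).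
Hypotheses (dV : forall i, dominates 0 T V (fun u => X u 0 i)).
Hypotheses (uX : forall i, ucont 0 T (fun u => X u 0 i)).
Hypothesis (BT : forall i, (B i)^T = - B i).

Let A s := \sum_i X s 0 i *: B i.
Let cA := \sum_i hs_norm (B i).

Hypotheses (cY : {within `[0, T], continuous Y}).
Hypothesis (eY : forall t, 0 <= t <= T -> Y t = 1%:M + RSint_mx Y A 0 t).

Let cA0 : 0 <= cA. Proof. by apply: sumr_ge0 => i _; exact: hs_norm_ge0. Qed.

Let AB s t : A t - A s = \sum_i (X t 0 i - X s 0 i) *: B i.
Proof. by rewrite /A -sumrB; apply: eq_bigr => i _; rewrite scalerBl. Qed.

Let hsA s t o : (forall i, `|X t 0 i - X s 0 i| <= o) -> hs_norm (A t - A s) <= o * cA.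
Proof. by move=> h; rewrite AB; exact: hs_norm_sumZ. Qed.

Let hsAV s t : 0 <= s -> s <= t -> t <= T -> hs_norm (A t - A s) <= V s t * cA.
Proof. by move=> s0 st tT; apply: hsA => i; exact: dV. Qed.

Let dA i j : dominates 0 T (fun s t => cA * V s t) (fun u => A u i j).
Proof.
move=> s t s0 st tT; have := hsAV s0 st tT; rewrite mulrC; apply: le_trans.
by have := hs_norm_entry (A t - A s) i j; rewrite !mxE.
Qed.

Let V0 : 0 <= V 0 T. Proof. by apply: cV.1. Qed.

(** Freezing Y at s in the integral over [s, t] leaves the oscillation of Y times V, up to
    constants. *)
Let ode_step e : 0 < e -> exists2 delta, 0 < delta & forall s t, 0 <= s -> s <= t ->
  t <= T -> t - s < delta -> hs_norm (Y t - Y s * (1 + (A t - A s))) <= e * V s t.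
Proof.
move=> e0; pose c := (k.+1 * k.+1)%:R * (k.+1%:R * cA).
have c0 : 0 <= c by rewrite !mulr_ge0.
have c1 : 0 < c + 1 by lra.
have [dl d0 hd] := @ucont_common _ (fun (ij : 'I_k.+1 * 'I_k.+1) t => Y t ij.1 ij.2) 0 T
  (fun ij => within_ucont_mx ij.1 ij.2 cY) _ (divr_gt0 e0 c1).
exists dl => // s t s0 st tT ts.
have t0 := le_trans s0 st; have sT := le_trans st tT.
have Vst : 0 <= V s t by exact: cV.1.
have o0 : 0 <= e / (c + 1) by rewrite ltW // divr_gt0.
have cAV : ctrl 0 T (fun s t => cA * V s t) by exact: ctrlZ.
apply: (@le_trans _ _ ((k.+1 * k.+1)%:R * (k.+1%:R * (e / (c + 1) * (cA * V s t)))));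
  last first.
  have -> : (k.+1 * k.+1)%:R * (k.+1%:R * (e / (c + 1) * (cA * V s t))) = e / (c + 1) * (c *
    V s t).
    by rewrite /c; ring.
  rewrite mulrA ler_wpM2r // mulrAC ler_pdivrMr //; apply: ler_wpM2l; [exact: ltW|lra].
apply: hs_norm_entries => [|i j].
  by do 2 apply: mulr_ge0 => //; exact: mulr_ge0.
have -> : (Y t - Y s * (1 + (A t - A s))) i j =
    \sum_l (RSint (fun u => Y u i l) (fun u => A u l j) s t - Y s i l * (A t l j - A s l j)).
  rewrite mulrDr mulr1 opprD addrA sumrB !mxE; congr (_ - _); last first.
    by apply: eq_bigr => l _; rewrite !mxE.
  rewrite {1}eY ?t0 // {1}eY ?s0 // !mxE opprD addrACA subrr add0r -sumrB.
  apply: eq_bigr => l _; rewrite (@RSint_add _ _ _ (fun s t => cA * V s t) 0 s t) //.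
  - by rewrite addrC addKr.
  - exact: ucont_sub (within_ucont_mx i l cY).
  - exact: ctrl_sub cAV.
  - exact: dominates_sub (dA l j).
apply: le_trans (ler_norm_sum _ _ _) _.
have -> : k.+1%:R * (e / (c + 1) * (cA * V s t)) = \sum_(l < k.+1) (e / (c + 1) * (cA * V s t)).
  by rewrite sumr_const card_ord mulr_natl.
apply: ler_sum => l _.
apply: (@RSint_near _ _ _ (fun s t => cA * V s t)) => //.
- exact: ucont_sub (within_ucont_mx i l cY).
- exact: ctrl_sub cAV.
- exact: dominates_sub (dA l j).
- by move=> x sx xt; apply: (hd (i, l)) => //; lra.
Qed.

Let Y_bounded : exists2 C, 0 <= C & forall t, 0 <= t -> t <= T -> hs_norm (Y t) <= C.
Proof.
have /choice[C hC] : forall ij : 'I_k.+1 * 'I_k.+1, exists C, 0 <= C /\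
    forall t, 0 <= t -> t <= T -> `|Y t ij.1 ij.2| <= C.
  move=> ij; have [||C C0 hC] := @ucont_bounded R (fun t => Y t ij.1 ij.2) 0 T => //.
    apply: (@within_continuous_comp _ _ _ `[0, T]%classic Y (fun N : Mat => N ij.1 ij.2)) => //.
    by move=> x _; exact: coord_continuous.
  by exists C.
have C0 : 0 <= \sum_ij C ij by apply: sumr_ge0 => ij _; exact: (hC ij).1.
exists ((k.+1 * k.+1)%:R * \sum_ij C ij); first by rewrite mulr_ge0.
move=> t t0 tT; apply: hs_norm_entries => // i j.
apply: le_trans ((hC (i, j)).2 t t0 tT) _.
rewrite (bigD1 (i, j)) //= lerDl; apply: sumr_ge0 => ij _; exact: (hC ij).1.
Qed.

Lemma ode_initial : Y 0 = 1%:M.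
Proof.
rewrite eY ?lexx //; apply/eqP; rewrite addrC -subr_eq0 addrK; apply/eqP/matrixP => i j.
rewrite !mxE big1 // => l _; apply: (@RSint_diag _ _ _ (fun s t => cA * V s t)).
  by apply: ctrl_sub (ctrlZ cA0 cV).
by apply: dominates_sub (dA l j).
Qed.

(* For antisymmetric D, (1 + D)(1 + D)^T = 1 - D^2 is 1 up to o(V), so that the
   increments of Y Y^T are o(V). *)
Lemma ode_orthogonal t : 0 <= t -> t <= T -> Y t *m (Y t)^T = 1%:M.
Proof.
move=> t0 tT; have [C C0 hC] := Y_bounded.
have Y0 : Y 0 *m (Y 0)^T = 1%:M by rewrite ode_initial trmx1 mulmx1.
rewrite -Y0; apply/matrixP => i j.
apply: (small_increments_cst (f := fun t => (Y t *m (Y t)^T) i j) cV t0 tT) => e e0.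
pose c := 2 * C + V 0 T + C ^+ 2 * cA ^+ 2.
have c0 : 0 <= c by rewrite !addr_ge0 ?mulr_ge0 ?exprn_ge0.
have c1 : 0 < c + 1 by lra.
pose o := Num.min 1 (e / (c + 1)).
have o0 : 0 < o by rewrite lt_min ltr01 divr_gt0.
have [d1 d10 h1] := ode_step o0; have [d2 d20 h2] := ucont_common uX o0.
exists (Num.min d1 d2); first by rewrite lt_min d10.
move=> s u s0 su uT; rewrite lt_min => /andP[l1 l2].
have sT := le_trans su uT; have u0 := le_trans s0 su.
have := h1 s u s0 su uT l1; set D := A u - A s; set E := Y u - _ => hE.
have Vsu : 0 <= V s u by exact: cV.1.
have VT : V s u <= V 0 T by exact: (ctrl_mono cV).
(* Both bounds on D are used: in [D *m D] one factor is charged to o and the other to V, which makes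
   the quadratic term o(V). *)
have hD1 : hs_norm D <= o * cA by apply: hsA => l; exact: h2.
have hD2 : hs_norm D <= V s u * cA by exact: hsAV.
have DT : D^T = - D.
  by rewrite /D AB linear_sum -sumrN; apply: eq_bigr => l _; rewrite linearZ /= BT scalerN.
have key : Y u *m (Y u)^T - Y s *m (Y s)^T =
    E *m (Y u)^T + Y u *m E^T - E *m E^T - Y s *m (D *m D) *m (Y s)^T.
  have h1' : (Y u - E) *m (Y u - E)^T = Y s *m (Y s)^T - Y s *m (D *m D) *m (Y s)^T.
    have -> : Y u - E = Y s *m (1%:M + D) by rewrite /E opprB addrCA subrr addr0.
    have tD : (1%:M + D)^T = 1%:M - D by rewrite (raddfD (@trmx R k.+1 k.+1)) /= trmx1 DT.
    have eD : (1%:M + D) *m (1%:M - D) = 1%:M - D *m D.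
      by rewrite mulmxBr mulmx1 mulmxDl mul1mx opprD addrA addrK.
    by rewrite trmx_mul tD -mulmxA (mulmxA (1%:M + D)) eD mulmxBl mul1mx mulmxBr !mulmxA.
  have h2' : (Y u - E) *m (Y u - E)^T =
      Y u *m (Y u)^T - E *m (Y u)^T - (Y u *m E^T - E *m E^T).
    by rewrite (raddfB (@trmx R k.+1 k.+1)) /= mulmxBr !mulmxBl.
  move: h1'; rewrite h2'; move: (Y u *m (Y u)^T) (Y s *m (Y s)^T) (E *m (Y u)^T) (Y u *m E^T)
    (E *m E^T) (Y s *m _ *m _) => N1 N2 N3 N4 N5 N6 hN.
  apply/matrixP => x y; have := congr1 (fun N : Mat => N x y) hN; rewrite !mxE; lra.
have hYs : hs_norm (Y s) <= C by exact: hC.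
have hYu : hs_norm (Y u) <= C by exact: hC.
have hM N1 N2 a b : hs_norm N1 <= a -> hs_norm N2 <= b -> hs_norm (N1 *m N2 : Mat) <= a * b.
  by move=> k1 k2; apply: le_trans (hs_normM _ _) _; apply: ler_pM; rewrite ?hs_norm_ge0.
have p1 : hs_norm (E *m (Y u)^T) <= o * V s u * C by apply: hM => //; rewrite hs_norm_tr.
have p2 : hs_norm (Y u *m E^T) <= C * (o * V s u) by apply: hM => //; rewrite hs_norm_tr.
have p3 : hs_norm (E *m E^T) <= o * V s u * (o * V s u) by apply: hM => //; rewrite hs_norm_tr.
have p4 : hs_norm (Y s *m (D *m D) *m (Y s)^T) <= C * (o * cA * (V s u * cA)) * C.
  by apply: (hM); [do 2 apply: (hM) => //|rewrite hs_norm_tr].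
have -> : (Y u *m (Y u)^T) i j - (Y s *m (Y s)^T) i j =
  (Y u *m (Y u)^T - Y s *m (Y s)^T) i j by rewrite !mxE.
rewrite key; apply: le_trans (hs_norm_entry _ _ _) _.
have p5 : hs_norm (E *m (Y u)^T + Y u *m E^T - E *m E^T - Y s *m (D *m D) *m (Y s)^T)
    <= o * V s u * C + C * (o * V s u) + o * V s u * (o * V s u) + C * (o * cA * (V s u *
      cA)) * C.
  apply: le_trans (hs_normD _ _) _; rewrite hs_normN; apply: (lerD _ p4).
  apply: le_trans (hs_normD _ _) _; rewrite hs_normN; apply: (lerD _ p3).
  by apply: le_trans (hs_normD _ _) _; exact: lerD.
apply: le_trans p5 _.
have o1 : o <= 1 by rewrite ge_min lexx.
have oc : o * (c + 1) <= e by rewrite -ler_pdivlMr // ge_min lexx orbT.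
have p6 : o * V s u * (o * V s u) <= o * V s u * (1 * V 0 T).
  apply: ler_wpM2l; first by rewrite mulr_ge0 // ltW.
  by apply: ler_pM => //; exact: ltW.
have p7 : o * (c + 1) * V s u <= e * V s u by exact: ler_wpM2r.
have p8 : 0 <= o * V s u by rewrite mulr_ge0 // ltW.
by rewrite /c in p7; lra.
Qed.

(** Level 1 of the signature gives [A t - A s] exactly, and by [signature_small] each level from 2
    on carries a factor that is small on short intervals. *)
Lemma signature_step N L : (0 < N)%N -> (forall i, hs_norm (B i) <= L) ->
  forall e, 0 < e -> exists2 delta, 0 < delta & forall s t, 0 <= s -> s <= t ->
  t <= T -> t - s < delta ->
  hs_norm (ev scalar_mx N B (signature X s t) - (1 + (A t - A s))) <= e * V s t.
Proof.
case: N => [//|N] _ hL e e0; have hn := @hs_ring_norm R k.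
pose L' := Num.max 0 L.
have L0 : 0 <= L' by rewrite le_max lexx.
have hL' i : hs_norm (B i) <= L' by rewrite le_max hL orbT.
pose c := ev_tot hsn d N.+1 L' * (1 + V 0 T) ^+ N.+1.
have c0 : 0 <= c by rewrite mulr_ge0 ?exprn_ge0 ?addr_ge0 //; exact: ev_tot_ge0.
have c1 : 0 < c + 1 by lra.
have oc : 0 < e / (c + 1) by rewrite divr_gt0.
have [dl d0 hd] := ucont_common uX oc.
exists dl => // s t s0 st tT ts.
have Vst : 0 <= V s t by exact: cV.1.
rewrite /ev !big_ord_recl /= ev0 // /bump /=.
have -> : ev_level scalar_mx B (signature X s t) 1 = A t - A s.
  rewrite AB /ev_level /=; apply: eq_bigr => i _.
  by rewrite mulr1 -mulmxE mul_scalar_mx /signature (iterated_int1 cV dV).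
rewrite addrA [X in X - _]addrC addrK.
apply: (@le_trans _ _ (\sum_(i < N) ev_cst hsn d L' i.+2 *
    (e / (c + 1) * ((1 + V 0 T) ^+ N.+1 * V s t)))).
  apply: nrm_sum => // i _; apply: ev_level_bound => //.
    by move=> a b; exact: hs_scalar_mx.
  move=> w hw; apply: le_trans (signature_small cV dV uX s0 st tT (ltW oc) _ _) _.
  - by move=> l x sx xt; apply: hd => //; lra.
  - by rewrite hw.
  - rewrite hw /= ler_wpM2l ?(ltW oc) // [V s t ^+ _]exprSr ler_wpM2r //.
    apply: (@le_trans _ _ ((1 + V 0 T) ^+ i)).
      rewrite lerXn2r ?nnegrE ?addr_ge0 //.
      by have := ctrl_mono cV (lexx _) s0 st tT (lexx _); lra.
    by apply: ler_weXn2l; [rewrite lerDl|exact: leq_trans (ltnW (ltn_ord i)) _].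
rewrite -mulr_suml.
have h1 : \sum_(i < N) ev_cst hsn d L' i.+2 <= ev_tot hsn d N.+1 L'.
  rewrite /ev_tot !big_ord_recl /= addrA ler_wpDl ?addr_ge0 ?(ev_cst_ge0 hn) //.
apply: le_trans (ler_wpM2r _ h1) _.
  by rewrite mulr_ge0 ?(ltW oc) // mulr_ge0 ?exprn_ge0 ?addr_ge0.
have -> : ev_tot hsn d N.+1 L' * (e / (c + 1) * ((1 + V 0 T) ^+ N.+1 * V s t)) =
  e / (c + 1) * c * V s t by rewrite /c; ring.
apply: ler_wpM2r => //; rewrite mulrAC ler_pdivrMr //; apply: ler_wpM2l; [exact: ltW|lra].
Qed.

(** Both terms are Y_s (1 + A_t - A_s) up to o(V). The levels above 1 are invisible at this order;
    they are kept because they make products stable in p-variation. *)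
Lemma flow_step N L : (0 < N)%N -> (forall i, hs_norm (B i) <= L) ->
  forall e, 0 < e -> exists2 delta, 0 < delta & forall s t, 0 <= s -> s <= t ->
  t <= T -> t - s < delta ->
  hs_norm (Y t - Y s * ev scalar_mx N B (signature X s t)) <= e * V s t.
Proof.
move=> N0 hL e e0; have [C C0 hC] := Y_bounded.
have e2 : 0 < e / 2 by rewrite divr_gt0.
have C1 : 0 < 2 * (C + 1) by lra.
have [d1 d10 h1] := ode_step e2.
have [d2 d20 h2] := signature_step N0 hL (divr_gt0 e0 C1).
exists (Num.min d1 d2); first by rewrite lt_min d10.
move=> s t s0 st tT; rewrite lt_min => /andP[l1 l2].
have := h1 s t s0 st tT l1; have := h2 s t s0 st tT l2.
set G := 1 + _; set S := ev _ _ _ _ => k2 k1.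
have -> : Y t - Y s * S = (Y t - Y s * G) - Y s * (S - G).
  by rewrite mulrBr opprB addrA subrK.
apply: le_trans (hs_normD _ _) _; rewrite hs_normN.
have k3 : hs_norm (Y s * (S - G)) <= C * (e / (2 * (C + 1)) * V s t).
  apply: le_trans (hs_normM _ _) _; apply: ler_pM; rewrite ?hs_norm_ge0 //.
  by apply: hC => //; exact: le_trans tT.
have k4 : C * (e / (2 * (C + 1)) * V s t) <= e / 2 * V s t.
  rewrite mulrA; apply: ler_wpM2r; first exact: cV.1.
  rewrite mulrA ler_pdivrMr //.
  have -> : e / 2 * (2 * (C + 1)) = e * (C + 1) by field.
  by rewrite mulrC; apply: ler_wpM2l; [exact: ltW|lra].
by lra.
Qed.

End LinearODE.

(** * The p-variation in coordinates *)

Section CoordinateVariation.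
Variable R : realType.

Lemma proj_norm_ge_coord d n (u : tensor R d n) I : `|u I| <= proj_norm u.
Proof.
apply: lb_le_inf.
  (* A lower bound passes to [inf] only for a nonempty set; the expansion of u in the canonical
     basis is a decomposition. *)
  pose e (l : 'I_#|{: n.-tuple 'I_d}|) : n.-tuple 'I_d := enum_val l.
  exists (\sum_(l < #|{: n.-tuple 'I_d}|) `|u (e l)| *
      \prod_(j < n) hs_norm (delta_mx 0 (tnth (e l) j) : 'rV[R]_d)).
  exists #|{: n.-tuple 'I_d}|, (fun l => u (e l)), (fun l j => delta_mx 0 (tnth (e l) j)).
  split=> //; apply/ffunP => J; rewrite sum_ffunE (bigD1 (enum_rank J)) //= big1 => [|l lJ].
    rewrite addr0 !ffunE /e enum_rankK big1 => [|j _]; first by rewrite [_ *: _]mulr1.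
    by rewrite mxE !eqxx.
  rewrite !ffunE; have [j hj] : exists j, tnth (e l) j != tnth J j.
    apply/existsP; apply: contraNT lJ; rewrite negb_exists => /forallP h.
    apply/eqP; rewrite -[l]enum_valK; congr enum_rank; apply: eq_from_tnth => j.
    by apply/eqP; have := h j; rewrite negbK.
  rewrite (bigD1 j) //= mxE eqxx /= eq_sym (negbTE hj) mul0r.
  exact: mulr0.
move=> _ [m [c [v [-> ->]]]]; rewrite sum_ffunE.
apply: le_trans (ler_norm_sum _ _ _) _; apply: ler_sum => l _.
rewrite !ffunE normrM ler_wpM2l // normr_prod; apply: ler_prod => j _.
by rewrite normr_ge0 hs_norm_entry.
Qed.

Variables (d : nat) (p : R).
Local Notation N := (Num.truncn p).
Hypothesis (hp : 2 < p).

Let p0 : 0 < p. Proof. exact: lt_trans hp. Qed.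

Lemma truncn_bounds : [/\ N%:R <= p, p < N.+1%:R & (1 < N)%N].
Proof.
have /andP[h1 h2] := truncn_itv (ltW p0).
split=> //; rewrite -ltnS -(@ltr_nat R); exact: lt_trans h2.
Qed.

(* Only upper bounds on the tensors matter below, so that coordinates can replace
   the projective norms. *)
Definition coord_pvar (F : R -> R -> tseries R d) (u v : R) : R :=
  \sum_(1 <= n < N.+1) wsum n (fun w => `|F u v w| `^ (p / n%:R)).

Definition tdiff (F G : R -> R -> tseries R d) (u v : R) : tseries R d :=
  fun w => F u v w - G u v w.

Lemma coord_pvar_ge0 F u v : 0 <= coord_pvar F u v.
Proof. by apply: sumr_ge0 => n _; apply: wsum_ge0 => w; exact: powR_ge0. Qed.

Lemma coord_pvar_ge_term F u v w : (0 < size w <= N)%N ->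
  `|F u v w| `^ (p / (size w)%:R) <= coord_pvar F u v.
Proof.
move=> hw; rewrite /coord_pvar (@bigD1_seq _ _ _ _ _ (size w)) ?iota_uniq ?mem_index_iota //=.
apply: ler_wpDr; last by apply: (wsum_ge_term (f :=
  fun w' => `|F u v w'| `^ (p / (size w)%:R))) => // w'; exact: powR_ge0.
by apply: sumr_ge0 => n _; apply: wsum_ge0 => w'; exact: powR_ge0.
Qed.

Lemma sup_dissections_ge0 (f : R -> R -> R) a b : a <= b -> (forall u v, 0 <= f u v) ->
  (0 <= sup_dissections f a b)%E.
Proof.
move=> ab f0; have [D hD] := partition_le ab.
apply: (@le_trans _ _ (dissection_sum f a D)%:E); first by rewrite lee_fin dissection_sum_ge0.
by apply: ereal_sup_ubound; exists D.
Qed.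

(** H has the coordinates of F up to sign, which covers both the p-variation norm and the distance.
    A coordinate is at most the projective norm, and level n has d^n <= d^N words. *)
Lemma sup_dissections_coord_pvar (F : R -> R -> tseries R d) (H : forall n : nat, R -> R ->
  tensor R d n) a b (c : R) : (0 < d)%N ->
  (forall n u v (w : n.-tuple 'I_d), `|F u v w| = `|H n u v w|) ->
  (\sum_(1 <= n < N.+1) sup_dissections (fun u v => proj_norm (H n u v) `^ (p / n%:R))%R a b
     <= c%:E)%E ->
  a <= b -> (sup_dissections (coord_pvar F) a b <= ((d ^ N)%:R * c)%:E)%E.
Proof.
move=> d0 FH hc ab; apply: ge_ereal_sup => _ [D hD <-].
pose f n u v := proj_norm (H n u v) `^ (p / n%:R).
have le1 : dissection_sum (coord_pvar F) a D <=
    (d ^ N)%:R * \sum_(1 <= n < N.+1) dissection_sum (f n) a D.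
  rewrite /dissection_sum [X in _ * X]exchange_big mulr_sumr /=; apply: ler_sum => uv _.
  rewrite mulr_sumr /coord_pvar; apply: ler_sum_nat => n /andP[n1 nN].
  apply: (@le_trans _ _ ((d ^ n)%:R * f n uv.1 uv.2)); last first.
    by apply: ler_wpM2r; [exact: powR_ge0|rewrite ler_nat leq_pexp2l].
  rewrite -wsum_cst; apply: ler_wsum => w hw.
  have pn : 0 <= proj_norm (H n uv.1 uv.2).
    apply: le_trans (proj_norm_ge_coord _ (tcast hw (in_tuple w))); exact: normr_ge0.
  apply: ge0_ler_powR; rewrite ?nnegrE ?divr_ge0 ?(ltW p0) //.
  have := FH n uv.1 uv.2 (tcast hw (in_tuple w)); rewrite val_tcast /= => ->.
  exact: proj_norm_ge_coord.
apply: (@le_trans _ _ ((d ^ N)%:R * \sum_(1 <= n < N.+1) dissection_sum (f n) a D)%:E).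
  by rewrite lee_fin.
rewrite !EFinM; apply: lee_wpmul2l; first by rewrite lee_fin.
apply: le_trans hc; rewrite -sumEFin; apply: lee_sum => n _.
by apply: ereal_sup_ubound; exists D.
Qed.

Lemma poweR_lt_inv (S : \bar R) (e : R) : (0 <= S)%E -> 0 < e ->
  (S `^ p^-1 < (e `^ p^-1)%:E)%E -> (S <= e%:E)%E.
Proof.
move=> S0 e0 h; rewrite leNgt; apply/negP => /ltW eS; move: h; rewrite ltNge => /negP; apply.
rewrite -poweR_EFin; apply: gt0_ler_poweR => //; first by rewrite invr_ge0 ltW.
  by rewrite in_itv /= lee_fin (ltW e0) leey.
by rewrite in_itv /= S0 leey.
Qed.

(** Strictly before the next greedy time the control is thus at most d^N, whatever X is; this number
    determines the constant C of a greedy interval. *)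
Lemma coord_pvar_pvar_norm F a b : (0 < d)%N -> a <= b -> (pvar_norm p F a b < 1)%E ->
  (sup_dissections (coord_pvar F) a b <= ((d ^ N)%:R)%:E)%E.
Proof.
move=> d0 ab h; rewrite -[(d ^ N)%:R]mulr1.
apply: (@sup_dissections_coord_pvar F (fun n u v => level n (F u v))) => //.
  by move=> n u v w; rewrite ffunE.
apply: poweR_lt_inv => //; last by rewrite powR1; exact: h.
by apply: sume_ge0 => n _; apply: sup_dissections_ge0 => // u v; exact: powR_ge0.
Qed.

Lemma coord_pvar_pvar_dist (F G : R -> R -> tseries R d) a b (e : R) : (0 < d)%N -> a <= b ->
  0 < e ->
  (pvar_dist p F G a b < (e `^ p^-1)%:E)%E ->
  (sup_dissections (coord_pvar (tdiff F G)) a b <= ((d ^ N)%:R * e)%:E)%E.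
Proof.
move=> d0 ab e0 h.
apply: (@sup_dissections_coord_pvar _ (fun n u v => level n (F u v) - level n (G u v))) => //.
  by move=> n u v w; rewrite /tdiff !ffunE.
apply: poweR_lt_inv => //.
by apply: sume_ge0 => n _; apply: sup_dissections_ge0 => // u v; exact: powR_ge0.
Qed.

(** x + y <= 2 max(x, y); the exponents p / n of all levels share the constant 2^p. *)
Lemma powRD_le (x y q : R) : 0 <= x -> 0 <= y -> 0 <= q -> q <= p ->
  (x + y) `^ q <= 2 `^ p * (x `^ q + y `^ q).
Proof.
move=> x0 y0 q0 qp.
have gen a b : 0 <= a -> a <= b -> (a + b) `^ q <= 2 `^ p * (a `^ q + b `^ q).
  move=> a0 ab; have b0 := le_trans a0 ab.
  apply: (@le_trans _ _ ((2 * b) `^ q)).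
    by apply: ge0_ler_powR; rewrite ?nnegrE; lra.
  rewrite powRM //; apply: ler_pM; rewrite ?powR_ge0 //.
    by apply: ler_powR => //; lra.
  by rewrite lerDr powR_ge0.
have [xy|yx] := leP x y; first exact: gen.
by rewrite addrC [_ `^ q + _]addrC; apply: gen => //; exact: ltW.
Qed.

Lemma coord_pvar_triangle (F G H : R -> R ->
  tseries R d) u v : (forall w, (0 < size w <= N)%N -> F u v w = G u v w + H u v w) ->
  coord_pvar F u v <= 2 `^ p * (coord_pvar G u v + coord_pvar H u v).
Proof.
move=> h; rewrite /coord_pvar -big_split mulr_sumr; apply: ler_sum_nat => n /andP[n1 nN].
have -> : 2 `^ p * (wsum n (fun w => `|G u v w| `^ (p / n%:R)) + wsum n (fun w => `|H u v w|
  `^ (p / n%:R)))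
  = wsum n (fun w => 2 `^ p * (`|G u v w| `^ (p / n%:R) + `|H u v w| `^ (p / n%:R))).
  by rewrite -wsum_mull wsumD.
apply: ler_wsum => w hw.
have q0 : 0 <= p / n%:R by rewrite divr_ge0 // ltW.
rewrite h ?hw ?n1 //; apply: le_trans (powRD_le _ _ q0 _) => //.
  by apply: ge0_ler_powR; rewrite ?nnegrE ?addr_ge0 ?ler_normD.
by rewrite ler_pdivrMr ?ltr0n // ler_peMr ?(ltW p0) // ler1n.
Qed.

End CoordinateVariation.

(** * Controls of a rough path and of its approximating signatures *)

Section Controls.
Variable R : realType.

Lemma sup_dissections_fin (g W : R -> R -> R) a b : a <= b -> ctrl a b W ->
  (forall u v, a <= u -> u < v -> v <= b -> g u v <= W u v) -> (sup_dissections g a b < +oo)%E.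
Proof.
move=> ab cW h; apply: (@le_lt_trans _ _ (W a b)%:E); last exact: ltry.
apply: ge_ereal_sup => _ [D hD <-]; rewrite lee_fin.
exact: dissection_sum_le_ctrl cW (lexx _) h hD.
Qed.

Lemma continuous_bv_ctrl d T (X : R -> 'rV[R]_d) : 0 <= T -> continuous_bv_path T X ->
  exists V, [/\ ctrl 0 T V, forall i, dominates 0 T V (fun u => X u 0 i)
    & forall i, ucont 0 T (fun u => X u 0 i)].
Proof.
move=> T0 [cX bX]; pose g u v := hs_norm (X v - X u) `^ 1.
have g0 u v : 0 <= g u v by exact: powR_ge0.
have cV := dvar_ctrl g0 bX.
exists (dvar g); split=> // i; last exact: within_ucont_mx cX.
move=> s t s0 st tT; have [->|nst] := eqVneq s t.
  by rewrite subrr normr0 cV.1 // (le_trans s0).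
have {}st : s < t by rewrite lt_neqAle nst.
apply: le_trans (dvar_ge g0 bX s0 st tT); rewrite /g powRr1 ?hs_norm_ge0 //.
by have := hs_norm_entry (X t - X s) 0 i; rewrite !mxE.
Qed.

Variables (d : nat) (p : R).
Local Notation N := (Num.truncn p).
Hypotheses (hp : 2 < p) (d0 : (0 < d)%N).
Local Notation coord_pvar := (@coord_pvar R d p).

Let p0 : 0 < p. Proof. exact: lt_trans hp. Qed.

Lemma dvar_coord_pvar_small (F : R -> R -> tseries R d) a b c : a <= b ->
  (sup_dissections (coord_pvar F) a b <= c%:E)%E ->
  (sup_dissections (coord_pvar F) a b < +oo)%E /\ dvar (coord_pvar F) a b <= c.
Proof.
move=> ab h; have f : (sup_dissections (coord_pvar F) a b < +oo)%E by apply: le_lt_trans h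
  (ltry _).
split=> //; rewrite -lee_fin fineK // fin_numE -ltNye -ltey f andbT.
by apply: lt_le_trans (sup_dissections_ge0 ab (coord_pvar_ge0 p F)); exact: ltNyr.
Qed.

Definition bv_cst (v : R) := (\sum_(1 <= n < N.+1) (d ^ n)%:R) *
  ((1 + v) ^+ N * ((1 + v) ^+ N) `^ p).

(** Write |S(w)|^(p/n) as |S(w)| |S(w)|^(p/n - 1). At level 1 the factors are at most V and o^(p -
    1); at higher levels the first is at most o V up to a constant, and the second is bounded. As p
    > 1, the sum is o(V) on short intervals. *)
Lemma coord_pvar_signature T V (X : R -> 'rV[R]_d) o u v : ctrl 0 T V ->
  (forall i, dominates 0 T V (fun u => X u 0 i)) ->
  (forall i, ucont 0 T (fun u => X u 0 i)) ->
  0 <= u -> u <= v -> v <= T -> 0 <= o ->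
  (forall i x, u <= x -> x <= v -> `|X x 0 i - X u 0 i| <= o) ->
  coord_pvar (trunc_signature N X) u v <= bv_cst (V 0 T) * (o `^ (p - 1) + o) * V u v.
Proof.
move=> cV dV uX u0 uv vT o0 ho.
have [Np _ N1] := truncn_bounds hp; have hp' := hp.
have Vuv : 0 <= V u v by exact: cV.1.
have VT : V u v <= V 0 T by apply: (ctrl_mono cV).
have V0 : 0 <= V 0 T by exact: le_trans VT.
have M1 n : 1 <= (1 + V 0 T) ^+ n by apply: exprn_ege1; rewrite lerDl.
have op : 0 <= o `^ (p - 1) by exact: powR_ge0.
set M := (1 + V 0 T) ^+ N.
have M11 : 1 <= M by exact: M1.
have Mp : 1 <= M `^ p.
  have : 1 `^ p <= M `^ p by apply: ge0_ler_powR; rewrite ?nnegrE ?(ltW p0) // (le_trans ler01).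
  by rewrite powR1.
rewrite /bv_cst -/M -!mulrA mulr_suml; apply: ler_sum_nat => n /andP[n1 nN].
rewrite -wsum_cst; apply: ler_wsum => w hw.
have hn : (size w <= N)%N by rewrite hw.
rewrite /trunc_signature /trunc hn.
have y1 := signature_bound cV dV uX w u0 uv vT.
have y2 := signature_small cV dV uX u0 uv vT o0 ho.
have {y2} := y2 w; rewrite hw => /(_ n1).
rewrite hw in y1; set y := `|_| in y1 *.
have y0 : 0 <= y by exact: normr_ge0.
have n0 : 0 < n%:R :> R by rewrite ltr0n.
move=> y2; rewrite -mulr_powRB1 ?divr_gt0 //.
have q1 : 1 <= p / n%:R.
  by rewrite ler_pdivlMr // mul1r (le_trans _ Np) // ler_nat.
have [n2|n2] := leqP n 1.
  have n_1 : n = 1%N by apply/eqP; rewrite eqn_leq n2 n1.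
  rewrite n_1 /= expr0 mulr1 in y2; rewrite n_1 expr1 in y1.
  apply: (@le_trans _ _ (V u v * o `^ (p - 1))).
    apply: ler_pM => //; first exact: powR_ge0.
    by rewrite n_1 divr1; apply: ge0_ler_powR; rewrite ?nnegrE //; lra.
  have h1 : o `^ (p - 1) * V u v <= (o `^ (p - 1) + o) * V u v by rewrite ler_wpM2r // lerDl.
  rewrite mulrC; apply: le_trans h1 _; rewrite mulrA ler_peMl ?mulr_ege1 //.
  by rewrite mulr_ge0 ?addr_ge0.
have yM : y <= M.
  apply: le_trans y1 _; apply: (@le_trans _ _ ((1 + V 0 T) ^+ n)).
    by rewrite lerXn2r ?nnegrE ?addr_ge0 //; lra.
  by apply: ler_weXn2l; rewrite ?lerDl.
have y3 : y <= o * (M * V u v).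
  apply: le_trans y2 _; apply: ler_wpM2l => //.
  case: n n1 nN hw n0 q1 y1 n2 => [//|[//|n]] _ nN _ _ _ _ _ /=.
  rewrite exprSr; apply: ler_wpM2r => //.
  apply: (@le_trans _ _ ((1 + V 0 T) ^+ n)).
    by rewrite lerXn2r ?nnegrE ?addr_ge0 //; lra.
  apply: ler_weXn2l; rewrite ?lerDl //; rewrite ltnS in nN;
    exact: leq_trans (leqnSn _) (leq_trans (leqnSn _) nN).
have y4 : y `^ (p / n%:R - 1) <= M `^ p.
  apply: (@le_trans _ _ (M `^ (p / n%:R - 1))).
    by apply: ge0_ler_powR; rewrite ?nnegrE //; lra.
  apply: ler_powR => //; apply: (@le_trans _ _ (p / n%:R)); first by lra.
  by rewrite ler_pdivrMr // ler_peMr ?(ltW p0) // ler1n.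
apply: (@le_trans _ _ (o * (M * V u v) * M `^ p)); first by apply: ler_pM => //;
  exact: powR_ge0.
have -> : o * (M * V u v) * M `^ p = o * (M * M `^ p * V u v) by ring.
have -> : M * (M `^ p * ((o `^ (p - 1) + o) * V u v)) = (o `^ (p - 1) + o) * (M * M `^ p * V
  u v) by ring.
apply: ler_wpM2r; last by rewrite lerDr.
by rewrite !mulr_ge0 //; lra.
Qed.

Section Approximation.
Variables (T : R) (X : R -> R -> tseries R d) (Xm : nat -> R -> 'rV[R]_d).
Hypotheses (T0 : 0 <= T) (hX : approximates p T Xm X).
Local Notation S m := (trunc_signature N (Xm m)).

Let gS m := coord_pvar (S m).
Let gD m := coord_pvar (tdiff (S m) X).

Let distance_small e : 0 < e -> exists m0, forall m, (m0 <= m)%N ->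
  (sup_dissections (gD m) 0 T < +oo)%E /\ dvar (gD m) 0 T <= e.
Proof.
move=> e0; have dN : 0 < (d ^ N)%:R :> R by rewrite ltr0n expn_gt0 d0.
have e1 : 0 < e / (d ^ N)%:R by rewrite divr_gt0.
have e2 : 0 < (e / (d ^ N)%:R) `^ p^-1 by rewrite powR_gt0.
case: hX => _ /fine_cvgP[fX /cvgrPdist_lt/(_ _ e2) cX].
have [m0 _ hm] : \forall m \near \oo,
    (pvar_dist p (S m) X 0 T < ((e / (d ^ N)%:R) `^ p^-1)%:E)%E.
  near=> m.
  have f : pvar_dist p (S m) X 0 T \is a fin_num by near: m.
  rewrite -(fineK f) lte_fin; apply: le_lt_trans (ler_norm _) _.
  have : `|0 - fine (pvar_dist p (S m) X 0 T)| < (e / (d ^ N)%:R) `^ p^-1 by near: m.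
  by rewrite sub0r normrN.
exists m0 => m hm0; apply: dvar_coord_pvar_small => //.
have -> : e = (d ^ N)%:R * (e / (d ^ N)%:R) by rewrite mulrCA mulfV ?mulr1 // gt_eqF.
by apply: coord_pvar_pvar_dist => //; exact: hm.
Unshelve. all: by end_near.
Qed.

Let gD_sym m u v : coord_pvar (tdiff X (S m)) u v = gD m u v.
Proof.
rewrite /gD /coord_pvar; apply: eq_bigr => n _; apply: eq_wsum => w _.
by rewrite /tdiff distrC.
Qed.

Let gX_le m u v : coord_pvar X u v <= 2 `^ p * (gS m u v + gD m u v).
Proof.
rewrite -gD_sym; apply: coord_pvar_triangle => // w _.
by rewrite /tdiff addrC subrK.
Qed.

Let gS_le m u v : gS m u v <= 2 `^ p * (coord_pvar X u v + gD m u v).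
Proof. by apply: coord_pvar_triangle => // w _; rewrite /tdiff addrC subrK. Qed.

Let two_p : 0 <= 2 `^ p :> R. Proof. exact: powR_ge0. Qed.

Let bv_small m : exists V, [/\ ctrl 0 T V,
    exists C, forall u v, 0 <= u -> u <= v -> v <= T -> gS m u v <= C * V u v,
    forall C, 0 <= C -> ctrl 0 T (fun u v => C * V u v)
  & forall e, 0 < e -> exists2 delta, 0 < delta & forall u v, 0 <= u -> u <= v -> v <= T ->
    v - u < delta -> gS m u v <= e * V u v].
Proof.
have [V [cV dV uX]] := continuous_bv_ctrl T0 (hX.1 m).
have V0 : 0 <= V 0 T by exact: cV.1.
exists V; split=> //.
- exists (bv_cst (V 0 T) * (V 0 T `^ (p - 1) + V 0 T)) => u v u0 uv vT.
  apply: (coord_pvar_signature cV dV uX) => // i x ux xv.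
  have xT := le_trans xv vT.
  by apply: le_trans (dV i u x u0 ux xT) _; apply: (ctrl_mono cV).
- by move=> C C0; exact: ctrlZ.
- have B0 : 0 <= bv_cst (V 0 T).
    rewrite /bv_cst !mulr_ge0 ?powR_ge0 ?exprn_ge0 ?addr_ge0 //.
    by apply: sumr_ge0 => n _.
  move=> e e0; pose o := Num.min 1 (e / (2 * bv_cst (V 0 T) + 1)).
  have B1 : 0 < 2 * bv_cst (V 0 T) + 1 by lra.
  have o0 : 0 < o by rewrite lt_min ltr01 divr_gt0.
  have o1 : o <= 1 by rewrite ge_min lexx.
  have oB : o * (2 * bv_cst (V 0 T) + 1) <= e by rewrite -ler_pdivlMr // ge_min lexx orbT.
  have [dl dl0 hd] := ucont_common uX o0.
  exists dl => // u v u0 uv vT vu.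
  apply: le_trans (coord_pvar_signature cV dV uX u0 uv vT (ltW o0) _) _.
    by move=> i x ux xv; apply: hd => //; lra.
  apply: ler_wpM2r; first exact: cV.1.
  have op : o `^ (p - 1) <= o.
    by rewrite -[X in _ <= X](powRr1 (ltW o0)); apply: ger_powR; [rewrite o0 o1|have := hp;
      lra].
  have : bv_cst (V 0 T) * (o `^ (p - 1) + o) <= bv_cst (V 0 T) * (2 * o).
    by apply: ler_wpM2l => //; lra.
  have : 0 <= o by exact: ltW.
  lra.
Qed.

(** X is at finite p-variation distance from the signature of some [Xm], whose p-variation is
    controlled by the variation of the path. *)
Lemma coord_pvar_fin : (sup_dissections (coord_pvar X) 0 T < +oo)%E.
Proof.
have [m /(_ m (leqnn m))[fD _]] := distance_small ltr01.
have [V [cV [C hC] _ _]] := bv_small m.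
have C0 : 0 <= `|C| by [].
apply: (sup_dissections_fin T0 (ctrlZ two_p (ctrlD (ctrlZ C0 cV) (dvar_ctrl (coord_pvar_ge0 p
  _) fD)))).
move=> u v u0 uv vT; apply: le_trans (gX_le m u v) _; apply: ler_wpM2l => //.
apply: lerD; last exact: (dvar_ge (coord_pvar_ge0 p _) fD u0 uv vT).
apply: le_trans (hC u v u0 (ltW uv) vT) _; apply: ler_wpM2r; last exact: ler_norm.
by apply: cV.1 => //; exact: ltW.
Qed.

(* Inherited from an approximating path of bounded variation. *)
Lemma dvar_coord_pvar_small_itv e : 0 < e -> exists2 delta, 0 < delta & forall s t, 0 <= s ->
  s <= t ->
  t <= T -> t - s < delta -> dvar (coord_pvar X) s t <= e.
Proof.
move=> e0; have tp : 0 < 2 `^ p :> R by exact: powR_gt0.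
pose e1 := e / 2 / 2 `^ p.
have e10 : 0 < e1 by rewrite !divr_gt0.
have [m /(_ m (leqnn m))[fD eD]] := distance_small e10.
have [V [cV _ _ hV]] := bv_small m.
have V0 : 0 <= V 0 T by exact: cV.1.
have V1 : 0 < V 0 T + 1 by lra.
have [dl dl0 hd] := hV _ (divr_gt0 e10 V1).
exists dl => // s t s0 st tT ts.
have cD := dvar_ctrl (coord_pvar_ge0 p _) fD.
pose W u v := 2 `^ p * (e1 / (V 0 T + 1) * V u v + dvar (gD m) u v).
have cW : ctrl 0 T W.
  by apply: ctrlZ => //; apply: ctrlD => //; apply: ctrlZ => //; apply/ltW; exact: divr_gt0.
apply: (@le_trans _ _ (W s t)).
  apply: (dvar_le_ctrl (coord_pvar_ge0 p _) coord_pvar_fin s0 st tT (ctrl_sub s0 tT cW)).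
  move=> u v su uv vt; have u0 := le_trans s0 su; have vT := le_trans vt tT.
  apply: le_trans (gX_le m u v) _; apply: ler_wpM2l => //; apply: lerD.
    by apply: hd => //; [exact: ltW|lra].
  exact: (dvar_ge (coord_pvar_ge0 p _) fD u0 uv vT).
have h1 : e1 / (V 0 T + 1) * V s t <= e1.
  rewrite mulrAC ler_pdivrMr //; apply: ler_wpM2l; first exact: ltW.
  have : V s t <= V 0 T by apply: (ctrl_mono cV).
  lra.
have h2 : dvar (gD m) s t <= e1.
  by apply: le_trans eD; apply: (ctrl_mono cD).
have -> : e = 2 `^ p * (e1 + e1).
  rewrite /e1; field; exact: lt0r_neq0.
by apply: ler_wpM2l => //; exact: lerD.
Qed.

(** delta is chosen before m. It comes from X, to which the signatures are compared at the cost of a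
    distance that is small for large m; the variations of the paths [Xm] themselves may grow without
    bound. *)
Lemma approx_controls e : 0 < e -> exists2 delta, 0 < delta &
  exists m0, forall m, (m0 <= m)%N ->
  [/\ (sup_dissections (gS m) 0 T < +oo)%E,
    dvar (gS m) 0 T <= 2 `^ p * (dvar (coord_pvar X) 0 T + 1)
  & forall s t, 0 <= s -> s <= t -> t <= T -> t - s < delta -> dvar (gS m) s t <= e].
Proof.
move=> e0; have tp : 0 < 2 `^ p :> R by exact: powR_gt0.
pose e1 := Num.min 1 (e / 2 / 2 `^ p).
have e10 : 0 < e1 by rewrite lt_min ltr01 !divr_gt0.
have [m0 hm0] := distance_small e10.
have [dl dl0 hd] := dvar_coord_pvar_small_itv e10.
exists dl => //; exists m0 => m /hm0[fD eD].
have cD := dvar_ctrl (coord_pvar_ge0 p _) fD.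
have cX := dvar_ctrl (coord_pvar_ge0 p _) coord_pvar_fin.
have cW := ctrlZ two_p (ctrlD cX cD).
have le u v : 0 <= u -> u < v -> v <= T ->
    gS m u v <= 2 `^ p * (dvar (coord_pvar X) u v + dvar (gD m) u v).
  move=> u0 uv vT; apply: le_trans (gS_le m u v) _; apply: ler_wpM2l => //; apply: lerD.
    exact: (dvar_ge (coord_pvar_ge0 p _) coord_pvar_fin u0 uv vT).
  exact: (dvar_ge (coord_pvar_ge0 p _) fD u0 uv vT).
have fS : (sup_dissections (gS m) 0 T < +oo)%E by exact: sup_dissections_fin cW le.
split=> //.
  apply: le_trans (dvar_le_ctrl (coord_pvar_ge0 p _) fS (lexx _) T0 (lexx _) cW le) _.
  apply: ler_wpM2l => //; apply: lerD => //; apply: le_trans eD _.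
  by rewrite ge_min lexx.
move=> s t s0 st tT ts.
apply: le_trans (dvar_le_ctrl (coord_pvar_ge0 p _) fS s0 st tT (ctrl_sub s0 tT cW) _) _.
  by move=> u v su uv vt; apply: le => //; [exact: le_trans su|exact: le_trans tT].
apply: (@le_trans _ _ (2 `^ p * (e1 + e1))).
  apply: ler_wpM2l => //; apply: lerD; first exact: hd.
  by apply: le_trans eD; apply: (ctrl_mono cD).
have : e1 * 2 `^ p <= e / 2 by rewrite -ler_pdivlMr // ge_min lexx orbT.
lra.
Qed.

Lemma approx_pointwise e : 0 < e -> exists m0, forall m, (m0 <= m)%N ->
  forall s t w, 0 <= s -> s < t -> t <= T -> (0 < size w <= N)%N -> `|S m s t w - X s t w| <= e.
Proof.
move=> e0; pose e1 := Num.min 1 e.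
have e10 : 0 < e1 by rewrite lt_min ltr01.
have e11 : e1 <= 1 by rewrite ge_min lexx.
(* As e1 <= 1, the threshold e1^p is below e1^(p/n) at every level n. *)
have [m0 hm0] := distance_small (powR_gt0 p e10); exists m0 => m /hm0[fD eD] s t w s0 st tT hw.
apply: (@le_trans _ _ e1); last by rewrite ge_min lexx orbT.
have /andP[w0 wN] := hw; have n0 : 0 < (size w)%:R :> R by rewrite ltr0n.
have q0 : 0 < p / (size w)%:R by rewrite divr_gt0.
rewrite leNgt; apply/negP => lt_e.
have := gt0_ltr_powR q0; move=> /(_ e1 `|S m s t w - X s t w|).
rewrite !nnegrE => /(_ (ltW e10) (normr_ge0 _) lt_e).
apply/negP; rewrite -leNgt; apply: (@le_trans _ _ (e1 `^ p)); last first.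
  apply: ger_powR; first by rewrite e10.
  by rewrite ler_pdivrMr // ler_peMr ?(ltW p0) // ler1n.
apply: le_trans eD; apply: (@le_trans _ _ (gD m s t)).
  exact: (@coord_pvar_ge_term _ _ _ (tdiff (S m) X)).
apply: le_trans (dvar_ge (coord_pvar_ge0 p _) fD s0 st tT) _.
apply: (ctrl_mono (dvar_ctrl (coord_pvar_ge0 p _) fD)) => //; exact: ltW.
Qed.

End Approximation.

(** Off the diagonal a dissection with one interval suffices. On it the only dissection is empty,
    and the coordinates vanish by multiplicativity. *)
Lemma dvar_holder T (x : R -> R -> tseries R d) : 0 <= T ->
  (sup_dissections (coord_pvar x) 0 T < +oo)%E -> multiplicative N 0 T x ->
  holder N p 0 T (dvar (coord_pvar x)) x.
Proof.
move=> T0 fx mx s t s0 st tT w wN.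
have [w0|w0] := posnP (size w).
  by rewrite (size0nil w0) mx.1 // normr1 /= mul0r powRr0.
have hw : (0 < size w <= N)%N by rewrite w0.
have [est|nst] := eqVneq s t.
  by rewrite est (multiplicative_diag mx) ?normr0 ?powR_ge0 // (le_trans s0).
have {}st : s < t by rewrite lt_neqAle nst.
have n0 : 0 < (size w)%:R :> R by rewrite ltr0n.
have -> : `|x s t w| = (`|x s t w| `^ (p / (size w)%:R)) `^ ((size w)%:R / p).
  rewrite -powRrM mulrA divfK ?gt_eqF // mulfV ?gt_eqF // powRr1 //.
apply: ge0_ler_powR; rewrite ?nnegrE ?powR_ge0 ?divr_ge0 ?(ltW p0) //.
  by apply: (dvar_ctrl (coord_pvar_ge0 p _) fx).1 => //; exact: ltW.
apply: le_trans (dvar_ge (coord_pvar_ge0 p _) fx s0 st tT).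
exact: coord_pvar_ge_term.
Qed.

Lemma trunc_signature_multiplicative T V (X : R -> 'rV[R]_d) : ctrl 0 T V ->
  (forall i, dominates 0 T V (fun u => X u 0 i)) ->
  (forall i, ucont 0 T (fun u => X u 0 i)) ->
  multiplicative N 0 T (trunc_signature N X).
Proof.
move=> cV dV uX; split=> [s t _ _ _|s u t s0 su ut tT w wN].
  by rewrite /trunc_signature /trunc.
rewrite /trunc_signature {1}/trunc wN (signature_Chen cV dV uX w s0 su ut tT).
rewrite /tmul; apply: eq_bigr => i _; rewrite /trunc size_take size_drop.
have -> : (if (i < size w)%N then i : nat else size w) = i.
  by case: ltnP => // h; apply/eqP; rewrite eqn_leq h /= -ltnS.
have iN : (i <= N)%N by apply: leq_trans wN; rewrite -ltnS.
by rewrite iN (leq_trans (leq_subr _ _)).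
Qed.

Lemma rough_path_multiplicative gamma T (X : R -> R -> tseries R d) :
  is_rough_path p gamma T X -> multiplicative N 0 T X.
Proof.
case=> _ _ h1 h2 _; split=> [s t s0 st tT|s u t s0 su ut tT w wN]; first exact: h1.
by rewrite (h2 s u t) // /trunc wN.
Qed.

End Controls.

(** * Linear rough differential equations as limits of products *)

Section Convergence.
Variables (R : realType) (d k : nat) (p : R).
Local Notation N := (Num.truncn p).
Local Notation Mat := 'M[R]_k.+1.
Local Notation hsn := (@hs_norm R k.+1 k.+1).
Hypotheses (hp : 2 < p) (d0 : (0 < d)%N).
Variables (B : 'I_d -> Mat) (T : R) (X : R -> R -> tseries R d).
Variables (Xm : nat -> R -> 'rV[R]_d) (Ym : nat -> R -> Mat).
Hypotheses (BT : forall i, (B i)^T = - B i) (T0 : 0 <= T).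
Hypotheses (mX : multiplicative N 0 T X) (hX : approximates p T Xm X).
Hypothesis (hY : forall m,
  solves_linear_ode T (fun v : 'rV[R]_d => \sum_i v 0 i *: B i) (Xm m) (Ym m)).
Local Notation S m := (trunc_signature N (Xm m)).
Local Notation P x := (fun s t => ev scalar_mx N B (x s t)).
Implicit Types (e s t a b delta : R).

Let p0 : 0 < p. Proof. exact: lt_trans hp. Qed.
Let L := \sum_i hsn (B i).
Let L0 : 0 <= L. Proof. by apply: sumr_ge0 => i _; exact: hs_norm_ge0. Qed.
Let hL i : hsn (B i) <= L.
Proof.
by rewrite /L (bigD1 i) //= lerDl; apply: sumr_ge0 => j _; exact: hs_norm_ge0.
Qed.
Let hn := @hs_ring_norm R k.
Let scC := @scalar_mx_central R k.
Let scN := @hs_scalar_mx R k.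

Let ev_trunc x : ev scalar_mx N B (trunc N x) = ev scalar_mx N B x.
Proof.
apply: eq_bigr => n _; apply: eq_wsum => w hw.
by rewrite /trunc hw -ltnS ltn_ord.
Qed.

Let Ym_orth m t : 0 <= t -> t <= T -> Ym m t *m (Ym m t)^T = 1%:M.
Proof.
move=> t0 tT; have [V [cV dV uX]] := continuous_bv_ctrl T0 (hX.1 m).
have [cY eY] := hY m; exact: (ode_orthogonal T0 cV dV uX BT cY eY).
Qed.

Let Ym_norm m t : 0 <= t -> t <= T -> hsn (Ym m t) = Num.sqrt k.+1%:R.
Proof. by move=> t0 tT; rewrite -[Ym m t]mul1mx hs_norm_orthr ?hs_norm1 ?Ym_orth. Qed.

(** Two estimates meet at a partition of [s, t] as fine as m requires: [flow_step] compares [Ym m]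
    with the product over it up to e, and sewing compares this product with [P (S m) s t]. Letting e
    tend to 0 leaves a bound with constants independent of m. *)
Let Ym_sewing : exists e0 K C : R, [/\ 0 < e0, 0 <= K, 0 < C &
  exists2 m0, forall m s t, (m0 <= m)%N -> 0 <= s -> s <= t -> t <= T ->
     dvar (coord_pvar p (S m)) s t <= e0 ->
     hsn (Ym m t - Ym m s * P (S m) s t) <=
       Num.sqrt k.+1%:R * (K * dvar (coord_pvar p (S m)) s t `^ (N.+1%:R / p))
  & forall m delta a b D, (m0 <= m)%N -> 0 <= a -> b <= T -> part delta a b D ->
     hsn (prodP (P (S m)) a D) <= C].
Proof.
have [Np pN N1] := truncn_bounds hp.
have [e0 [K [e00 K0 hK]]] := rough_sewing hn d scC scN p0 Np pN L0.
pose W := 2 `^ p * (dvar (coord_pvar p X) 0 T + 1).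
have [C C0 hC] := rough_bound hn d scC scN p0 Np pN W L0.
have [dl1 _ [m0 hm0]] := approx_controls hp d0 T0 hX ltr01.
have bound m delta a b D : (m0 <= m)%N -> 0 <= a -> b <= T -> part delta a b D ->
     hsn (prodP (P (S m)) a D) <= C.
  move=> /hm0[fS hW _] a0 bT hD; have ab := part_le hD.
  have [V [cV dV uX]] := continuous_bv_ctrl T0 (hX.1 m).
  have mS := trunc_signature_multiplicative p cV dV uX.
  have hS := dvar_holder hp T0 fS mS; have cS := dvar_ctrl (coord_pvar_ge0 p _) fS.
  apply: (hC B (S m) _ a b hL (ctrl_sub a0 bT cS) (multiplicative_sub a0 bT mS)
    (holder_sub a0 bT hS) _ _ _ hD).
  by apply: le_trans hW; apply: (ctrl_mono cS).
exists e0, K, C; split=> //; exists m0 => //.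
move=> m s t hm s0 st tT he; have [fS hW _] := hm0 m hm.
have [V [cV dV uX]] := continuous_bv_ctrl T0 (hX.1 m).
have mS := trunc_signature_multiplicative p cV dV uX.
have hS := dvar_holder hp T0 fS mS; have cS := dvar_ctrl (coord_pvar_ge0 p _) fS.
have [_ sew] := hK B (S m) _ s t hL (ctrl_sub s0 tT cS) (multiplicative_sub s0 tT mS)
    (holder_sub s0 tT hS) he.
have [cY eY] := hY m.
apply/ler_addgt0Pr => e e1.
have Vst : 0 <= V s t by exact: cV.1.
have VC : 0 < V s t * C + 1 by rewrite ltr_wpDl // mulr_ge0 // ltW.
have e2 : 0 < e / (V s t * C + 1) by rewrite divr_gt0.
have [dl dl0 hd] := flow_step T0 cV dV uX cY eY (ltnW N1) hL e2.
have [D hD] := part_exists dl0 st.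
have k1 : hsn (Ym m t - Ym m s * prodP (P (S m)) s D) <= e.
  have cU : ctrl s t (fun s' t' => e / (V s t * C + 1) * V s' t').
    by apply: ctrlZ; [exact: ltW|exact: ctrl_sub cV].
  apply: le_trans (telescope_prodP hn cU (lexx s) (ltW C0) _ _ hD) _.
  - move=> s' t' ss st' tt ts; rewrite /trunc_signature ev_trunc.
    by apply: hd => //; [exact: le_trans ss|exact: le_trans tT].
  - by move=> a' D' sa hD'; apply: bound hD' => //; exact: le_trans sa.
  have -> : e / (V s t * C + 1) * V s t * C = e * (V s t * C) / (V s t * C + 1) by ring.
  by rewrite ler_pdivrMr //; apply: ler_wpM2l; [exact: ltW|rewrite lerDl].
have k2 : hsn (Ym m s * (prodP (P (S m)) s D - P (S m) s t)) <=
    Num.sqrt k.+1%:R * (K * dvar (coord_pvar p (S m)) s t `^ (N.+1%:R / p)).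
  apply: le_trans (hs_normM _ _) _; rewrite Ym_norm ?(le_trans st) //.
  by apply: ler_wpM2l; [exact: sqrtr_ge0|exact: sew hD].
have -> : Ym m t - Ym m s * P (S m) s t = (Ym m t - Ym m s * prodP (P (S m)) s D) +
    Ym m s * (prodP (P (S m)) s D - P (S m) s t) by rewrite mulrBr subrKA.
by apply: le_trans (hs_normD _ _) _; rewrite addrC; exact: lerD.
Qed.

(** Local defects of order V^theta add up to at most (max V)^(theta - 1) times the total V up to
    constants, and on intervals shorter than delta the maximum is small uniformly in large m. *)
Lemma flow_defect e : 0 < e -> exists2 delta, 0 < delta & exists m0, forall m, (m0 <= m)%N ->
  forall a b D, 0 <= a -> b <= T -> part delta a b D ->
  hsn (Ym m b - Ym m a * prodP (P (S m)) a D) <= e.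
Proof.
move=> e1; have [Np pN N1] := truncn_bounds hp.
have [e0 [K [C [e00 K0 C0 [m1 h1 h2]]]]] := Ym_sewing.
pose W := 2 `^ p * (dvar (coord_pvar p X) 0 T + 1).
have W0 : 0 <= W.
  rewrite mulr_ge0 ?powR_ge0 // addr_ge0 //.
  exact: (dvar_ctrl (coord_pvar_ge0 p _) (coord_pvar_fin hp d0 T0 hX)).1.
pose th := N.+1%:R / p - 1.
have th0 : 0 < th by rewrite /th subr_gt0 ltr_pdivlMr // mul1r.
pose c := Num.sqrt k.+1%:R * K * W * C.
have c0 : 0 <= c := mulr_ge0 (mulr_ge0 (mulr_ge0 (sqrtr_ge0 _) K0) W0) (ltW C0).
have c1 : 0 < c + 1 by rewrite ltr_wpDl.
pose e2 := Num.min e0 ((e / (c + 1)) `^ th^-1).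
have e20 : 0 < e2 by rewrite lt_min e00 powR_gt0 // divr_gt0.
have eth : e2 `^ th <= e / (c + 1).
  have -> : e / (c + 1) = ((e / (c + 1)) `^ th^-1) `^ th.
    by rewrite -powRrM mulVf ?gt_eqF // powRr1 // ltW // divr_gt0.
  apply: ge0_ler_powR; rewrite ?nnegrE ?powR_ge0 ?(ltW th0) ?(ltW e20) //.
  by rewrite ge_min lexx orbT.
have [dl dl0 [m2 hm2]] := approx_controls hp d0 T0 hX e20.
exists dl => //; exists (maxn m1 m2) => m; rewrite geq_max => /andP[hm1 /hm2[fS hW small]].
move=> a b D a0 bT hD; have ab := part_le hD.
have cS := dvar_ctrl (coord_pvar_ge0 p _) fS.
pose c' := Num.sqrt k.+1%:R * K * e2 `^ th.
have c'0 : 0 <= c' := mulr_ge0 (mulr_ge0 (sqrtr_ge0 _) K0) (powR_ge0 _ _).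
have cU := ctrlZ c'0 cS.
apply: le_trans (telescope_prodP hn (ctrl_sub (lexx _) bT cU) a0 (ltW C0) _ _ hD) _.
- move=> s t s0 st tb ts; have tT := le_trans tb bT.
  have os := small s t s0 st tT ts.
  apply: le_trans (h1 m s t hm1 s0 st tT _) _; first by apply: le_trans os _;
    rewrite ge_min lexx.
  have os0 : 0 <= dvar (coord_pvar p (S m)) s t by exact: cS.1.
  rewrite -(mulr_powRB1 os0) ?divr_gt0 // -/th /c' !mulrA -[leRHS]mulrA.
  rewrite -[leLHS]mulrA; apply: ler_wpM2l; first by rewrite mulr_ge0 ?sqrtr_ge0.
  rewrite mulrC; apply: ler_wpM2r => //.
  by apply: ge0_ler_powR; rewrite ?nnegrE ?(ltW th0) ?(ltW e20).
- move=> a' D' a'0 hD'; exact: (h2 m dl a' b D').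
have oab : dvar (coord_pvar p (S m)) a b <= W by apply: le_trans hW; apply: (ctrl_mono cS).
apply: (@le_trans _ _ (e2 `^ th * c)).
  have -> : e2 `^ th * c = c' * W * C by rewrite /c /c'; ring.
  by apply: ler_wpM2r; [exact: ltW|exact: ler_wpM2l].
apply: le_trans (ler_wpM2r c0 eth) _.
by rewrite mulrAC ler_pdivrMr //; apply: ler_wpM2l; [exact: ltW|rewrite lerDl].
Qed.

Let ev_sub (x y : tseries R d) e : 0 <= e -> (forall w, (size w <= N)%N -> `|x w - y w| <= e) ->
  hsn (ev scalar_mx N B x - ev scalar_mx N B y) <= ev_tot hsn d N L * e.
Proof.
move=> e0 h.
have -> : ev scalar_mx N B x - ev scalar_mx N B y = ev scalar_mx N B (fun w => x w - y w).
  rewrite /ev -sumrB; apply: eq_bigr => n _; apply/eqP; rewrite subr_eq -wsumD; apply/eqP.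
  by apply: eq_wsum => w _; rewrite -mulrDl -raddfD subrK.
exact: (ev_bound hn scN L0 hL e0 h).
Qed.

(** Here m0 may depend on D: the product has finitely many factors, each converging with the
    coordinates of the signatures. *)
Lemma prodP_cvg a b delta D e : 0 <= a -> b <= T -> part delta a b D -> 0 < e ->
  exists m0, forall m, (m0 <= m)%N ->
  hsn (prodP (P (S m)) a D - prodP (P X) a D) <= e.
Proof.
move=> + bT; elim: D a e => [|t D IH] a e a0 /=.
  by move=> _ e0; exists 0%N => m _; rewrite subrr hs_norm0 ltW.
move=> [at_ ta hD] e0; have tT := le_trans (part_le hD) bT.
have t0 := le_trans a0 (ltW at_).
set Q := prodP (P X) t D; set A := P X a t.
pose c := hsn Q + hsn A + 1.
have c0 : 0 < c by rewrite ltr_wpDl // addr_ge0 ?hs_norm_ge0.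
pose e1 := Num.min 1 (e / (2 * c)).
have e10 : 0 < e1 by rewrite lt_min ltr01 divr_gt0 // mulr_gt0.
have e11 : e1 <= 1 by rewrite ge_min lexx.
have ec : e1 * (2 * c) <= e by rewrite -ler_pdivlMr ?mulr_gt0 // ge_min lexx orbT.
have [m1 h1] := IH t e1 t0 hD e10.
have B0 := ev_tot_ge0 hn d N L0.
have B1 : 0 < ev_tot hsn d N L + 1 by rewrite ltr_wpDl.
have [m2 h2] := approx_pointwise hp d0 T0 hX (divr_gt0 e10 B1).
exists (maxn m1 m2) => m; rewrite geq_max => /andP[/h1 k1 /h2 k2].
have k3 : hsn (P (S m) a t - A) <= e1.
  apply: (@le_trans _ _ (ev_tot hsn d N L * (e1 / (ev_tot hsn d N L + 1)))).
    apply: ev_sub; first by rewrite ltW // divr_gt0.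
    move=> w wN; have [w0|w0] := posnP (size w); last by apply: k2; rewrite ?w0.
    rewrite (size0nil w0) mX.1 ?(ltW at_) // subrr normr0.
    by rewrite ltW // divr_gt0.
  by rewrite mulrA ler_pdivrMr // mulrC; apply: ler_wpM2l; [exact: ltW|rewrite lerDl].
have -> : P (S m) a t * prodP (P (S m)) t D - A * Q =
   (P (S m) a t - A) * (prodP (P (S m)) t D - Q) + (P (S m) a t - A) * Q +
   A * (prodP (P (S m)) t D - Q).
  by rewrite -mulrDr subrK mulrBl mulrBr subrKA.
have nQ := hs_norm_ge0 Q; have nA := hs_norm_ge0 A.
have j1 : hsn ((P (S m) a t - A) * (prodP (P (S m)) t D - Q)) <= e1 * 1.
  apply: le_trans (hs_normM _ _) _; apply: ler_pM; rewrite ?hs_norm_ge0 //.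
  exact: le_trans e11.
have j2 : hsn ((P (S m) a t - A) * Q) <= e1 * hsn Q.
  by apply: le_trans (hs_normM _ _) _; apply: ler_wpM2r.
have j3 : hsn (A * (prodP (P (S m)) t D - Q)) <= hsn A * e1.
  by apply: le_trans (hs_normM _ _) _; apply: ler_wpM2l.
apply: le_trans (hs_normD _ _) _; apply: le_trans (lerD (hs_normD _ _) (lexx _)) _.
have : 0 <= e1 * c by rewrite mulr_ge0 // ltW.
by move: ec j1 j2 j3; rewrite /c; lra.
Qed.

(** The mesh is fixed by [flow_defect], then D is given, and only then is m taken large, so that m
    disappears from the conclusion. *)
Lemma prodP_solution (Y : R -> Mat) e : 
  (forall e, 0 < e -> exists m0 : nat, forall m : nat, (m0 <= m)%N ->
          forall t, 0 <= t <= T -> hsn (Ym m t - Y t) < e) -> 0 < e ->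
  exists2 delta, 0 < delta & forall D, part delta 0 T D -> hsn (Y T - prodP (P X) 0 D) <= e.
Proof.
move=> hl e0; have e3 : 0 < e / 3 by rewrite divr_gt0.
have [dl dl0 [m1 h1]] := flow_defect e3.
exists dl => // D hD.
have [m2 h2] := prodP_cvg (lexx _) (lexx _) hD e3.
have [m3 h3] := hl _ e3.
pose m := maxn m1 (maxn m2 m3).
have k1 : (m1 <= m)%N by rewrite leq_maxl.
have k2 : (m2 <= m)%N by rewrite (leq_trans (leq_maxl _ _) (leq_maxr _ _)).
have k3 : (m3 <= m)%N by rewrite (leq_trans (leq_maxr _ _) (leq_maxr _ _)).
have {h1}j1 := h1 m k1 0 T D (lexx _) (lexx _) hD.
have {h2}j2 := h2 m k2.
have {h3}j3 : hsn (Y T - Ym m T) <= e / 3.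
  by rewrite -hs_normN opprB; apply/ltW/h3; rewrite ?T0 ?lexx.
have Y0 : Ym m 0 = 1.
  have [V [cV dV uX]] := continuous_bv_ctrl T0 (hX.1 m).
  have [cY eY] := hY m; exact: (ode_initial T0 cV dV eY).
rewrite Y0 mul1r in j1.
have -> : Y T - prodP (P X) 0 D = (Y T - Ym m T) + (Ym m T - prodP (P (S m)) 0 D) +
   (prodP (P (S m)) 0 D - prodP (P X) 0 D) by rewrite !subrKA.
apply: le_trans (hs_normD _ _) _; apply: le_trans (lerD (hs_normD _ _) (lexx _)) _.
lra.
Qed.

(** The product over [a, b] is close to [Ya^T *m Yb], where Ya and Yb are the orthogonal values of
    [Ym m] at a and b. Multiplying A by the latter preserves the norm, and the errors are
    proportional to the norm of A. *)
Lemma prodP_near_orthogonal e : 0 < e -> exists2 delta, 0 < delta &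
  forall a b D (A : Mat), 0 <= a -> b <= T -> part delta a b D ->
  hsn (A * prodP (P X) a D) <= (1 + e) * hsn A.
Proof.
move=> e0; have e2 : 0 < e / 2 by rewrite divr_gt0.
have [dl dl0 [m1 h1]] := flow_defect e2.
exists dl => // a b D A a0 bT hD; have ab := part_le hD.
have [m2 h2] := prodP_cvg a0 bT hD e2.
pose m := maxn m1 m2.
have {h1}j1 := h1 m (leq_maxl _ _) a b D a0 bT hD.
have {h2}j2 := h2 m (leq_maxr _ _).
set F := prodP (P (S m)) a D in j1 j2; set G := prodP (P X) a D in j2 *.
set Ya := Ym m a in j1; set Yb := Ym m b in j1.
have oa : Ya *m Ya^T = 1%:M by apply: Ym_orth => //; exact: le_trans bT.
have oa' : Ya^T *m Ya = 1%:M by exact: mulmx1C.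
have ob : Yb *m Yb^T = 1%:M by apply: Ym_orth => //; exact: le_trans ab.
have nA : hsn (A *m Ya^T) = hsn A by apply: hs_norm_orthr; rewrite trmxK.
have -> : A * G = A *m Ya^T *m Yb - A *m Ya^T *m (Yb - Ya * F) - A * (F - G).
  have -> : A *m Ya^T *m (Yb - Ya * F) = A *m Ya^T *m Yb - A *m F.
    rewrite mulmxBr; congr (_ - _).
    by rewrite -mulmxE -mulmxA (mulmxA Ya^T) oa' mul1mx.
  by rewrite opprB addrCA subrr addr0 mulrBr -!mulmxE opprB addrCA subrr addr0.
have k1 : hsn (A *m Ya^T *m Yb) = hsn A by rewrite hs_norm_orthr.
have k2 : hsn (A *m Ya^T *m (Yb - Ya * F)) <= hsn A * (e / 2).
  by apply: le_trans (hs_normM _ _) _; rewrite nA ler_wpM2l ?hs_norm_ge0.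
have k3 : hsn (A * (F - G)) <= hsn A * (e / 2).
  by apply: le_trans (hs_normM _ _) _; rewrite ler_wpM2l ?hs_norm_ge0.
apply: le_trans (hs_normD _ _) _; apply: le_trans (lerD (hs_normD _ _) (lexx _)) _.
rewrite !hs_normN k1; lra.
Qed.

End Convergence.

(** * Power series *)

Section PowerSeries.
Variable R : realType.
Implicit Types (a : nat -> R) (r mu : R).

(* One ultrafilter yields the limits of all the coefficients simultaneously. *)
Lemma ultrafilter_limits : exists U : set_system nat, [/\ ProperFilter U, \oo `<=` U &
  forall (u : nat -> R) (C : R), (forall m, `|u m| <= C) -> exists l : R, u @ U --> l].
Proof.
have [U [UU hU]] := @ultraFilterLemma nat \oo _.
exists U; split=> [||u C hu]; [exact: ultra_proper|exact: hU|].
have uU : UltraFilter (u @ U).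
  split; first by apply: fmap_proper_filter; exact: ultra_proper.
  move=> G GG hG; apply/seteqP; split=> [A GA|]; last exact: hG.
  have [//|UA] := in_ultra_setVsetC (u @^-1` A) UU.
  have GnA : G (~` A) by apply: hG; exact: UA.
  by have [x []] := filter_ex (filterI GA GnA).
have : compact `[- C, C]%classic by exact: segment_compact.
rewrite compact_ultra => /(_ (u @ U) uU)[].
- have hm (m : nat) : `[- C, C]%classic (u m) by rewrite /= in_itv /= -ler_norml.
  exact: (@filterE _ _ _ (u @^-1` `[- C, C]%classic) hm).
- by move=> l [_ hl]; exists l.
Qed.

(** Radius of convergence at least r, in a form that termwise differentiation preserves. *)
Definition bounded_coef r a := forall rho, 0 < rho -> rho < r ->
  exists C, forall n, `|a n| * rho ^+ n <= C.

Lemma bounded_coef_cvg r a mu : bounded_coef r a -> `|mu| < r -> cvgn (pseries a mu).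
Proof.
move=> ba mur; pose rho := (`|mu| + r) / 2.
have m0 := normr_ge0 mu.
have rho0 : 0 < rho by rewrite /rho; lra.
have mr : `|mu| < rho by rewrite /rho; lra.
have [|C hC] := ba rho rho0; first by rewrite /rho; lra.
have q0 : 0 <= `|mu| / rho by rewrite mulr_ge0 // invr_ge0 ltW.
apply: normed_cvg; apply: (@series_le_cvg _ _ (geometric C (`|mu| / rho))) => [n|n|n|].
- exact: normr_ge0.
- by apply: mulr_ge0; [apply: le_trans (hC 0%N); rewrite mulr_ge0|exact: exprn_ge0].
- apply: (@le_trans _ _ (`|a n * mu ^+ n|)) => //; rewrite /geometric /= normrM normrX.
  have -> : `|a n| * `|mu| ^+ n = `|a n| * rho ^+ n * (`|mu| / rho) ^+ n.
    by rewrite -mulrA -exprMn [rho * _]mulrC divfK // gt_eqF.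
  by apply: ler_wpM2r => //; exact: exprn_ge0.
- apply: is_cvg_geometric_series.
  by rewrite ger0_norm // ltr_pdivrMr // mul1r.
Qed.

(** The factor n + 1 is absorbed by enlarging rho to s: by Bernoulli's inequality it is at most a
    constant times (s / rho)^n. *)
Lemma bounded_coef_diffs r a : bounded_coef r a -> bounded_coef r (pseries_diffs a).
Proof.
move=> ba rho rho0 rhor; pose s := (rho + r) / 2.
have rs : rho < s by rewrite /s; lra.
have s0 : 0 < s by lra.
have [|C hC] := ba s s0; first by rewrite /s; lra.
pose h := s / rho - 1.
have h0 : 0 < h by rewrite /h subr_gt0 ltr_pdivlMr // mul1r.
have C0 : 0 <= C by apply: le_trans (hC 0%N); rewrite mulr_ge0.
exists (C * (1 + h^-1) / s) => n.
have bern : forall m, 1 + m%:R * h <= (1 + h) ^+ m.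
  elim=> [|m IH]; first by rewrite mul0r addr0.
  rewrite exprS -[m.+1%:R]natr1; apply: (@le_trans _ _ ((1 + h) * (1 + m%:R * h))).
    have : 0 <= m%:R * h * h by rewrite !mulr_ge0 // ltW.
    lra.
  by apply: ler_wpM2l => //; lra.
have n1 : n.+1%:R <= (1 + h^-1) * (1 + h) ^+ n.
  apply: (@le_trans _ _ ((1 + h^-1) * (1 + n%:R * h))).
    have -> : (1 + h^-1) * (1 + n%:R * h) = 1 + n%:R * h + h^-1 + n%:R by field;
      exact: lt0r_neq0.
    have : 0 <= n%:R * h by rewrite mulr_ge0 // ltW.
    have : 0 < h^-1 by rewrite invr_gt0.
    rewrite -natr1; lra.
  by apply: ler_wpM2l => //; rewrite addr_ge0 // invr_ge0 ltW.
have sE : s ^+ n = (1 + h) ^+ n * rho ^+ n.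
  by rewrite -exprMn /h addrCA subrr addr0 divfK // gt_eqF.
rewrite /pseries_diffs normrM ger0_norm // ler_pdivlMr //.
apply: (@le_trans _ _ (`|a n.+1| * s ^+ n.+1 * (1 + h^-1))); last first.
  by apply: ler_wpM2r; [rewrite addr_ge0 // invr_ge0 ltW|exact: hC].
rewrite exprSr sE.
have -> : n.+1%:R * `|a n.+1| * rho ^+ n * s = `|a n.+1| * rho ^+ n * s * n.+1%:R by ring.
have -> : `|a n.+1| * ((1 + h) ^+ n * rho ^+ n * s) * (1 + h^-1) =
  `|a n.+1| * rho ^+ n * s * ((1 + h^-1) * (1 + h) ^+ n) by ring.
exact: (ler_wpM2l (mulr_ge0 (mulr_ge0 (normr_ge0 _) (exprn_ge0 _ (ltW rho0))) (ltW s0))).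
Qed.

(** The expansion is assumed on a whole disc, since in the induction the derivative must again be
    expanded on the same disc. *)
Lemma derive1n_pseries r n (f : R -> R) a x : 0 < r -> bounded_coef r a ->
  (forall mu, `|mu| < r -> f (x + mu) = limn (pseries a mu)) ->
  derive1n n f x = n`!%:R * a n.
Proof.
move=> r0; elim: n f a => [|n IH] f a ba hf.
  rewrite derive1n0 fact0 mul1r -[x]addr0 hf ?normr0 //.
  have -> : pseries a 0 = (fun m => if (m == 0)%N then 0 else a 0%N).
    apply/funext => -[|m]; first by rewrite /pseries /series /= big_geq.
    rewrite /pseries /series /= big_nat_recl // expr0 mulr1 big1 ?addr0 // => i _.
    by rewrite exprS mul0r mulr0.
  by apply: cvg_lim => //; apply: cvg_near_cst; exists 1%N => // -[].
rewrite derive1Sn (IH _ (pseries_diffs a)).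
- by rewrite /pseries_diffs factS natrM mulrA [n`!%:R * _]mulrC.
- exact: bounded_coef_diffs.
- move=> mu mur; rewrite derive1E.
  pose rho := (`|mu| + r) / 2.
  have m0 := normr_ge0 mu.
  have rho0 : 0 < rho by rewrite /rho; lra.
  have mr : `|mu| < rho by rewrite /rho; lra.
  have mr' : `|mu| < `|rho| by rewrite [ltRHS]gtr0_norm.
  have rhor : `|rho| < r by rewrite gtr0_norm // /rho; lra.
  have bd := bounded_coef_diffs ba; have bdd := bounded_coef_diffs bd.
  have der := pseries_snd_diffs (bounded_coef_cvg ba rhor) (bounded_coef_cvg bd rhor)
    (bounded_coef_cvg bdd rhor) mr'.
  have hx : mu = (x + mu) - x by rewrite addrC addKr.
  have dcomp : is_derive (x + mu) (1 : R) (fun y => limn (pseries a (y - x)))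
      (limn (pseries (pseries_diffs a) mu)).
    have d1 : is_derive (x + mu) (1 : R) (fun y => y - x) 1.
      by apply: is_derive_eq; rewrite oppr0 addr0.
    have d2 : is_derive ((fun y => y - x) (x + mu)) (1 : R) (fun z => limn (pseries a z))
        (limn (pseries (pseries_diffs a) mu)) by rewrite /= -hx.
    have := @is_derive1_comp R (fun z => limn (pseries a z)) (fun y => y - x) (x + mu) _ _ d2
      d1.
    by rewrite mulr1.
  rewrite -(@derive_val _ _ _ _ _ _ _ dcomp); apply: near_eq_derive.
  near=> y; rewrite -hf; first by rewrite addrC subrK.
  have -> : y - x = (y - (x + mu)) + mu by ring.
  apply: le_lt_trans (ler_normD _ _) _.
  have : `|(x + mu) - y| < r - `|mu|.
    near: y; apply: (@nbhsx_ballx _ _ (x + mu) (r - `|mu|)); lra.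
  by rewrite distrC; lra.
Unshelve. all: by end_near.
Qed.

(** The bound at r makes the tails at mu geometric of ratio |mu| / r, uniformly in m; the limit
    along U is then taken in the partial sums. *)
Lemma poly_limit_pseries (U : set_system nat) (Q : nat -> {poly R}) a r C (f : R -> R) mu :
  ProperFilter U -> 0 < r ->
  (forall m s, \sum_(n < s) `|(Q m)`_n| * r ^+ n <= C) ->
  (forall n, (fun m => (Q m)`_n) @ U --> a n) ->
  `|mu| < r -> (fun m => (Q m).[mu]) @ U --> f mu -> f mu = limn (pseries a mu).
Proof.
move=> FU r0 hC ha mur hf.
pose rho := `|mu| / r.
have rho0 : 0 <= rho by rewrite divr_ge0 // ltW.
have rho1 : rho < 1 by rewrite ltr_pdivrMr // mul1r.
have muE : `|mu| = rho * r by rewrite divfK // gt_eqF.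
have tail m N : `|(Q m).[mu] - \sum_(n < N) (Q m)`_n * mu ^+ n| <= rho ^+ N * C.
  pose s := maxn (size (Q m)) N.
  rewrite (@horner_coef_wide _ s) ?leq_maxl //.
  have Ns : (N <= s)%N by rewrite leq_maxr.
  rewrite -(big_mkord xpredT (fun n => (Q m)`_n * mu ^+ n)).
  rewrite -(big_mkord xpredT (fun n => (Q m)`_n * mu ^+ n)) (big_cat_nat (n := N)) //=.
  rewrite addrC addrK; apply: le_trans (ler_norm_sum _ _ _) _.
  apply: (@le_trans _ _ (\sum_(N <= n < s) rho ^+ N * (`|(Q m)`_n| * r ^+ n))).
    apply: ler_sum_nat => n /andP[Nn _]; rewrite normrM normrX muE exprMn mulrCA.
    rewrite mulrA [X in X * _]mulrC -mulrA mulrA [X in X * _ <= _]mulrC -mulrA.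
    apply: ler_wpM2r; first by rewrite mulr_ge0 ?exprn_ge0 // ltW.
    by apply: ler_wiXn2l => //; exact: ltW.
  rewrite -mulr_sumr; apply: ler_wpM2l; first by rewrite exprn_ge0.
  apply: le_trans (hC m s).
  rewrite -(big_mkord xpredT (fun n => `|(Q m)`_n| * r ^+ n)) (@big_cat_nat _ _ _ N 0 s) //=.
  by rewrite lerDr; apply: sumr_ge0 => n _; rewrite mulr_ge0 ?exprn_ge0 // ltW.
have tail_lim N : `|f mu - \sum_(n < N) a n * mu ^+ n| <= rho ^+ N * C.
  have cv : (fun m => `|(Q m).[mu] - \sum_(n < N) (Q m)`_n * mu ^+ n|) @ U -->
      `|f mu - \sum_(n < N) a n * mu ^+ n|.
    apply: cvg_norm; apply: cvgB => //; apply: cvg_big => // [|n _].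
      exact: add_continuous.
    by apply: cvgMl; exact: ha.
  apply: (cvgr_to_le cv).
  by apply: nearW => m; exact: tail.
apply/esym/cvg_lim => //; apply/cvgrPdist_le => e e0; near=> N.
rewrite /pseries /series /= big_mkord; apply: le_trans (tail_lim N) _.
have : `|0 - geometric C rho N| <= e.
  near: N; apply: cvgr_dist_le e0; apply: cvg_geometric; by rewrite ger0_norm.
by rewrite sub0r normrN /geometric /= mulrC => h; apply: le_trans (ler_norm _) h.
Unshelve. all: by end_near.
Qed.

End PowerSeries.

(** * Derivatives of a limit of matrix polynomials *)

Section AnalyticBound.
Variables (R : realType) (k : nat).
Local Notation Mat := 'M[R]_k.+1.
Local Notation hsn := (@hs_norm R k.+1 k.+1).

Lemma partial_pnorm r (q : {poly Mat}) s : 0 <= r ->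
  \sum_(n < s) hsn q`_n * r ^+ n <= pnorm r q.
Proof.
move=> r0; pose s' := maxn s (size (majorant q)).
rewrite /pnorm (@horner_coef_wide _ s') ?leq_maxr //.
have ss : (s <= s')%N by rewrite leq_maxl.
rewrite -(big_mkord xpredT (fun n => hsn q`_n * r ^+ n)).
rewrite -(big_mkord xpredT (fun n => (majorant q)`_n * r ^+ n)) (@big_cat_nat _ _ _ s 0 s') //=.
apply: ler_wpDr; last by apply: ler_sum => n _; rewrite coef_majorant.
by apply: sumr_ge0 => n _; rewrite coef_majorant mulr_ge0 ?hs_norm_ge0 ?exprn_ge0.
Qed.

Definition entry_poly (q : {poly Mat}) i j : {poly R} := \poly_(n < size q) q`_n i j.

Lemma coef_entry_poly q i j n : (entry_poly q i j)`_n = q`_n i j.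
Proof.
rewrite coef_poly; case: ltnP => // h; rewrite [q`_n]nth_default //.
by rewrite mxE.
Qed.

Lemma horner_entry_poly q i j mu : (entry_poly q i j).[mu] = q.[mu%:M] i j.
Proof.
rewrite (@horner_coef_wide _ (size q)) ?size_poly // horner_coef summxE.
apply: eq_bigr => n _; rewrite coef_entry_poly.
have -> : (mu%:M : Mat) ^+ n = (mu ^+ n)%:M by rewrite -rmorphXn.
by rewrite -scalar_mx_central -mulmxE mul_scalar_mx mxE mulrC.
Qed.

(** Boundedness gives limits of all coefficients along one ultrafilter, and convergence of the
    values identifies these limits as the Taylor coefficients of Y at x. *)
Lemma deriv_param_bound (Y : R -> Mat) (Q : nat -> {poly Mat}) x r C n : 0 < r ->
  (forall m, pnorm r (Q m) <= C) ->
  (forall mu e, 0 < e -> exists m0, forall m, (m0 <= m)%N ->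
     hsn (Y (x + mu) - (Q m).[mu%:M]) <= e) ->
  hsn (deriv_param n Y x) <= n`!%:R / r ^+ n * C.
Proof.
move=> r0 hC hQ; have r0' := ltW r0.
have [U [FU Uoo hU]] := ultrafilter_limits R.
have C0 : 0 <= C by apply: le_trans (hC 0%N);
  exact: (nrm_ge0 (@pnorm_ring_norm R k r r0') (Q 0%N)).
have coefC m l : hsn (Q m)`_l <= C / r ^+ l.
  by rewrite ler_pdivlMr ?exprn_gt0 //; apply: le_trans (hC m); exact: coef_pnorm.
have /choice[a ha] : forall ijl : ('I_k.+1 * 'I_k.+1) * nat, exists l : R,
    (fun m => (Q m)`_ijl.2 ijl.1.1 ijl.1.2) @ U --> l.
  move=> [[i j] l] /=; apply: (hU _ (C / r ^+ l)) => m.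
  by apply: le_trans (hs_norm_entry _ _ _) _; exact: coefC.
have ab i j l : `|a ((i, j), l)| <= C / r ^+ l.
  apply: (cvgr_to_le (cvg_norm (ha ((i, j), l)))).
  by apply: nearW => m /=; apply: le_trans (hs_norm_entry _ _ _) _; exact: coefC.
have der i j : derive1n n (fun y => Y y i j) x = n`!%:R * a ((i, j), n).
  apply: (@derive1n_pseries _ r _ _ (fun l => a ((i, j), l))) => //.
    move=> rho rho0 rhor; exists C => l; apply: (@le_trans _ _ (C / r ^+ l * r ^+ l));
      last first.
      by rewrite divfK // expf_neq0 // gt_eqF.
    apply: ler_pM => //; first by rewrite exprn_ge0 // ltW.
    by rewrite lerXn2r ?nnegrE // ltW.
  move=> mu mur.
  apply: (@poly_limit_pseries _ U (fun m => entry_poly (Q m) i j) _ r C (fun mu => Y (x + mu)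
    i j)) => //.
  - move=> m s; apply: le_trans (hC m); apply: le_trans (partial_pnorm _ s r0').
    apply: ler_sum => l _; rewrite coef_entry_poly ler_wpM2r ?exprn_ge0 //.
    exact: hs_norm_entry.
  - by move=> l; under eq_fun do rewrite coef_entry_poly; exact: (ha ((i, j), l)).
  - apply: cvg_trans (_ : _ @ \oo --> _); first by apply: cvg_app; exact: Uoo.
    apply/cvgrPdist_le => e e0; have [m0 h] := hQ mu e e0.
    exists m0 => // m hm; rewrite horner_entry_poly.
    have := hs_norm_entry (Y (x + mu) - (Q m).[mu%:M]) i j; rewrite !mxE => hh.
    by apply: le_trans hh _; exact: h.
have -> : deriv_param n Y x = n`!%:R *: \matrix_(i, j) a ((i, j), n).
  by apply/matrixP => i j; rewrite !mxE der.
rewrite hs_normZ ger0_norm // -mulrA; apply: ler_wpM2l => //.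
rewrite [_ * C]mulrC; set A := \matrix_(i, j) _.
have c0 : 0 <= C / r ^+ n by rewrite divr_ge0 // exprn_ge0.
suff h : hs2 A <= (C / r ^+ n) ^+ 2.
  by rewrite -[leRHS]ger0_norm // -sqrtr_sqr; apply: ler_wsqrtr.
(* The norm passes to the limit as a whole; bounding A entry by entry would cost a factor depending
   on the dimension. *)
have cv : (fun m => hs2 (Q m)`_n) @ U --> hs2 A.
  apply: cvg_big => // [|i _]; first exact: add_continuous.
  apply: cvg_big => // [|j _]; first exact: add_continuous.
  rewrite mxE expr2; under eq_fun do rewrite expr2.
  by apply: cvgM; exact: (ha ((i, j), n)).
apply: (cvgr_to_le cv); apply: nearW => m.
by rewrite -hs_norm_sqr lerXn2r ?nnegrE ?hs_norm_ge0.
Qed.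

End AnalyticBound.

(** * Greedy partitions and the derivative bound *)

Section NonMeasurableIntegral.
Variables (d : measure_display) (T : measurableType d) (R : realType).
Variable mu : {measure set T -> \bar R}.
Import HBNNSimple.
Local Open Scope ereal_scope.

(* The greedy count is not known to be measurable, so this goes through the
   definition of the integral as a supremum over simple functions. *)
Lemma integral_le_scale (f g : T -> \bar R) (c : R) : (0 < c)%R ->
  (forall x, 0 <= f x) -> (forall x, 0 <= g x) -> (forall x, f x <= c%:E * g x) ->
  \int[mu]_x f x <= c%:E * \int[mu]_x g x.
Proof.
move=> c0 f0 g0 fg; rewrite !ge0_integralTE //.
apply: ge_ereal_sup => _ [h hf <-].
have ci0 : (0 <= c^-1)%R by rewrite invr_ge0 ltW.
pose h' := mul_nnsfun (cst_nnsfun T (NngNum ci0)) h.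
have hE : h = (cst c \* h')%R :> (T -> R).
  by apply/funext => x; rewrite /= mulrA mulfV ?mul1r // gt_eqF.
have -> : sintegral mu h = c%:E * sintegral mu h'.
  by rewrite -sintegralrM; congr sintegral.
apply: lee_wpmul2l; first by rewrite lee_fin ltW.
apply: ereal_sup_ubound; exists h' => // x.
by rewrite /= EFinM lee_pdivrMl //; exact: le_trans (hf x) (fg x).
Qed.

End NonMeasurableIntegral.

Definition scalar_poly (R : realType) (k : nat) : {rmorphism R -> {poly 'M[R]_k.+1}} :=
  polyC \o scalar_mx.

(** * Products of pencils along greedy partitions *)

Section Greedy.
Variables (R : realType) (d k : nat) (p : R).
Local Notation N := (Num.truncn p).
Local Notation Mat := 'M[R]_k.+1.
Local Notation hsn := (@hs_norm R k.+1 k.+1).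
Hypotheses (hp : 2 < p) (d0 : (0 < d)%N).
Local Notation scp := (scalar_poly R k).
Implicit Types (a b t lambda eta : R) (X : R -> R -> tseries R d).

Let p0 : 0 < p. Proof. exact: lt_trans hp. Qed.

(** The infimum only gives information on times strictly before it: at the greedy time itself the
    norm may be 1 or more. *)
Lemma greedy_nextP T X a : a <= T ->
  [/\ a <= greedy_next p T X a, greedy_next p T X a <= T &
   forall t, a < t -> t < greedy_next p T X a -> (pvar_norm p X a t < 1)%E].
Proof.
move=> aT; rewrite /greedy_next; set S := (_ `|` _).
have lbS : lbound S a by move=> t [[/andP[/ltW]]|->].
have hinf : has_inf S by split; [exists T; right|exists a].
have infT : inf S <= T by apply: ge_inf; [case: hinf|right].
split=> //; first by apply: lb_le_inf; case: hinf.
move=> t at_ tS; rewrite ltNge; apply/negP => h.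
have : inf S <= t.
  apply: ge_inf; first by case: hinf.
  by left; split=> //; rewrite at_ (le_trans (ltW tS)).
by rewrite leNgt tS.
Qed.

Lemma greedy_time_bounds T X j : 0 <= T -> 0 <= greedy_time p T X j /\ greedy_time p T X j <= T.
Proof.
move=> T0; elim: j => [//|j [h1 h2]] /=.
by have [h3 h4 _] := greedy_nextP X h2; split=> //; exact: le_trans h3.
Qed.

Let scpC c (x : {poly Mat}) : scp c * x = x * scp c.
Proof.
by apply/polyP => i; rewrite /= coefCM coefMC scalar_mx_central.
Qed.

Let scpN r c (x : {poly Mat}) : 0 <= r -> pnorm r (scp c * x) <= `|c| * pnorm r x.
Proof. exact: pnorm_scalar. Qed.

Lemma part_rcons delta a b (D : seq R) t : part delta a b (rcons D t) ->
  [/\ t = b, part delta a (last a D) D, last a D < b & b - last a D < delta].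
Proof.
elim: D a => [|s D IH] a /=; first by move=> [? ? <-].
by move=> [h1 h2 /IH[-> h3 h4 h5]].
Qed.

(** The link between the two uses of [ev]: evaluation at a scalar matrix is a ring morphism that
    carries the pencil at lambda to the matrices at lambda + mu. *)
Lemma horner_prodP lambda mu (E : 'I_d -> Mat) X a D :
  (prodP (fun s t => ev scp N (fun i => pencil lambda (E i)) (X s t)) a D).[mu%:M] =
  prodP (fun s t => ev scalar_mx N (fun i => (lambda + mu) *: E i) (X s t)) a D.
Proof.
rewrite -horner_scalarE rmorph_prodP; congr (prodP _ _ _); apply/funext => s; apply/funext => t.
rewrite (@rmorph_ev _ _ _ (horner_scalar k mu) scp scalar_mx) => [|c].
  by congr ev; apply/funext => i; rewrite /= horner_scalarE horner_pencil.
by rewrite horner_scalarE hornerC.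
Qed.

(** The partition up to each greedy time is extended by a fine one of the next greedy interval,
    which contributes one factor e^eta. Only r must precede X; the mesh that orthogonality requires
    may depend on X, since partitions can be refined at will. *)
Lemma greedy_constant (E : 'I_d -> Mat) Lambda eta : 0 <= Lambda -> 0 < eta ->
  exists2 r, 0 < r & forall lambda, `|lambda| <= Lambda ->
  forall T X, 0 <= T -> multiplicative N 0 T X ->
  (sup_dissections (coord_pvar p X) 0 T < +oo)%E ->
  (forall e, 0 < e -> exists2 delta, 0 < delta & forall s t, 0 <= s -> s <= t ->
     t <= T -> t - s < delta -> dvar (coord_pvar p X) s t <= e) ->
  (forall e, 0 < e -> exists2 delta, 0 < delta &
     forall a b D (A : Mat), 0 <= a -> b <= T -> part delta a b D ->
     hsn (A * prodP (fun s t => ev scalar_mx N (fun i => lambda *: E i) (X s t)) a D) <= (1 +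
       e) * hsn A) ->
  forall j delta, 0 < delta -> exists2 D, part delta 0 (greedy_time p T X j) D &
    pnorm r (prodP (fun s t => ev scp N (fun i => pencil lambda (E i)) (X s t)) 0 D)
      <= Num.sqrt k.+1%:R * expR eta ^+ j.
Proof.
move=> La0 eta0; have [Np pN N1] := truncn_bounds hp.
pose L := (Lambda + 1) * \sum_i hsn (E i).
have S0 : 0 <= \sum_i hsn (E i) by apply: sumr_ge0 => i _; exact: hs_norm_ge0.
have L0 : 0 <= L by rewrite /L mulr_ge0 // addr_ge0.
have h1 := pnorm_ring_norm k (@ler01 R).
have [e0 [K [e00 K0 sew]]] := rough_sewing h1 d scpC (fun c x => scpN c x ler01) p0 Np pN L0.
have [C C0 hC] := rough_bound h1 d scpC (fun c x => scpN c x ler01) p0 Np pN ((d ^ N)%:R) L0.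
(* A greedy interval has Wiener norm at most 2 C at radius 1, and its constant coefficient
   multiplies norms by at most 1 + eta / 2; then 1 + eta / 2 + r (2 C) <= 1 + eta <= e^eta. *)
pose r := Num.min 1 (eta / (4 * C)).
have r0 : 0 < r by rewrite lt_min ltr01 divr_gt0 // mulr_gt0.
have r1 : r <= 1 by rewrite ge_min lexx.
have rC : r * (4 * C) <= eta by rewrite -ler_pdivlMr ?mulr_gt0 // ge_min lexx orbT.
exists r => // lambda hla T X T0 mX fX small orth.
pose m i := pencil lambda (E i).
have hm i : pnorm 1 (m i) <= L.
  apply: le_trans (pnorm_pencil _ _) _; apply: ler_pM;
    rewrite ?addr_ge0 ?hs_norm_ge0 ?lerD2r //.
  by rewrite (bigD1 i) //= lerDl; apply: sumr_ge0 => l _; exact: hs_norm_ge0.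
have cX := dvar_ctrl (coord_pvar_ge0 p X) fX.
have hX := dvar_holder hp T0 fX mX.
have [d1 d10 hd1] := small e0 e00.
have [d2 d20 hd2] := orth _ (divr_gt0 eta0 (ltr0n R 2)).
elim=> [|j IH] delta dl0.
  by exists [::] => //=; rewrite mulr1 pnormC hs_norm1.
have [D0 hD0 bD0] := IH delta dl0.
have [tj0 tjT] := greedy_time_bounds X j T0.
set a := greedy_time p T X j in hD0 tj0 tjT.
have [ab bT pv] := greedy_nextP X tjT.
rewrite /greedy_time iterS -/(greedy_time p T X j) -/a.
set b := greedy_next p T X a in ab bT pv *.
have dmin : 0 < Num.min delta (Num.min d1 d2) by rewrite !lt_min dl0 d10.
have [D hD] := part_exists dmin ab.
exists (D0 ++ D).
  apply: part_cat hD0 _; apply: part_weaken hD; by rewrite ge_min lexx.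
have lastD0 : last 0 D0 = a.
  by have [_ /eqP] := part_itv hD0.
rewrite prodP_cat lastD0.
set PP := fun s t => ev scp N _ (X s t).
have const : (prodP PP a D)`_0 = prodP (fun s t => ev scalar_mx N (fun i => lambda *: E i) (X
  s t)) a D.
  have := horner_prodP lambda 0 E X a D; rewrite addr0 => <-.
  by rewrite -horner_coef0; congr horner; rewrite raddf0.
(* The control is known to be at most d^N only up to points strictly before b. The last step of D is
   split off: its length below d1 makes the control at most e0, so its factor is within 1 of the
   unit and costs 2. *)
have bound : pnorm 1 (prodP PP a D) <= 2 * C.
  have piece a' D' : a <= a' -> a' <= T -> (a < a' -> a' < b) ->
    part (Num.min delta (Num.min d1 d2)) a a' D' ->
      pnorm 1 (prodP PP a D') <= C.
    move=> aa' a'T a'b hD'; apply: (hC m X (dvar (coord_pvar p X)) a a' hm (ctrl_sub tj0 a'T cX)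
      (multiplicative_sub tj0 a'T mX) (holder_sub tj0 a'T hX) _ _ _ hD').
    have [e_a|na] := eqVneq a a'; first by rewrite -e_a (ctrl_diag cX).
    have {}aa' : a < a' by rewrite lt_neqAle na.
    by have [] := dvar_coord_pvar_small (ltW aa') (coord_pvar_pvar_norm hp d0 (ltW aa') (pv
      a' aa' (a'b aa'))).
  case/lastP: D {const} hD => [|D t] hD.
    apply: le_trans (piece a [::] (lexx _) tjT _ (erefl a)) _; first by rewrite ltxx.
    by lra.
  have [-> hD' lb bl] := part_rcons hD; set a' := last a D in hD' lb bl.
  have aa' := part_le hD'; have a'0 := le_trans tj0 aa'.
  rewrite -cats1 prodP_cat /= mulr1 -/a'.
  have om_e : dvar (coord_pvar p X) a' b <= e0.
    apply: hd1 => //; first exact: ltW.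
    by apply: lt_le_trans bl _; rewrite !ge_min lexx !orbT.
  have [near _] := sew m X _ a' b hm (ctrl_sub a'0 bT cX) (multiplicative_sub a'0 bT mX)
    (holder_sub a'0 bT hX) om_e.
  apply: le_trans (nrm_near1 h1 _ (near a' b (lexx _) (ltW lb) (lexx _))) _.
  apply: ler_wpM2l => //; apply: (piece a' D) => //.
  exact: le_trans (ltW lb) bT.
have near := pnorm_mul_near (prodP PP 0 D0) (ltW r0) r1 _ bound.
have nearo : forall A : Mat, hsn (A * (prodP PP a D)`_0) <= (1 + eta / 2) * hsn A.
  move=> A; rewrite const; apply: (hd2 a b) => //.
  by apply: part_weaken hD; rewrite !ge_min lexx !orbT.
apply: le_trans (near _ nearo) _.
rewrite exprSr [leRHS]mulrA [leLHS]mulrC; apply: ler_pM => //.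
- exact: (nrm_ge0 (pnorm_ring_norm k (ltW r0))).
- by rewrite addr_ge0 ?addr_ge0 ?mulr_ge0 // ?divr_ge0 // ltW.
by apply: le_trans (expR_ge1Dx _); lra.
Qed.

End Greedy.

(** * The derivative bound for a linear rough differential equation *)

Section DerivativeBound.
Variables (R : realType) (d k : nat) (p : R).
Local Notation N := (Num.truncn p).
Local Notation hsn := (@hs_norm R k.+1 k.+1).
Hypotheses (hp : 2 < p) (d0 : (0 < d)%N).

(** The truncated predecessor covers J = 0, the case that occurs for T = 0, where the count is
    bounded below by 0. *)
Lemma greedy_count_ge T (X : R -> R -> tseries R d) J : (forall j, (j < J)%N ->
  greedy_time p T X j < T) ->
  ((J.-1)%:R%:E <= greedy_count p T X)%E.
Proof.
case: J => [|J] h; first by rewrite /greedy_count le_max lexx.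
rewrite /greedy_count le_max; apply/orP; right.
by apply: ereal_sup_ubound; exists J => //; exact: h.
Qed.

Lemma rde_derivative_bound (M : {linear 'rV[R]_d -> 'M[R]_k.+1}) (Lambda eta : R) :
  (forall v, so (M v)) -> 0 <= Lambda -> 0 < eta -> exists2 r, 0 < r &
  forall gamma T (X : R -> R -> tseries R d) (Y : R -> R -> 'M[R]_k.+1), 0 <= T ->
  is_rough_path p gamma T X ->
  (forall lambda, solves_linear_rde p T (fun v => lambda *: M v) X (Y lambda)) ->
  forall lambda n, `|lambda| <= Lambda ->
  ((hsn (deriv_param n (fun l => Y l T) lambda))%:E <=
    (n`!%:R / r ^+ n * Num.sqrt k.+1%:R * expR eta)%:E
      * expeR (eta%:E * greedy_count p T X))%E.
Proof.
move=> hM La0 eta0; pose E (i : 'I_d) := M (delta_mx 0 i).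
have [r r0 hr] := greedy_constant hp d0 E La0 eta0.
exists r => // gamma T X Y T0 /rough_path_multiplicative mX hY lambda n hla.
have linE l : (fun v : 'rV[R]_d => l *: M v) = (fun v => \sum_i v 0 i *: (l *: E i)).
  apply/funext => v; rewrite {1}(row_sum_delta v) linear_sum scaler_sumr.
  by apply: eq_bigr => i _; rewrite linearZ /= !scalerA mulrC.
have ET l i : (l *: E i)^T = - (l *: E i) by rewrite linearZ /= hM scalerN.
have c0 m : 0 <= m`!%:R / r ^+ m * Num.sqrt k.+1%:R :> R.
  by rewrite mulr_ge0 ?sqrtr_ge0 // divr_ge0 // exprn_ge0 // ltW.
have e0 : 0 < n`!%:R / r ^+ n * Num.sqrt k.+1%:R * expR eta.
  by rewrite !mulr_gt0 ?expR_gt0 ?invr_gt0 ?exprn_gt0 ?ltr0n ?fact_gt0 // sqrtr_gt0 ltr0n.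
(* If the greedy times never reach T, the count is infinite, and so is the right-hand side. *)
have [[J hJ]|allJ] := pselect (exists j, T <= greedy_time p T X j); last first.
  have hN : greedy_count p T X = +oo%E.
    apply/eqyP => A A0; have lt_all j : greedy_time p T X j < T.
      by rewrite ltNge; apply/negP => h; apply: allJ; exists j.
    apply: le_trans (@greedy_count_ge T X (Num.Def.archi_bound A).+1 (fun j _ => lt_all j)).
    by rewrite lee_fin ltW // archi_boundP // ltW.
  rewrite hN gt0_muley ?lte_fin // /= gt0_muley ?lte_fin //; exact: leey.
have {J hJ} [J hJ minJ] : exists2 J, T <= greedy_time p T X J & forall j, (j < J)%N ->
  greedy_time p T X j < T.
  have ex : exists j, T <= greedy_time p T X j by exists J.
  case: (ex_minnP ex) => j hj mj; exists j => // i ij.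
  by rewrite ltNge; apply/negP => /mj; rewrite leqNgt ij.
have eJ : greedy_time p T X J = T.
  by apply/eqP; rewrite eq_le hJ andbT; case: (greedy_time_bounds p X J T0).
(* Each parameter l comes with its own approximating paths, but these four conclusions no longer
   mention them. The third is used at lambda, the last at lambda + mu. *)
have sol l : [/\ (sup_dissections (coord_pvar p X) 0 T < +oo)%E,
  forall e, 0 < e -> exists2 delta, 0 < delta & forall s t, 0 <= s -> s <= t ->
     t <= T -> t - s < delta -> dvar (coord_pvar p X) s t <= e,
  forall e, 0 < e -> exists2 delta, 0 < delta &
     forall a b D (A : 'M[R]_k.+1), 0 <= a -> b <= T -> part delta a b D ->
     hsn (A * prodP (fun s t => ev scalar_mx N (fun i => l *: E i) (X s t)) a D) <= (1 + e) *
       hsn A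
  & forall e, 0 < e -> exists2 delta, 0 < delta & forall D, part delta 0 T D ->
     hsn (Y l T - prodP (fun s t => ev scalar_mx N (fun i => l *: E i) (X s t)) 0 D) <= e].
  have [_ [Xm [Ym [hX]]]] := hY l; rewrite linE => hode hlim; split.
  - exact: coord_pvar_fin hX.
  - by move=> e; exact: dvar_coord_pvar_small_itv hX e.
  - by move=> e; exact: (prodP_near_orthogonal hp d0 (ET l) T0 mX hX hode).
  - by move=> e; exact: (prodP_solution hp d0 (ET l) T0 mX hX hode hlim).
have [fX small orth _] := sol lambda.
have := hr lambda hla T X T0 mX fX small orth J; rewrite eJ => hD.
have /choice[D hDm] : forall m : nat, exists D, part (m.+1%:R^-1) 0 T D /\
    pnorm r (prodP (fun s t => ev (scalar_poly R k) N (fun i => pencil lambda (E i)) (X s t))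
      0 D)
      <= Num.sqrt k.+1%:R * expR eta ^+ J.
  by move=> m; have [|D h1 h2] := hD m.+1%:R^-1; [rewrite invr_gt0|exists D].
have bound := @deriv_param_bound R k (fun l => Y l T) (fun m => prodP (fun s t => ev
  (scalar_poly R k) N (fun i => pencil lambda (E i)) (X s t)) 0 (D m)) lambda r
  (Num.sqrt k.+1%:R * expR eta ^+ J) n r0 (fun m => (hDm m).2).
apply: (@le_trans _ _ (n`!%:R / r ^+ n * (Num.sqrt k.+1%:R * expR eta ^+ J))%:E).
  rewrite lee_fin; apply: bound => mu e e1.
  have [_ _ _ /(_ e e1)[dl dl0 hdl]] := sol (lambda + mu).
  exists (Num.Def.archi_bound dl^-1) => m hm; rewrite horner_prodP.
  apply: hdl; apply: part_weaken (hDm m).1.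
  rewrite invf_ple ?posrE ?ltr0n //.
  apply: le_trans (ltW (archi_boundP _)) _; first by rewrite invr_ge0 ltW.
  by rewrite ler_nat leqW.
have hN := greedy_count_ge minJ.
(* There are J greedy intervals against a count of at least J - 1: the remaining one is paid by the
   factor [expR eta], which is spare for J = 0. *)
apply: (@le_trans _ _ ((n`!%:R / r ^+ n * Num.sqrt k.+1%:R * expR eta)%:E * (expR (eta *
  (J.-1)%:R))%:E)%E).
  rewrite -EFinM lee_fin !mulrA -[leRHS]mulrA; apply: ler_wpM2l => //.
  rewrite expRM_natr -exprS; apply: ler_weXn2l; last by case: (J).
  by rewrite -expR0 ler_expR ltW.
apply: lee_wpmul2l; first by rewrite lee_fin ltW.
rewrite -[X in (X <= _)%E]/(expeR (eta * (J.-1)%:R)%:E) lee_expeR EFinM.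
by apply: lee_wpmul2l => //; rewrite lee_fin ltW.
Qed.

End DerivativeBound.

Theorem proposition3p11 (R : realType) (gamma : R -> R)
    (hgamma : forall q, 0 < gamma q)
    (p : R) (hp : 2 < p) (d k : nat) (hd : (1 <= d)%N) (hk : (1 <= k)%N)
    (M : {linear 'rV[R]_d -> 'M[R]_k}) (hM : forall v, so (M v))
    (eta : R) (heta : 0 < eta) (K : set R) (hK : bounded_set K) :
  exists r : R, 0 < r /\
    forall (disp : measure_display) (Omega : measurableType disp)
      (P : probability Omega R) (T : {RV P >-> R})
      (X : Omega -> R -> R -> tseries R d)
      (hX : is_random_geometric_rough_path p (gamma p) T X)
      (Y : Omega -> R -> R -> 'M[R]_k)
      (hY : forall omega lambda,
          solves_linear_rde p (T omega) (fun v => lambda *: M v) (X omega)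
            (Y omega lambda))
      (n : nat),
      let YT omega lambda :=
        deriv_param n (fun l => Y omega l (T omega)) lambda in
      let N omega := greedy_count p (T omega) (X omega) in
      let C := n`!%:R / r ^+ n * Num.sqrt k%:R * expR eta in
      (forall omega,
          (ereal_sup [set (hs_norm (YT omega lambda))%:E | lambda in K]
             <= C%:E * expeR (eta%:E * N omega))%E) /\
      (ereal_sup [set 'E_P [fun omega => hs_norm (YT omega lambda)] | lambda in K]
         <= C%:E * \int[P]_omega expeR (eta%:E * N omega))%E.
Proof.
(* Square matrices form a nonzero ring in positive size, which the type has to display. *)
case: k hk M hM => [//|k] _ M hM.
have [B [_ hB]] := hK.
(* Boundedness gives a bound by every number above B, hence by B + 1; B may be negative when K is
   empty. *)
pose Lambda := Num.max 0 (B + 1).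
have La0 : 0 <= Lambda by rewrite le_max lexx.
have hLa lambda : K lambda -> `|lambda| <= Lambda.
  by move=> Kl; rewrite le_max (hB (B + 1)) ?orbT // ltrDl.
have [r r0 hr] := rde_derivative_bound hp hd hM La0 heta.
exists r; split=> // disp Omega P T X [T0 gX _] Y hY n YT N C.
have C0 : 0 < C.
  by rewrite !mulr_gt0 ?expR_gt0 ?invr_gt0 ?exprn_gt0 ?ltr0n ?fact_gt0 // sqrtr_gt0 ltr0n.
have main omega lambda : K lambda ->
    ((hs_norm (YT omega lambda))%:E <= C%:E * expeR (eta%:E * N omega))%E.
  by move=> Kl; apply: hr; [exact: T0|exact: (gX omega).1|exact: hY|exact: hLa].
split=> [omega|]; apply: ge_ereal_sup => _ [lambda Kl <-]; first exact: main.
rewrite unlock; apply: integral_le_scale => // omega.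
- by rewrite lee_fin hs_norm_ge0.
- exact: expeR_ge0.
- exact: main.
Qed.
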